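(* Let $m>2$ and let $\mathcal R\in U_q[osp(m|n)]^-\otimes U_q[osp(m|n)]^+$ be the universal $R$-matrix of $U_q[osp(m|n)]$. The Lax operator $R=(\pi\otimes\mathrm{id})\mathcal R$ is given by $$R=q^{\sum_a h_a\otimes h^a}\Bigl[I\otimes I+(q-q^{-1})\sum_{\varepsilon_a<\varepsilon_b}(-1)^{[b]}E^a_b\otimes\hat\sigma_{ba}\Bigr]=\sum_aE^a_a\otimes q^{h_{\varepsilon_a}}+(q-q^{-1})\sum_{\varepsilon_a<\varepsilon_b}(-1)^{[b]}E^a_b\otimes q^{h_{\varepsilon_a}}\hat\sigma_{ba},$$ where the operators $\hat\sigma_{ba}$ ($a,b\in\mathcal I$, $\varepsilon_b>\varepsilon_a$) satisfy: (i) the $q$-commutation relations $$q^{(\alpha_c,\varepsilon_b)}\hat\sigma_{ba}e_cq^{\frac12h_c}-(-1)^{([a]+[b])[c]}q^{-(\alpha_c,\varepsilon_a)}e_cq^{\frac12h_c}\hat\sigma_{ba}=0,\qquad\varepsilon_b>\varepsilon_a,$$ for every simple root $\alpha_c$ such that neither $\varepsilon_a-\alpha_c$ nor $\varepsilon_b+\alpha_c$ equals $\varepsilon_x$ for any $x\in\mathcal I$ (here $[c]$ is the grading of $e_c$); and (ii) the recursion relations $$\hat\sigma_{ba}=q^{-(\varepsilon_b,\varepsilon_a)}\hat\sigma_{bc}\hat\sigma_{ca}-q^{-(\varepsilon_c,\varepsilon_c)}(-1)^{([b]+[c])([a]+[c])}\hat\sigma_{ca}\hat\sigma_{bc},\qquad\varepsilon_b>\varepsilon_c>\varepsilon_a,$$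 for $a,b,c\in\mathcal I$ with $c\ne\overline b$ and $c\ne\overline a$; and with initial values given by $$\hat\sigma_{i\,i+1}=-\hat\sigma_{\overline{i+1}\,\overline{i}}=q^{\frac12}e_iq^{\frac12h_i}\quad(1\le i<l),$$ $$\hat\sigma_{l-1\,\overline{l}}=-\hat\sigma_{l\,\overline{l-1}}=q^{\frac12}e_lq^{\frac12h_l}\quad(m=2l),$$ $$\hat\sigma_{l\,l+1}=-q^{-\frac12}\hat\sigma_{l+1\,\overline{l}}=e_lq^{\frac12h_l}\quad(m=2l+1),$$ $$\hat\sigma_{\mu\,\mu+1}=\hat\sigma_{\overline{\mu+1}\,\overline{\mu}}=q^{-\frac12}e_\mu q^{\frac12h_\mu}\quad(1\le\mu<k),$$ $$\hat\sigma_{\mu=k\;i=1}=(-1)^kq\,\hat\sigma_{\overline{i}=\overline{1}\;\overline{\mu}=\overline{k}}=q^{\frac12}e_sq^{\frac12h_s},$$ $$\hat\sigma_{l\,\overline{l}}=0\quad(m=2l).$$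
   Context: Throughout $m>2$ and $n=2k\ge2$ are integers, $l=\lfloor m/2\rfloor$, and $q$ is a nonzero complex number that is not a root of unity (with fixed choices of the powers $q^x$ used). Indices. $\mathcal I$ is the disjoint union of even indices $i\in\{1,\dots,m\}$ (grading $[i]=0$, Latin letters) and odd indices $\mu\in\{1,\dots,n\}$ (grading $[\mu]=1$, Greek letters). Writing $i=1$ or $\mu=k$ as a subscript specifies the even index $1$ or the odd index $k$. Put $\overline{i}=m+1-i$, $\overline{\mu}=n+1-\mu$, and $\xi_i=1$, $\xi_\mu=(-1)^\mu$. Weights. To $a\in\mathcal I$ is attached a weight $\varepsilon_a$ (also written $\delta_\mu$ if $a=\mu$ is odd) with $\varepsilon_{\overline a}=-\varepsilon_a$ (so $\varepsilon_{l+1}=0$ if $m=2l+1$); $\varepsilon_1,\dots,\varepsilon_l,\delta_1,\dots,\delta_k$ are linearly independent, with bilinear form $(\varepsilon_i,\varepsilon_j)=\delta^i_j$, $(\delta_\mu,\delta_\nu)=-\delta^\mu_\nu$, $(\varepsilon_i,\delta_\mu)=0$ for $1\le i,j\le l$, $1\le\mu,\nu\le k$. Weights are totally ordered by $\delta_1>\dots>\delta_k>\varepsilon_1>\dots>\varepsilon_m>\delta_{k+1}>\dots>\delta_n$. Simple roots: $\alpha_i=\varepsilon_i-\varepsilon_{i+1}$ ($1\le i<l$); $\alpha_l=\varepsilon_l+\varepsilon_{l-1}$ if $m=2l$, $\alpha_l=\varepsilon_l$ if $m=2l+1$; $\alpha_\mu=\delta_\mu-\delta_{\mu+1}$ ($1\le\mu<k$);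 $\alpha_s=\delta_k-\varepsilon_1$ (the only odd simple root). $U_q[osp(m|n)]$ is the $\mathbb Z_2$-graded unital associative algebra generated by raising generators $e_c$, lowering generators $f_c$ (one pair for each simple root $\alpha_c$; $e_s,f_s$ odd, the rest even) and the Cartan subalgebra $H$, spanned by elements $h_\lambda$ linear in the weight $\lambda$, together with all $q^{h}$, $h\in H$; $h_c:=h_{\alpha_c}$. With graded commutator $[A,B]=AB-(-1)^{[A][B]}BA$, the relations are: $[h_\lambda,h_{\lambda'}]=0$, $[h_\lambda,e_c]=(\lambda,\alpha_c)e_c$, $[h_\lambda,f_c]=-(\lambda,\alpha_c)f_c$, $[e_c,f_d]=\delta^c_d\frac{q^{h_c}-q^{-h_c}}{q-q^{-1}}$, $[e_c,e_c]=[f_c,f_c]=0$ if $(\alpha_c,\alpha_c)=0$, and the standard and extra (higher order) $q$-Serre relations. In terms of $E_c=e_cq^{\frac12h_c}$ and $[E_c,x]_q=\mathrm{ad}E_c\circ x=E_cx-(-1)^{[E_c][x]}q^{(\alpha_c,\mathrm{wt}\,x)}xE_c$, the standard ones are $(\mathrm{ad}E_b\,\circ)^{1-a_{bc}}E_c=0$ for $b\ne c$ (where $a_{bc}=2(\alpha_b,\alpha_c)/(\alpha_b,\alpha_b)$ if $(\alpha_b,\alpha_b)\neq0$; and for $(\alpha_b,\alpha_b)=0$ the relation $\mathrm{ad}E_b\circ E_c=0$ when $(\alpha_b,\alpha_c)=0$), and similarly for $F_c=f_cq^{\frac12h_c}$; the extra ones are those of the standard presentation of the quantum superalgebra for this Dynkin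 diagram (Yamane, Publ. RIMS 35 (1999)), e.g. for $k\ge2$: $[E_s,[E_{\mu=k-1},[E_s,E_{i=1}]_q]_q]_q=0=[E_s,[E_{i=1},[E_s,E_{\mu=k-1}]_q]_q]_q$. Tensor products are graded: $(a\otimes b)(c\otimes d)=(-1)^{[b][c]}ac\otimes bd$. The coproduct is the algebra homomorphism with $\Delta(e_c)=q^{\frac12h_c}\otimes e_c+e_c\otimes q^{-\frac12h_c}$, $\Delta(f_c)=q^{\frac12h_c}\otimes f_c+f_c\otimes q^{-\frac12h_c}$, $\Delta(q^{h})=q^{h}\otimes q^{h}$. The graded twist is $T(a\otimes b)=(-1)^{[a][b]}b\otimes a$ and $\Delta^T=T\Delta$. $U_q[osp(m|n)]^+$ (resp. $U_q[osp(m|n)]^-$) is the Hopf subsuperalgebra generated by the raising (resp. lowering) generators and Cartan elements. A universal $R$-matrix is an even invertible element $\mathcal R$ of (a suitable completion of) $U_q[osp(m|n)]^{\otimes2}$ with $\mathcal R\Delta(a)=\Delta^T(a)\mathcal R$ for all $a$, $(\mathrm{id}\otimes\Delta)\mathcal R=\mathcal R_{13}\mathcal R_{12}$, $(\Delta\otimes\mathrm{id})\mathcal R=\mathcal R_{13}\mathcal R_{23}$. There is a unique one in $U_q[osp(m|n)]^-\otimes U_q[osp(m|n)]^+$ (completed), arising from Drinfeld's double construction. Vector representation. $V$ is the $(m+n)$-dimensional graded space with homogeneous basis $|a\rangle$, $a\in\mathcal I$; $E^a_b|c\rangle=\delta^c_b|a\rangle$, and $E^a_b$ has grading $[a]+[b]$.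 Put $\Sigma^a_b=E^a_b-(-1)^{[a]([a]+[b])}\xi_a\xi_bE^{\overline b}_{\overline a}$. Then $\pi:U_q[osp(m|n)]\to\mathrm{End}\,V$ is given by $\pi(h_{\varepsilon_a})=(-1)^{[a]}\Sigma^a_a$; $\pi(e_i)=\Sigma^i_{i+1}$, $\pi(f_i)=\Sigma^{i+1}_i$ ($1\le i<l$); $\pi(e_l)=\Sigma^{l-1}_{\overline l}$, $\pi(f_l)=\Sigma^{\overline l}_{l-1}$ if $m=2l$; $\pi(e_l)=\Sigma^l_{l+1}$, $\pi(f_l)=\Sigma^{l+1}_l$ if $m=2l+1$; $\pi(e_\mu)=\Sigma^\mu_{\mu+1}$, $\pi(f_\mu)=-\Sigma^{\mu+1}_\mu$ ($1\le\mu<k$); $\pi(e_s)=\Sigma^{\mu=k}_{i=1}$, $\pi(f_s)=-\Sigma^{i=1}_{\mu=k}$. In $q^{\sum_ah_a\otimes h^a}$ the sum runs over the basis $\{h_{\varepsilon_i}\}_{1\le i\le l}\cup\{h_{\delta_\mu}\}_{1\le\mu\le k}$ of $H$ (written $h_a=h_{\varepsilon_a}$), with dual basis $h^a=(-1)^{[a]}h_{\varepsilon_a}$, and the first tensor factor is taken in the representation $\pi$. All other sums over $a$ or $(a,b)$ run over $\mathcal I$. *)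

(* Defs.v *)
(* The complex numbers are R[i], for R : realType. *)
From HB Require Import structures.
From mathcomp Require Import all_boot all_order all_algebra.
From mathcomp Require Import boolp reals complex.

Set Implicit Arguments.
Unset Strict Implicit.
Unset Printing Implicit Defensive.

Import GRing.Theory.
Local Open Scope ring_scope.
Local Open Scope quotient_scope.

Inductive term (K : Type) (G : Type) : Type :=
  | TGen of G
  | TScal of K
  | TAdd of term K G & term K G
  | TMul of term K G & term K G.
Arguments TGen {K G}.
Arguments TScal {K G}.

HB.instance Definition _ (K G : Type) := gen_eqMixin (term K G).
HB.instance Definition _ (K G : Type) := gen_choiceMixin (term K G).

Fixpoint teval (K : comNzRingType) (G : Type) (A : algType K) (phi : G -> A)
    (t : term K G) : A :=
  match t with
  | TGen g => phi g
  | TScal c => c%:A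
  | TAdd t1 t2 => teval phi t1 + teval phi t2
  | TMul t1 t2 => teval phi t1 * teval phi t2
  end.

(* [pgrad g] is the image of the generator g under the grading involution
   x |-> (-1)^[x] x, e.g. -g for an odd generator g; [prel phi] states that the
   family phi satisfies the defining relations.  The last field (some nonzero
   superalgebra satisfies the relations) is what makes the quotient nonzero. *)
Record presentation (K : comNzRingType) := Presentation {
  pgen : Type;
  pgrad : pgen -> term K pgen;
  prel : forall A : algType K, (pgen -> A) -> Prop;
  pnontrivial : exists (A : algType K) (th : {lrmorphism A -> A}) (phi : pgen -> A),
    [/\ involutive th, forall g, th (phi g) = teval phi (pgrad g) & prel phi]
}.

(* A superalgebra is an algebra A with the involution th x = (-1)^[x] x.  Two
   terms are identified when they agree in every superalgebra satisfying the
   relations; hence [pres P] below is the universal such superalgebra, i.e. the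
   Z_2-graded unital associative algebra presented by P. *)
Definition term_equiv (K : comNzRingType) (P : presentation K)
    (s t : term K (pgen P)) : Prop :=
  forall (A : algType K) (th : {lrmorphism A -> A}) (phi : pgen P -> A),
    involutive th -> (forall g, th (phi g) = teval phi (pgrad g)) ->
    prel phi -> teval phi s = teval phi t.

Definition term_eqb (K : comNzRingType) (P : presentation K) :
    rel (term K (pgen P)) := fun s t => `[< term_equiv s t >].

Section Presented.
Variables (K : comNzRingType) (P : presentation K).

Lemma term_eqb_equiv : equiv_class_of (@term_eqb K P).
Proof.
split.
- by move=> s; apply/asboolP.
- move=> s t; apply/idP/idP => /asboolP st; apply/asboolP => A th phi *;
  by apply/esym/st.
- move=> t s u /asboolP st /asboolP tu; apply/asboolP => A th phi h1 h2 h3.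
  by rewrite (st A th phi h1 h2 h3) (tu A th phi h1 h2 h3).
Qed.

Canonical term_eqb_equiv_rel := EquivRelPack term_eqb_equiv.

Definition pres : Type := {eq_quot (@term_eqb K P)}.
HB.instance Definition _ := Choice.on pres.
HB.instance Definition _ := EqQuotient.on pres.

Definition pcls (t : term K (pgen P)) : pres := \pi_pres t.
Definition prepr (x : pres) : term K (pgen P) := repr x.

Lemma preprK x : pcls (prepr x) = x.
Proof. exact: reprK. Qed.

Lemma pclsP s t : pcls s = pcls t <-> term_equiv s t.
Proof.
rewrite /pcls; split => [/eqmodP/asboolP //|st].
by apply/eqmodP/asboolP.
Qed.

Lemma prepr_cls t : term_equiv (prepr (pcls t)) t.
Proof. by apply/pclsP; rewrite preprK. Qed.

Definition padd (x y : pres) := pcls (TAdd (prepr x) (prepr y)).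
Definition pmul (x y : pres) := pcls (TMul (prepr x) (prepr y)).
Definition pscale (c : K) (x : pres) := pcls (TMul (TScal c) (prepr x)).
Definition popp (x : pres) := pscale (-1) x.
Definition pzero : pres := pcls (TScal 0).
Definition pone : pres := pcls (TScal 1).

Lemma pcls_ind (Q : pres -> Prop) : (forall t, Q (pcls t)) -> forall x, Q x.
Proof. by move=> h x; rewrite -(preprK x). Qed.

Lemma paddE s t : padd (pcls s) (pcls t) = pcls (TAdd s t).
Proof.
by apply/pclsP => A th phi h1 h2 h3 /=; rewrite !(prepr_cls _ h1 h2 h3).
Qed.

Lemma pmulE s t : pmul (pcls s) (pcls t) = pcls (TMul s t).
Proof.
by apply/pclsP => A th phi h1 h2 h3 /=; rewrite !(prepr_cls _ h1 h2 h3).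
Qed.

Lemma pscaleE c t : pscale c (pcls t) = pcls (TMul (TScal c) t).
Proof.
by apply/pclsP => A th phi h1 h2 h3 /=; rewrite !(prepr_cls _ h1 h2 h3).
Qed.

Let pE := (paddE, pmulE, pscaleE).

Fact paddA : associative padd.
Proof.
elim/pcls_ind => x; elim/pcls_ind => y; elim/pcls_ind => z; rewrite !pE.
by apply/pclsP => A th phi *; rewrite /= addrA.
Qed.
Fact paddC : commutative padd.
Proof.
elim/pcls_ind => x; elim/pcls_ind => y; rewrite !pE.
by apply/pclsP => A th phi *; rewrite /= addrC.
Qed.
Fact padd0 : left_id pzero padd.
Proof.
elim/pcls_ind => x; rewrite !pE.
by apply/pclsP => A th phi *; rewrite /= scale0r add0r.
Qed.
Fact paddN : left_inverse pzero popp padd.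
Proof.
elim/pcls_ind => x; rewrite /popp !pE.
by apply/pclsP => A th phi *; rewrite /= scaleN1r mulN1r addNr scale0r.
Qed.
Fact pmulA : associative pmul.
Proof.
elim/pcls_ind => x; elim/pcls_ind => y; elim/pcls_ind => z; rewrite !pE.
by apply/pclsP => A th phi *; rewrite /= mulrA.
Qed.
Fact pmul1 : left_id pone pmul.
Proof.
elim/pcls_ind => x; rewrite !pE.
by apply/pclsP => A th phi *; rewrite /= scale1r mul1r.
Qed.
Fact pmulr1 : right_id pone pmul.
Proof.
elim/pcls_ind => x; rewrite !pE.
by apply/pclsP => A th phi *; rewrite /= scale1r mulr1.
Qed.
Fact pmulDl : left_distributive pmul padd.
Proof.
elim/pcls_ind => x; elim/pcls_ind => y; elim/pcls_ind => z; rewrite !pE.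
by apply/pclsP => A th phi *; rewrite /= mulrDl.
Qed.
Fact pmulDr : right_distributive pmul padd.
Proof.
elim/pcls_ind => x; elim/pcls_ind => y; elim/pcls_ind => z; rewrite !pE.
by apply/pclsP => A th phi *; rewrite /= mulrDr.
Qed.
Fact pone_neq0 : pone != pzero.
Proof.
apply/eqP => /pclsP h.
have [A [th [phi [h1 h2 h3]]]] := pnontrivial P.
have := h A th phi h1 h2 h3.
by rewrite /= scale0r scale1r => /eqP; rewrite oner_eq0.
Qed.

HB.instance Definition _ := GRing.isZmodule.Build pres paddA paddC padd0 paddN.
HB.instance Definition _ :=
  GRing.Zmodule_isNzRing.Build pres pmulA pmul1 pmulr1 pmulDl pmulDr pone_neq0.

Fact pscaleA a b v : pscale a (pscale b v) = pscale (a * b) v.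
Proof.
elim/pcls_ind: v => x; rewrite !pE.
by apply/pclsP => A th phi *; rewrite /= !mulr_algl scalerA.
Qed.
Fact pscale1 : left_id 1 pscale.
Proof.
elim/pcls_ind => x; rewrite !pE.
by apply/pclsP => A th phi *; rewrite /= scale1r mul1r.
Qed.
Fact pscaleDr : right_distributive pscale +%R.
Proof.
move=> c; elim/pcls_ind => x; elim/pcls_ind => y.
rewrite -![LHS]/(pscale _ (padd _ _)) -![RHS]/(padd _ _) !pE.
by apply/pclsP => A th phi *; rewrite /= mulrDr.
Qed.
Fact pscaleDl v : {morph pscale^~ v : a b / a + b}.
Proof.
move=> a b; elim/pcls_ind: v => x; rewrite -![RHS]/(padd _ _) !pE.
by apply/pclsP => A th phi *; rewrite /= scalerDl mulrDl.
Qed.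
HB.instance Definition _ :=
  GRing.Zmodule_isLmodule.Build K pres pscaleA pscale1 pscaleDr pscaleDl.

Fact pscaleAl (a : K) (u v : pres) : a *: (u * v) = (a *: u) * v.
Proof.
elim/pcls_ind: u => x; elim/pcls_ind: v => y.
rewrite -![LHS]/(pscale _ (pmul _ _)) -![RHS]/(pmul (pscale _ _) _) !pE.
by apply/pclsP => A th phi *; rewrite /= mulrA.
Qed.
HB.instance Definition _ := GRing.Lmodule_isLalgebra.Build K pres pscaleAl.

Fact pscaleAr (a : K) (u v : pres) : a *: (u * v) = u * (a *: v).
Proof.
elim/pcls_ind: u => x; elim/pcls_ind: v => y.
rewrite -![LHS]/(pscale _ (pmul _ _)) -![RHS]/(pmul _ (pscale _ _)) !pE.
by apply/pclsP => A th phi *; rewrite /= !mulr_algl scalerAr.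
Qed.
HB.instance Definition _ := GRing.Lalgebra_isAlgebra.Build K pres pscaleAr.

Lemma pclsD s t : pcls s + pcls t = pcls (TAdd s t).
Proof. exact: paddE. Qed.
Lemma pclsM s t : pcls s * pcls t = pcls (TMul s t).
Proof. exact: pmulE. Qed.
Lemma pclsZ c t : c *: pcls t = pcls (TMul (TScal c) t).
Proof. exact: pscaleE. Qed.
Lemma pcls1 : 1 = pcls (TScal 1).
Proof. by []. Qed.

Let cE := (pclsD, pclsM, pclsZ).

Definition pinj (g : pgen P) : pres := pcls (TGen g).

Fixpoint tgrad (t : term K (pgen P)) : term K (pgen P) :=
  match t with
  | TGen g => pgrad g
  | TScal c => TScal c
  | TAdd t1 t2 => TAdd (tgrad t1) (tgrad t2)
  | TMul t1 t2 => TMul (tgrad t1) (tgrad t2)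
  end.

(* the grading involution x |-> (-1)^[x] x *)
Definition grad (x : pres) : pres := pcls (tgrad (prepr x)).

Lemma tgradE (A : algType K) (th : {lrmorphism A -> A}) (phi : pgen P -> A) :
  (forall g, th (phi g) = teval phi (pgrad g)) ->
  forall t, teval phi (tgrad t) = th (teval phi t).
Proof.
move=> h; elim=> [g|c|s hs t ht|s hs t ht] /=.
- by rewrite h.
- by rewrite linearZ /= rmorph1.
- by rewrite hs ht rmorphD.
- by rewrite hs ht rmorphM.
Qed.

Lemma gradE t : grad (pcls t) = pcls (tgrad t).
Proof.
apply/pclsP => A th phi h1 h2 h3.
by rewrite !(tgradE h2) (prepr_cls _ h1 h2 h3).
Qed.

Fact grad_linear : linear grad.
Proof.
move=> a; elim/pcls_ind => x; elim/pcls_ind => y.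
by rewrite [in LHS]pclsZ [in LHS]pclsD !gradE pclsZ pclsD.
Qed.
Fact grad_multiplicative : monoid_morphism grad.
Proof.
split; first by rewrite pcls1 gradE.
by elim/pcls_ind => x; elim/pcls_ind => y; rewrite [in LHS]pclsM !gradE pclsM.
Qed.
HB.instance Definition _ := GRing.isLinear.Build K pres pres _ grad grad_linear.
HB.instance Definition _ :=
  GRing.isMonoidMorphism.Build pres pres grad grad_multiplicative.

Lemma gradK : involutive grad.
Proof.
elim/pcls_ind => x; rewrite !gradE; apply/pclsP => A th phi h1 h2 h3.
by rewrite !(tgradE h2) h1.
Qed.

Definition homog (p : bool) (x : pres) : bool := grad x == (-1) ^+ p *: x.

Section Lift.
Variables (A : algType K) (th : {lrmorphism A -> A}) (phi : pgen P -> A).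
Hypothesis thK : involutive th.
Hypothesis th_phi : forall g, th (phi g) = teval phi (pgrad g).
Hypothesis phi_rel : prel phi.

Let F (x : pres) : A := teval phi (prepr x).

Let FE t : F (pcls t) = teval phi t.
Proof. exact: (prepr_cls _ thK th_phi phi_rel). Qed.

Let F_linear : linear F.
Proof.
move=> a; elim/pcls_ind => x; elim/pcls_ind => y.
by rewrite !cE !FE /= mulr_algl.
Qed.

Let F_multiplicative : monoid_morphism F.
Proof.
split; first by rewrite pcls1 FE /= scale1r.
by elim/pcls_ind => x; elim/pcls_ind => y; rewrite !cE !FE.
Qed.

Lemma pres_lift : exists f : {lrmorphism pres -> A},
  (forall g, f (pinj g) = phi g) /\ (forall x, f (grad x) = th (f x)).
Proof.
pose lF := GRing.isLinear.Build K pres A _ F F_linear.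
pose mF := GRing.isMonoidMorphism.Build pres A F F_multiplicative.
pose f : {lrmorphism pres -> A} := HB.pack F lF mF.
exists f; split=> [g|]; first exact: FE.
by elim/pcls_ind => x; rewrite gradE /= !FE (tgradE th_phi).
Qed.
End Lift.

Lemma pres_ext (x y : pres) :
  (forall (A : algType K) (phi : pgen P -> A) (f : {lrmorphism pres -> A}),
     prel phi -> (forall g, f (pinj g) = phi g) -> f x = f y) -> x = y.
Proof.
elim/pcls_ind: x => s; elim/pcls_ind: y => t h.
apply/pclsP => A th phi h1 h2 h3.
have [f [fE _]] := pres_lift h1 h2 h3.
have fcls u : f (pcls u) = teval phi u.
  elim: u => [g|c|u hu v hv|u hu v hv] /=.
  - exact: fE.
  - rewrite -[c in LHS]mulr1 -(rmorph1 f) -linearZ /=; congr (f _).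
    rewrite pcls1 pclsZ; apply/pclsP => B th' psi _ _ _ /=.
    by rewrite mulr1 scale1r mulr1.
  - by rewrite -pclsD rmorphD /= hu hv.
  - by rewrite -pclsM rmorphM /= hu hv.
by rewrite -!fcls; apply: h h3 fE.
Qed.

End Presented.

Section SubAlgebra.
Variables (K : comNzRingType) (A : algType K) (S : A -> Prop).
Inductive subalgebra : A -> Prop :=
  | subalgebra_gen x of S x : subalgebra x
  | subalgebra_scal c : subalgebra c%:A
  | subalgebra_add x y of subalgebra x & subalgebra y : subalgebra (x + y)
  | subalgebra_mul x y of subalgebra x & subalgebra y : subalgebra (x * y).
End SubAlgebra.

(* The graded tensor square of the superalgebra pres P, as the superalgebra
   generated by two copies of pres P with
   (1 (x) y)(x (x) 1) = (-1)^([x][y]) (x (x) 1)(1 (x) y). *)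
Section TensorSquare.
Variables (K : comNzRingType) (P : presentation K).
Local Notation U := (pres P).

Definition alg_hom (B : algType K) (f : U -> B) : Prop :=
  [/\ forall c x y, f (c *: x + y) = c *: f x + f y,
      f 1 = 1 & forall x y, f (x * y) = f x * f y].

Definition tsq_grad (g : U + U) : term K (U + U) :=
  match g with
  | inl x => TGen (inl (grad x))
  | inr x => TGen (inr (grad x))
  end.

Definition tsq_rel (B : algType K) (phi : U + U -> B) : Prop :=
  [/\ alg_hom (fun x => phi (inl x)),
      alg_hom (fun x => phi (inr x)) &
      forall (p r : bool) (x y : U), homog p x -> homog r y ->
        phi (inr y) * phi (inl x) =
        (-1) ^+ (p && r) *: (phi (inl x) * phi (inr y))].

(* aug is an augmentation (counit) of pres P; it only serves to prove that the
   tensor square is not the zero ring *)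
Variables (aug : {lrmorphism U -> K^o}) (aug_grad : forall x, aug (grad x) = aug x).

Fact tsq_nontrivial : exists (B : algType K) (th : {lrmorphism B -> B})
    (phi : U + U -> B),
  [/\ involutive th, forall g, th (phi g) = teval phi (tsq_grad g) & tsq_rel phi].
Proof.
have hom : alg_hom (aug : U -> (K^o : algType K)).
  by split=> [c x y||x y]; rewrite ?linearP ?rmorph1 ?rmorphM.
exists (K^o : algType K), idfun, (fun g => match g with inl x | inr x => aug x end).
split=> //; first by case=> x /=; rewrite aug_grad.
split=> // p r x y hx hy.
case: p hx => [/eqP hx|_] /=; last by rewrite scale1r; apply: mulrC.
case: r hy => [/eqP hy|_] /=; last by rewrite scale1r; apply: mulrC.
have e2 (z : U) : grad z = (-1) ^+ true *: z -> aug z = - aug z.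
  by move=> hz; rewrite -{1}aug_grad hz linearZ /= scaleN1r.
rewrite expr1 scaleN1r -mulNr -(e2 _ hx); exact: mulrC.
Qed.

Definition tsq_presentation : presentation K :=
  Presentation tsq_nontrivial.
End TensorSquare.

(* 1-based labels: [ev i] is the even index i, [od mu] the odd index mu. *)
Definition idx : Type := (bool * nat)%type.
HB.instance Definition _ := Equality.on idx.
Definition ev (i : nat) : idx := (false, i).
Definition od (mu : nat) : idx := (true, mu).

Section OSp.
Variables (R : realType) (m k : nat).
Local Notation C := R[i].
Local Notation n := (2 * k)%N.
Local Notation l := m./2.

Definition indices : seq idx :=
  [seq ev i | i <- iota 1 m] ++ [seq od mu | mu <- iota 1 n].

Definition ibar (a : idx) : idx := (a.1, ((if a.1 then n else m) + 1 - a.2)%N).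

Definition xi (a : idx) : C := if a.1 then (-1) ^+ a.2 else 1.

(* Weights, identified with the elements of H through lambda |-> h_lambda; the
   components are the coordinates on eps_1..eps_l and delta_1..delta_k. *)
Definition weight : Type := ('rV[C]_l * 'rV[C]_k)%type.
HB.instance Definition _ := GRing.Lmodule.on weight.

Definition eps (a : idx) : weight :=
  if a.1
  then (0, \row_(j < k) ((j.+1 == a.2)%:R - (j.+1 == (ibar a).2)%:R))
  else (\row_(j < l) ((j.+1 == a.2)%:R - (j.+1 == (ibar a).2)%:R), 0).

Definition wform (x y : weight) : C :=
  \sum_(i < l) x.1 0 i * y.1 0 i - \sum_(j < k) x.2 0 j * y.2 0 j.

(* position in the decreasing list
   delta_1 > .. > delta_k > eps_1 > .. > eps_m > delta_(k+1) > .. > delta_n *)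
Definition position (a : idx) : nat :=
  if a.1 then (if a.2 <= k then a.2 else m + a.2)%N else (k + a.2)%N.

(* eps_a < eps_b *)
Definition wlt (a b : idx) : bool := (position b < position a)%N.

(* [sE i] has root alpha_(i+1), [sO mu] has root alpha_(mu+1) (1-based odd
   index), [sS] has the odd simple root alpha_s. *)
Inductive sroot : Type := sE of 'I_l | sO of 'I_k.-1 | sS.

Definition spar (c : sroot) : bool := if c is sS then true else false.

Definition alpha (c : sroot) : weight :=
  match c with
  | sE i =>
      if (i.+1 < l)%N then eps (ev i.+1) - eps (ev i.+2)
      else if odd m then eps (ev l) else eps (ev l) + eps (ev l.-1)
  | sO mu => eps (od mu.+1) - eps (od mu.+2)
  | sS => eps (od k) - eps (ev 1)
  end.

(* q is the deformation parameter and [qp x] the chosen value of q^x *)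
Variables (q : C) (qp : C -> C).

(* q-Serre relations for the family X, where X c (= E_c or F_c) has parity
   [spar c] and weight z alpha_c (z = 1 or -1).  A homogeneous element is
   carried along with its parity and its weight; [adq b] is ad X_b, i.e.
   X_b x - (-1)^([b][x]) q^(h_b) x q^(-h_b) X_b. *)
Section Serre.
Variables (A : algType C) (X : sroot -> A) (z : C).

Definition hel : Type := (A * bool * weight)%type.

Definition gen_hel (c : sroot) : hel := (X c, spar c, z *: alpha c).

Definition adq (b : sroot) (x : hel) : hel :=
  (X b * x.1.1
     - ((-1) ^+ (spar b && x.1.2) * qp (wform (alpha b) x.2)) *: (x.1.1 * X b),
   spar b (+) x.1.2,
   z *: alpha b + x.2).

Record q_serre : Prop := {
  serre_std : forall (b c : sroot) (N : nat),
    b <> c -> wform (alpha b) (alpha b) != 0 ->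
    N%:R = 1 - 2 * wform (alpha b) (alpha c) / wform (alpha b) (alpha b) ->
    (iter N (adq b) (gen_hel c)).1.1 = 0;
  serre_null : forall b c : sroot,
    b <> c -> wform (alpha b) (alpha b) = 0 -> wform (alpha b) (alpha c) = 0 ->
    (adq b (gen_hel c)).1.1 = 0;
  (* Extra relations: alpha_s sits between two even simple roots of opposite
     signs, i.e. one of b, c is mu = k-1 and the other is i = 1 or, when m = 4,
     i = 2, as alpha_s is then also linked to alpha_2 = eps_1 + eps_2. *)
  serre_extra : forall b c : sroot,
    wform (alpha b) (alpha sS) != 0 ->
    wform (alpha b) (alpha sS) + wform (alpha c) (alpha sS) = 0 ->
    (adq sS (adq b (adq sS (gen_hel c)))).1.1 = 0
}.
End Serre.

(* e c, f c, h lambda, t lambda are e_c, f_c, h_lambda, q^(h_lambda) *)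
Record osp_relations (A : algType C) (e f : sroot -> A) (h t : weight -> A)
    : Prop := {
  rel_h_lin : forall (c : C) x y, h (c *: x + y) = c *: h x + h y;
  rel_t0 : t 0 = 1;
  rel_tD : forall x y, t (x + y) = t x * t y;
  rel_hh : forall x y, h x * h y = h y * h x;
  rel_ht : forall x y, h x * t y = t y * h x;
  rel_he : forall x c, h x * e c - e c * h x = wform x (alpha c) *: e c;
  rel_hf : forall x c, h x * f c - f c * h x = - wform x (alpha c) *: f c;
  rel_te : forall x c, t x * e c = qp (wform x (alpha c)) *: (e c * t x);
  rel_tf : forall x c, t x * f c = qp (- wform x (alpha c)) *: (f c * t x);
  rel_ef : forall c,
    e c * f c - (-1) ^+ spar c *: (f c * e c) =
    (q - q^-1)^-1 *: (t (alpha c) - t (- alpha c));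
  rel_ef0 : forall c d, c <> d ->
    e c * f d - (-1) ^+ (spar c && spar d) *: (f d * e c) = 0;
  rel_ee : forall c, wform (alpha c) (alpha c) = 0 ->
    e c * e c - (-1) ^+ spar c *: (e c * e c) = 0;
  rel_ff : forall c, wform (alpha c) (alpha c) = 0 ->
    f c * f c - (-1) ^+ spar c *: (f c * f c) = 0;
  rel_serre_e : q_serre (fun c => e c * t (2^-1 *: alpha c)) 1;
  rel_serre_f : q_serre (fun c => f c * t (2^-1 *: alpha c)) (-1)
}.

Inductive osp_gen : Type :=
  | Ge of sroot | Gf of sroot | Gh of weight | Gt of weight.

Definition osp_grad (g : osp_gen) : term C osp_gen :=
  match g with
  | Ge c | Gf c => TMul (TScal ((-1) ^+ spar c)) (TGen g)
  | Gh _ | Gt _ => TGen g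
  end.

Definition osp_rel (A : algType C) (phi : osp_gen -> A) : Prop :=
  osp_relations (fun c => phi (Ge c)) (fun c => phi (Gf c))
                (fun x => phi (Gh x)) (fun x => phi (Gt x)).

Definition counit_gen (g : osp_gen) : C^o :=
  match g with Gt _ => 1 | _ => 0 end.

Fact counit_gen_grad g : counit_gen g = teval counit_gen (osp_grad g).
Proof. by case: g => //= c; rewrite mulr0. Qed.

Fact counit_gen_rel : osp_rel counit_gen.
Proof.
have serre0 (X : sroot -> C^o) (z : C) : (forall c, X c = 0) -> q_serre X z.
  move=> X0; have ad0 b x : x.1.1 = 0 -> (adq X z b x).1.1 = 0.
    by move=> x0; rewrite /adq /= x0 X0 !mulr0 scaler0 subrr.
  split=> [b c N _ _ _|b c *|b c *]; last 2 first.
  - by apply: ad0; apply: X0.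
  - by do 3!apply: (ad0); apply: X0.
  by elim: N => [|N IH] /=; [exact: X0 | exact: ad0].
split=> /=; try by move=> *; rewrite ?(mul0r, mulr0, scaler0, subrr, addr0, mulr1, mul1r).
- by apply: serre0 => c; rewrite mul0r.
- by apply: serre0 => c; rewrite mul0r.
Qed.

Fact osp_nontrivial : exists (A : algType C) (th : {lrmorphism A -> A})
    (phi : osp_gen -> A),
  [/\ involutive th, forall g, th (phi g) = teval phi (osp_grad g) & osp_rel phi].
Proof.
exists (C^o : algType C), idfun, counit_gen; split=> //.
- exact: counit_gen_grad.
- exact: counit_gen_rel.
Qed.

Definition osp_presentation : presentation C := Presentation osp_nontrivial.

(* U_q[osp(m|n)] *)
Definition Uq : Type := pres osp_presentation.
HB.instance Definition _ := GRing.Algebra.on Uq.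

Definition Ue (c : sroot) : Uq := pinj (P := osp_presentation) (Ge c).
Definition Uf (c : sroot) : Uq := pinj (P := osp_presentation) (Gf c).
Definition Uh (x : weight) : Uq := pinj (P := osp_presentation) (Gh x).
Definition Ut (x : weight) : Uq := pinj (P := osp_presentation) (Gt x).

Lemma adq_morph (A B : algType C) (f : {lrmorphism A -> B}) (X : sroot -> A)
    (z : C) (b : sroot) (x : hel A) :
  adq (fun c => f (X c)) z b (f x.1.1, x.1.2, x.2) =
  (f (adq X z b x).1.1, (adq X z b x).1.2, (adq X z b x).2).
Proof.
rewrite /adq /=; congr (_, _, _); rewrite [RHS]rmorphB /= [in RHS]linearZ /=.
by rewrite !rmorphM.
Qed.

Lemma adq_iter_morph (A B : algType C) (f : {lrmorphism A -> B})
    (X : sroot -> A) (z : C) (b : sroot) (N : nat) (x : hel A) :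
  iter N (adq (fun c => f (X c)) z b) (f x.1.1, x.1.2, x.2) =
  (f (iter N (adq X z b) x).1.1, (iter N (adq X z b) x).1.2,
   (iter N (adq X z b) x).2).
Proof. by elim: N => [//|N IH] /=; rewrite IH adq_morph. Qed.

Lemma Uq_ext (x y : Uq) :
  (forall (A : algType C) (phi : osp_gen -> A) (f : {lrmorphism Uq -> A}),
     osp_rel phi -> (forall g, f (pinj (P := osp_presentation) g) = phi g) ->
     f x = f y) -> x = y.
Proof. exact: (@pres_ext _ osp_presentation). Qed.

Lemma Uq_relations : osp_relations Ue Uf Uh Ut.
Proof.
have gE (X : sroot -> Uq) z c (A : algType C) (f : {lrmorphism Uq -> A}) :
    gen_hel (fun c => f (X c)) z c =
    (f (gen_hel X z c).1.1, (gen_hel X z c).1.2, (gen_hel X z c).2) by [].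
have serreU (X : sroot -> Uq) (z : C) :
    (forall (A : algType C) (phi : osp_gen -> A) (f : {lrmorphism Uq -> A}),
       osp_rel phi -> (forall g, f (pinj (P := osp_presentation) g) = phi g) ->
       q_serre (fun c => f (X c)) z) -> q_serre X z.
  move=> h; split.
  - move=> b c N bc nz hN; apply: Uq_ext => A phi f hphi fE.
    have := serre_std (h A phi f hphi fE) bc nz hN.
    by rewrite gE adq_iter_morph /= rmorph0.
  - move=> b c bc n0 nbc; apply: Uq_ext => A phi f hphi fE.
    have := serre_null (h A phi f hphi fE) bc n0 nbc.
    by rewrite gE adq_morph /= rmorph0.
  - move=> b c nz hbc; apply: Uq_ext => A phi f hphi fE.
    have := serre_extra (h A phi f hphi fE) nz hbc.
    by rewrite gE !adq_morph /= rmorph0.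
split.
- move=> c x y; apply: Uq_ext => A phi f hphi fE.
  by rewrite linearP /= !fE (rel_h_lin hphi).
- apply: Uq_ext => A phi f hphi fE.
  by rewrite rmorph1 fE (rel_t0 hphi).
- move=> x y; apply: Uq_ext => A phi f hphi fE.
  by rewrite rmorphM /= !fE (rel_tD hphi).
- move=> x y; apply: Uq_ext => A phi f hphi fE.
  by rewrite !rmorphM /= !fE (rel_hh hphi).
- move=> x y; apply: Uq_ext => A phi f hphi fE.
  by rewrite !rmorphM /= !fE (rel_ht hphi).
- move=> x c; apply: Uq_ext => A phi f hphi fE.
  by rewrite rmorphB linearZ /= !rmorphM /= !fE (rel_he hphi).
- move=> x c; apply: Uq_ext => A phi f hphi fE.
  by rewrite rmorphB linearZ /= !rmorphM /= !fE (rel_hf hphi).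
- move=> x c; apply: Uq_ext => A phi f hphi fE.
  by rewrite linearZ /= !rmorphM /= !fE (rel_te hphi).
- move=> x c; apply: Uq_ext => A phi f hphi fE.
  by rewrite linearZ /= !rmorphM /= !fE (rel_tf hphi).
- move=> c; apply: Uq_ext => A phi f hphi fE.
  have := rel_ef hphi c => /= rel.
  rewrite [in LHS]rmorphB /= !linearZ /= [in RHS]rmorphB /=.
  by rewrite !rmorphM /= !fE scalerN.
- move=> c d cd; apply: Uq_ext => A phi f hphi fE.
  have := rel_ef0 hphi cd => /= rel.
  by rewrite rmorphB /= linearZ /= !rmorphM rmorph0 /= !fE ?scalerN.
- move=> c c0; apply: Uq_ext => A phi f hphi fE.
  have := rel_ee hphi c0 => /= rel.
  by rewrite rmorphB /= linearZ /= !rmorphM rmorph0 /= !fE ?scalerN.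
- move=> c c0; apply: Uq_ext => A phi f hphi fE.
  have := rel_ff hphi c0 => /= rel.
  by rewrite rmorphB /= linearZ /= !rmorphM rmorph0 /= !fE ?scalerN.
- apply: serreU => A phi f hphi fE.
  have -> : (fun c => f (Ue c * Ut (2^-1 *: alpha c))) =
            (fun c => phi (Ge c) * phi (Gt (2^-1 *: alpha c))).
    by apply/funext => c; rewrite rmorphM /= !fE.
  exact: rel_serre_e hphi.
- apply: serreU => A phi f hphi fE.
  have -> : (fun c => f (Uf c * Ut (2^-1 *: alpha c))) =
            (fun c => phi (Gf c) * phi (Gt (2^-1 *: alpha c))).
    by apply/funext => c; rewrite rmorphM /= !fE.
  exact: rel_serre_f hphi.
Qed.

(* E_c = e_c q^(h_c / 2) *)
Definition UE (c : sroot) : Uq := Ue c * Ut (2^-1 *: alpha c).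

Lemma counit_exists : exists f : {lrmorphism Uq -> C^o},
  (forall g : osp_gen, f (pinj (P := osp_presentation) g) = counit_gen g) /\
  (forall x : Uq, f (grad x) = f x).
Proof.
exact: (@pres_lift _ osp_presentation (C^o : algType C) idfun counit_gen
          (fun _ => erefl) counit_gen_grad counit_gen_rel).
Qed.

Definition counit : {lrmorphism Uq -> C^o} := projT1 (cid counit_exists).

Fact counit_grad x : counit (grad x) = counit x.
Proof. by rewrite /counit; case: (cid _) => f [] /=. Qed.

(* the graded tensor product U_q[osp(m|n)] (x) U_q[osp(m|n)] *)
Definition UU : Type := pres (tsq_presentation counit_grad).
HB.instance Definition _ := GRing.Algebra.on UU.

Definition tens (x y : Uq) : UU :=
  (pinj (P := tsq_presentation counit_grad) (inl x) : UU) *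
  (pinj (P := tsq_presentation counit_grad) (inr y) : UU).

Lemma UU_ext (x y : UU) :
  (forall (A : algType C) (phi : Uq + Uq -> A) (f : {lrmorphism UU -> A}),
     tsq_rel phi ->
     (forall g, f (pinj (P := tsq_presentation counit_grad) g) = phi g) ->
     f x = f y) -> x = y.
Proof. exact: (@pres_ext _ (tsq_presentation counit_grad)). Qed.

Lemma tensM (p r : bool) (x y x' y' : Uq) : homog r y -> homog p x' ->
  tens x y * tens x' y' = (-1) ^+ (p && r) *: tens (x * x') (y * y').
Proof.
move=> hy hx'; apply: UU_ext => A phi f [[l1 l2 l3] [r1 r2 r3] sc] fE.
rewrite linearZ /= /tens !rmorphM /= !fE l3 r3.
rewrite -mulrA (mulrA (phi (inr y))) (sc _ _ _ _ hx' hy).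
by rewrite -!scalerAl -scalerAr !mulrA.
Qed.

Record is_coproduct (Delta : {lrmorphism Uq -> UU}) : Prop := {
  coprod_e : forall c, Delta (Ue c) =
    tens (Ut (2^-1 *: alpha c)) (Ue c) + tens (Ue c) (Ut (- (2^-1 *: alpha c)));
  coprod_f : forall c, Delta (Uf c) =
    tens (Ut (2^-1 *: alpha c)) (Uf c) + tens (Uf c) (Ut (- (2^-1 *: alpha c)));
  coprod_t : forall x, Delta (Ut x) = tens (Ut x) (Ut x);
  coprod_h : forall x, Delta (Uh x) = tens (Uh x) 1 + tens 1 (Uh x)
}.

(* U_q[osp(m|n)]^+ and U_q[osp(m|n)]^- *)
Definition Uplus : Uq -> Prop :=
  subalgebra (fun u => (exists c, u = Ue c) \/ (exists x, u = Uh x \/ u = Ut x)).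
Definition Uminus : Uq -> Prop :=
  subalgebra (fun u => (exists c, u = Uf c) \/ (exists x, u = Uh x \/ u = Ut x)).

(* A finite-dimensional Z_2-graded weight module, in a homogeneous basis of
   weight vectors. *)
Record wmodule (d : nat) := WModule {
  wpar : 'I_d -> bool;
  wwt : 'I_d -> weight;
  wact :> Uq -> 'M[C]_d;
  wactP : forall (c : C) x y, wact (c *: x + y) = c *: wact x + wact y;
  wact1 : wact 1 = 1%:M;
  wactM : forall x y, wact (x * y) = wact x *m wact y;
  wact_par : forall p x, homog p x ->
    forall i j, wact x i j != 0 -> wpar i (+) wpar j = p;
  wact_h : forall x, wact (Uh x) = diag_mx (\row_i wform x (wwt i));
  wact_t : forall x, wact (Ut x) = diag_mx (\row_i qp (wform x (wwt i)))
}.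

(* For a graded vector space W with basis parities p and a superalgebra S, an
   element sum_ij E^i_j (x) s_ij of the graded tensor product End W (x) S is
   stored as the matrix (s_ij); [gmul p] is its product, since
   (E^i_x (x) a)(E^x_j (x) b) = (-1)^([a]([x]+[j])) E^i_j (x) ab. *)
Definition gmul (P : presentation C) (d : nat) (p : 'I_d -> bool)
    (M N : 'M[pres P]_d) : 'M[pres P]_d :=
  \matrix_(i, j) \sum_x (if p x (+) p j then grad (M i x) else M i x) * N x j.

(* a (x) u in End W (x) Uq *)
Definition etens (d : nat) (a : 'M[C]_d) (u : Uq) : 'M[Uq]_d :=
  \matrix_(i, j) (a i j *: u).

(* Finite sums of pure tensors x (x) y of homogeneous elements, with their
   parities: the list entry ((p, x), (r, y)) has [x] = p and [y] = r. *)
Definition hsum : Type := seq ((bool * Uq) * (bool * Uq)).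
Definition sweedler (z : UU) (s : hsum) : Prop :=
  (forall w, w \in s -> homog w.1.1 w.1.2 && homog w.2.1 w.2.2) /\
  z = \sum_(w <- s) tens w.1.2 w.2.2.

(* (rho (x) id) and (rho (x) id) T applied to a sum of homogeneous tensors *)
Definition act_id (d : nat) (W : wmodule d) (s : hsum) : 'M[Uq]_d :=
  \sum_(w <- s) etens (W w.1.2) w.2.2.
Definition act_id_twist (d : nat) (W : wmodule d) (s : hsum) : 'M[Uq]_d :=
  \sum_(w <- s) etens ((-1) ^+ (w.1.1 && w.2.1) *: W w.2.2) w.1.2.

Section TensorModule.
Variables (d d' : nat) (W : wmodule d) (W' : wmodule d').
Local Notation D := #|{: 'I_d * 'I_d'}|.
Local Notation fst x := (enum_val x).1.
Local Notation snd x := (enum_val x).2.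

(* A (x) B acting on W (x) W' by (A (x) B)(w (x) w') = (-1)^([B][w]) Aw (x) Bw' *)
Definition skron (A : 'M[C]_d) (B : 'M[C]_d') : 'M[C]_D :=
  \matrix_(x, y) ((-1) ^+ ((wpar W' (snd x) (+) wpar W' (snd y)) && wpar W (fst y))
                  * (A (fst x) (fst y) * B (snd x) (snd y))).

Definition is_tensor_module (Delta : Uq -> UU) (W'' : wmodule D) : Prop :=
  (forall x, wpar W'' x = wpar W (fst x) (+) wpar W' (snd x)) /\
  (forall a s, sweedler (Delta a) s ->
     W'' a = \sum_(w <- s) skron (W w.1.2) (W' w.2.2)).

(* M_13 and M'_23 in End(W (x) W') (x) Uq *)
Definition leg13 (M : 'M[Uq]_d) : 'M[Uq]_D :=
  \matrix_(x, y) (if snd x == snd y then M (fst x) (fst y) else 0).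
Definition leg23 (M' : 'M[Uq]_d') : 'M[Uq]_D :=
  \matrix_(x, y)
    (if fst x == fst y
     then (-1) ^+ ((wpar W' (snd x) (+) wpar W' (snd y)) && wpar W (fst y))
          *: M' (snd x) (snd y)
     else 0).
End TensorModule.

(* The completion of Uq (x) Uq: its elements are the families, natural in the
   finite-dimensional weight module W, of elements of End W (x) Uq (so the first
   factor is completed with respect to these modules), and u (x) v is the family
   rho_W(u) (x) v.  In it, cR W stands for (rho_W (x) id) cR. *)
Definition natural_family (cR : forall d, wmodule d -> 'M[Uq]_d) : Prop :=
  forall d d' (W : wmodule d) (W' : wmodule d') (g : 'M[C]_(d', d)),
    (forall i j, g i j != 0 -> wpar W' i = wpar W j) ->
    (forall u, g *m W u = W' u *m g) ->
    map_mx (in_alg Uq) g *m cR d W = cR d' W' *m map_mx (in_alg Uq) g.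

Record is_universal_R (Delta : {lrmorphism Uq -> UU})
    (cR : forall d, wmodule d -> 'M[Uq]_d) : Prop := {
  univR_natural : natural_family cR;
  univR_borel : forall d (W : wmodule d), exists s : seq (Uq * Uq),
    (forall w, w \in s -> Uminus w.1 /\ Uplus w.2) /\
    cR d W = \sum_(w <- s) etens (W w.1) w.2;
  univR_even : forall d (W : wmodule d) i j,
    homog (wpar W i (+) wpar W j) (cR d W i j);
  univR_inv : forall d (W : wmodule d), exists M : 'M[Uq]_d,
    gmul (wpar W) (cR d W) M = 1%:M /\ gmul (wpar W) M (cR d W) = 1%:M;
  (* R Delta(a) = Delta^T(a) R *)
  univR_twist : forall d (W : wmodule d) a s, sweedler (Delta a) s ->
    gmul (wpar W) (cR d W) (act_id W s) =
    gmul (wpar W) (act_id_twist W s) (cR d W);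
  (* (id (x) Delta) R = R_13 R_12 *)
  univR_id_coprod : forall d (W : wmodule d),
    map_mx Delta (cR d W) =
    gmul (P := tsq_presentation counit_grad) (wpar W)
         (map_mx (fun u => tens 1 u) (cR d W)) (map_mx (fun u => tens u 1) (cR d W));
  (* (Delta (x) id) R = R_13 R_23 *)
  univR_coprod_id : forall d d' (W : wmodule d) (W' : wmodule d')
      (W'' : wmodule #|{: 'I_d * 'I_d'}|),
    is_tensor_module W W' Delta W'' ->
    cR _ W'' = gmul (wpar W'') (leg13 d' (cR d W)) (leg23 W W' (cR d' W'))
}.

(* The basis of the vector representation, in the order 1..m (even), 1..n (odd) *)
Definition lab (x : 'I_(m + n)) : idx := nth (ev 0) indices x.

(* E^a_b *)
Definition Eop (a b : idx) : 'M[C]_(m + n) :=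
  \matrix_(x, y) ((lab x == a) && (lab y == b))%:R.

Definition Sig (a b : idx) : 'M[C]_(m + n) :=
  Eop a b - ((-1) ^+ (a.1 && (a.1 (+) b.1)) * xi a * xi b) *: Eop (ibar b) (ibar a).

Definition vec_e (c : sroot) : 'M[C]_(m + n) :=
  match c with
  | sE i =>
      if (i.+1 < l)%N then Sig (ev i.+1) (ev i.+2)
      else if odd m then Sig (ev l) (ev l.+1) else Sig (ev l.-1) (ibar (ev l))
  | sO mu => Sig (od mu.+1) (od mu.+2)
  | sS => Sig (od k) (ev 1)
  end.

Definition vec_f (c : sroot) : 'M[C]_(m + n) :=
  match c with
  | sE i =>
      if (i.+1 < l)%N then Sig (ev i.+2) (ev i.+1)
      else if odd m then Sig (ev l.+1) (ev l) else Sig (ibar (ev l)) (ev l.-1)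
  | sO mu => - Sig (od mu.+2) (od mu.+1)
  | sS => - Sig (ev 1) (od k)
  end.

Record is_vector_rep (V : wmodule (m + n)) : Prop := {
  vec_par : forall x, wpar V x = (lab x).1;
  vec_h : forall a, a \in indices -> V (Uh (eps a)) = (-1) ^+ a.1 *: Sig a a;
  vec_actE : forall c, V (Ue c) = vec_e c;
  vec_actF : forall c, V (Uf c) = vec_f c
}.

Definition cartan_indices : seq idx :=
  [seq ev i | i <- iota 1 l] ++ [seq od mu | mu <- iota 1 k].

(* q^(sum_a h_a (x) h^a) with first factor in V: each pi(h_a) is diagonal, so
   the exponent is a diagonal matrix with entries
   sum_a pi(h_a)_xx h^a, h^a = (-1)^[a] h_(eps_a), in H. *)
Definition cartan_part (V : wmodule (m + n)) : 'M[Uq]_(m + n) :=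
  diag_mx (\row_x Ut (\sum_(a <- cartan_indices)
                        (V (Uh (eps a)) x x * (-1) ^+ a.1) *: eps a)).

End OSp.

(* Main.v *)
(* Write L_ij for the entries of (pi (x) id)R.  They lie in the raising half and, by
   the intertwining property for h in H, L_ij has weight eps_j - eps_i; hence L is
   triangular, L_ii lies in the Cartan part, and L_ij is in U^0 e_c when
   eps_j - eps_i = alpha_c.  From (id (x) Delta)R = R_13 R_12, L_ii is grouplike, so
   L_ii = q^(x_i); for eps_j = eps_i + alpha_c the intertwining property for f_c then
   gives x_j = x_i + alpha_c and determines L_ij.  As R acts trivially on the
   invariant vector of V (x) V, the weights x_i and x_(ibar i) are opposite, so
   x_i = eps_i.

   Relation (i) is the intertwining property for e_c.  Naturality of R under the
   module endomorphism P R_VV of V (x) V is the RLL relation; its component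
   ((c, a), (c, b)) is relation (ii) up to the entry r_ac = pi(L_ac)_ca.  Applying pi
   to that component gives r_ab = r_cb, and so r_ac = (-1)^[c] (q - q^-1) follows from
   the case of simple roots. *)
Require Import Defs.
From HB Require Import structures.
From mathcomp Require Import all_boot all_order all_algebra.
From mathcomp Require Import boolp reals complex sequences exp trigo.
From mathcomp Require Import zify ring lra.

Set Implicit Arguments.
Unset Strict Implicit.
Unset Printing Implicit Defensive.

Import Order.TTheory GRing.Theory Num.Theory.
Local Open Scope ring_scope.

(** * Weights and simple roots *)

(** Eigenvalues take its place: if a sum of eigenvectors of an operator is itself an eigenvector,
    the terms with another eigenvalue may be dropped. The operators ad h sort words by weight, and
    the maps (id (x) phi)Delta sort the elements q^h; the functionals phi come from one-dimensional
    modules and from matrix entries of V. Since h and q^h are separate generators, an element of the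
    Cartan part is at first a polynomial in the h's with coefficients in the span of the q^h. A
    difference form of Euler's identity removes the polynomial part, and this is what turns
    grouplike into q^(x_i). The map [qp] need not be injective, so the relations of L_ii with f_c
    only compare powers of q. Equalities of weights come from the entries attached to simple roots,
    which leave x_j = x_i + alpha_c or x_j = x_i - alpha_c; q not being a root of unity excludes the
    second. Such relations never see a common shift of all x_i, hence the invariant vector. *)

Section Weights.
Variables (R : realType) (m k : nat).
Local Notation C := R[i].
Local Notation l := m./2.
Local Notation D := (weight R m k).
Local Notation wform := (@wform R m k).
Local Notation eps := (eps R m k).
Local Notation ibar := (ibar m k).
Local Notation indices := (indices m k).
Local Notation position := (position m k).
Local Notation alpha := (@alpha R m k).

Lemma wformDl x y z : wform (x + y) z = wform x z + wform y z.
Proof.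
rewrite /wform [RHS]addrACA -opprD -!big_split /=; congr (_ - _);
  by apply: eq_bigr => i _; rewrite mxE mulrDl.
Qed.

Lemma wformZl c x z : wform (c *: x) z = c * wform x z.
Proof.
rewrite /wform mulrBr !mulr_sumr; congr (_ - _);
  by apply: eq_bigr => i _; rewrite mxE mulrA.
Qed.

Lemma wformC x y : wform x y = wform y x.
Proof. by congr (_ - _); apply: eq_bigr => i _; rewrite mulrC. Qed.

Lemma wformDr x y z : wform z (x + y) = wform z x + wform z y.
Proof. by rewrite wformC wformDl !(wformC z). Qed.
Lemma wformZr c x z : wform z (c *: x) = c * wform z x.
Proof. by rewrite wformC wformZl wformC. Qed.
Lemma wformNr x z : wform z (- x) = - wform z x.
Proof. by rewrite -scaleN1r wformZr mulN1r. Qed.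
Lemma wformNl x z : wform (- x) z = - wform x z.
Proof. by rewrite wformC wformNr wformC. Qed.
Lemma wformBr x y z : wform z (x - y) = wform z x - wform z y.
Proof. by rewrite wformDr wformNr. Qed.
Lemma wformBl x y z : wform (x - y) z = wform x z - wform y z.
Proof. by rewrite wformDl wformNl. Qed.
Lemma wform0r z : wform z 0 = 0.
Proof. by rewrite -(scale0r 0) wformZr mul0r. Qed.
Lemma wform0l z : wform 0 z = 0.
Proof. by rewrite wformC wform0r. Qed.

Lemma mem_indices a :
  (a \in indices) = (0 < a.2 <= if a.1 then (2 * k)%N else m)%N.
Proof.
rewrite mem_cat; case: a => [[] i] /=; apply/idP/idP.
- case/orP=> /mapP [j]; rewrite mem_iota // => h [->]; lia.
- by move=> h; apply/orP; right; apply/mapP; exists i; rewrite // mem_iota; lia.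
- case/orP=> /mapP [j]; rewrite mem_iota // => h [->]; lia.
- by move=> h; apply/orP; left; apply/mapP; exists i; rewrite // mem_iota; lia.
Qed.

Lemma ibar_in a : a \in indices -> ibar a \in indices.
Proof. rewrite !mem_indices /Defs.ibar; case: a => [[] i] /=; lia. Qed.

Lemma ibarK a : a \in indices -> ibar (ibar a) = a.
Proof.
rewrite mem_indices /Defs.ibar; case: a => [[] i] /= h; congr (_, _); lia.
Qed.

Lemma ibar_eq a b : a \in indices -> b \in indices ->
  (ibar a == b) = (a == ibar b).
Proof.
by move=> ha hb; apply/eqP/eqP => [<-|->]; rewrite ibarK.
Qed.

Lemma uniq_indices : uniq indices.
Proof.
have i1 : injective ev by move=> x y [].
have i2 : injective od by move=> x y [].
rewrite cat_uniq !map_inj_uniq ?iota_uniq //= andbT.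
by apply/hasPn => x /mapP [j _ ->]; apply/mapP => -[].
Qed.

Lemma xi_sq a : xi R a * xi R a = 1.
Proof. by rewrite /xi; case: a.1; rewrite ?mulr1 // -signr_odd -signr_addb addbb. Qed.

Lemma xi_ibar a : a \in indices -> xi R (ibar a) = (-1) ^+ a.1 * xi R a.
Proof.
rewrite mem_indices /xi /Defs.ibar; case: a => [[] i] /= h; last by rewrite mul1r.
rewrite expr1 mulN1r -signr_odd -[in RHS](signr_odd _ i) -signrN; congr (_ ^+ nat_of_bool _).
lia.
Qed.

(** These are the functions a |-> (x, eps_a) for weights x, by [wform_cw]; linear functionals on the
    weights are given below by such functions on the indices. *)
Definition antisym (A : idx -> C) := forall a, a \in indices -> A (ibar a) = - A a.

(* the weight x with (x, eps_a) = A a *)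
Definition cw (A : idx -> C) : D :=
  (\row_(j < l) A (ev j.+1), \row_(j < k) - A (od j.+1)).

Lemma sum_delta (d : nat) (f : nat -> C) (i : nat) :
  \sum_(j < d) f j.+1 * (j.+1 == i)%:R = if (0 < i <= d)%N then f i else 0.
Proof.
case: ifP => h.
  have hi : (i.-1 < d)%N by lia.
  have ei : i.-1.+1 = i by lia.
  rewrite (bigD1 (Ordinal hi)) //= big1 ?addr0; first by rewrite ei eqxx mulr1.
  move=> j; rewrite -val_eqE /= => hj.
  have /negPf -> : j.+1 != i by apply: contraNneq hj => <-.
  by rewrite mulr0.
rewrite big1 // => j _; have /negPf -> : j.+1 != i by have := ltn_ord j; lia.
by rewrite mulr0.
Qed.

Lemma wform_cw A a : antisym A -> a \in indices -> wform (cw A) (eps a) = A a.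
Proof.
move=> hA ha; have hAa := hA _ ha.
have oppE (x : C) : x = - x -> 0 = x.
  by move/eqP; rewrite -subr_eq0 opprK -mulr2n mulrn_eq0 /= => /eqP.
move: ha; rewrite mem_indices /wform /Defs.eps; case: a hAa => [[] i] /= hAa hi.
- rewrite big1 ?sub0r => [|j _]; last by rewrite !mxE mulr0.
  rewrite -sumrN (eq_bigr (fun j : 'I_k => A (od j.+1) * (j.+1 == i)%:R
     - A (od j.+1) * (j.+1 == (2 * k + 1 - i)%N)%:R)); last first.
    by move=> j _; rewrite !mxE /=; ring.
  rewrite sumrB !(sum_delta k (fun j => A (od j))).
  move: hAa; rewrite /Defs.ibar /= => hAa.
  case: ifP => h1; case: ifP => h2; first lia.
  + by rewrite subr0.
  + by rewrite sub0r [X in - X]hAa opprK.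
  + lia.
- rewrite [X in _ - X]big1 ?subr0 => [|j _]; last by rewrite !mxE mulr0.
  rewrite (eq_bigr (fun j : 'I_l => A (ev j.+1) * (j.+1 == i)%:R
     - A (ev j.+1) * (j.+1 == (m + 1 - i)%N)%:R)); last first.
    by move=> j _; rewrite !mxE /=; ring.
  rewrite sumrB !(sum_delta l (fun j => A (ev j))).
  move: hAa; rewrite /Defs.ibar /= => hAa.
  case: ifP => h1; case: ifP => h2; first lia.
  + by rewrite subr0.
  + by rewrite sub0r [X in - X]hAa opprK.
  (* The remaining index is the self-dual one of odd [m]: its weight is 0, and antisymmetry forces
     [A] to vanish there. *)
  + rewrite subrr; apply: oppE; rewrite -[RHS]hAa; congr (A (_, _)); lia.
Qed.

Lemma eps_bar a : a \in indices -> eps (ibar a) = - eps a.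
Proof.
move=> /ibarK/(congr1 snd); rewrite /Defs.eps.
by case: a => [[] i] /= e; congr (_, _); apply/matrixP => x y;
  rewrite !mxE /= ?oppr0 // opprB e.
Qed.

Definition delta_fun (a : idx) : idx -> C :=
  fun b => (-1) ^+ a.1 * ((b == a)%:R - (b == ibar a)%:R).

Lemma delta_antisym a : a \in indices -> antisym (delta_fun a).
Proof.
move=> ha b hb; rewrite /delta_fun -mulrN opprB; congr (_ * (_%:R - _%:R)).
- by rewrite ibar_eq.
- by rewrite ibar_eq ?ibar_in // ibarK.
Qed.

Lemma eps_cw a : a \in indices -> eps a = cw (delta_fun a).
Proof.
move=> ha; rewrite /Defs.eps /cw /delta_fun /Defs.ibar; case: a ha => [[] i] /= ha;
  congr (_, _); apply/matrixP => x y; rewrite !mxE /=.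
- by rewrite expr1 subrr mulr0.
- by rewrite mulN1r opprK.
- by rewrite expr0 mul1r.
- by rewrite subrr mulr0 oppr0.
Qed.

Lemma wform_eps a b : a \in indices -> b \in indices ->
  wform (eps a) (eps b) = (-1) ^+ a.1 * ((b == a)%:R - (b == ibar a)%:R).
Proof.
by move=> ha hb; rewrite (eps_cw ha) wform_cw //; apply: delta_antisym.
Qed.

Lemma wform_eps0 a b : a \in indices -> b \in indices -> b != a -> b != ibar a ->
  wform (eps a) (eps b) = 0.
Proof.
by move=> ha hb /negPf h1 /negPf h2; rewrite wform_eps // h1 h2 subrr mulr0.
Qed.

Lemma wform_nondeg x y : (forall a, a \in indices -> wform (eps a) x = wform (eps a) y) ->
  x = y.
Proof.
have c1 (z : D) (j : 'I_l) : wform (eps (ev j.+1)) z = z.1 0 j.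
  rewrite /wform [X in _ - X]big1 ?subr0 => [|i _]; last by rewrite mxE mul0r.
  rewrite (bigD1 j) //= big1 ?addr0 => [|i hi]; rewrite !mxE /Defs.ibar /=.
    have /negPf -> : j.+1 != (m + 1 - j.+1)%N by have := ltn_ord j; lia.
    by rewrite eqxx subr0 mul1r.
  have /negPf -> : i.+1 != (m + 1 - j.+1)%N.
    by have := ltn_ord j; have := ltn_ord i; lia.
  have /negPf -> : i.+1 != j.+1 by apply: contraNneq hi => -[] /val_inj ->.
  by rewrite subrr mul0r.
have c2 (z : D) (j : 'I_k) : wform (eps (od j.+1)) z = - z.2 0 j.
  rewrite /wform [X in X - _]big1 ?sub0r => [|i _]; last by rewrite mxE mul0r.
  rewrite (bigD1 j) //= big1 ?addr0 => [|i hi]; rewrite !mxE /Defs.ibar /=.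
    have /negPf -> : j.+1 != (2 * k + 1 - j.+1)%N by have := ltn_ord j; lia.
    by rewrite eqxx subr0 mul1r.
  have /negPf -> : i.+1 != (2 * k + 1 - j.+1)%N.
    by have := ltn_ord j; have := ltn_ord i; lia.
  have /negPf -> : i.+1 != j.+1 by apply: contraNneq hi => -[] /val_inj ->.
  by rewrite subrr mul0r.
move=> h; rewrite [x]surjective_pairing [y]surjective_pairing; congr (_, _);
  apply/matrixP => i j; rewrite ord1.
- by rewrite -!c1 h // mem_indices /=; have := ltn_ord j; lia.
- by apply: oppr_inj; rewrite -!c2 h // mem_indices /=; have := ltn_ord j; lia.
Qed.

(** With these two indices every simple root becomes a difference eps_top - eps_bot. For the last
    even root the lower index is the self-dual one, of weight 0, if [m] is odd, and the dual of l if
    m = 2l, which turns eps_(l-1) + eps_l into a difference. *)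
Definition root_top (c : sroot m k) : idx :=
  match c with
  | sE i => if (i.+1 < l)%N || odd m then ev i.+1 else ev i
  | sO mu => od mu.+1
  | sS => od k
  end.

Definition root_bot (c : sroot m k) : idx :=
  match c with
  | sE i => ev i.+2
  | sO mu => od mu.+2
  | sS => ev 1
  end.

Hypotheses (hm : (2 < m)%N) (hk : (0 < k)%N).

Lemma top_in c : root_top c \in indices.
Proof.
rewrite mem_indices; case: c => [i|mu|] /=; [|have := ltn_ord mu; lia|lia].
by have := ltn_ord i; case: ifP => /= h; lia.
Qed.

Lemma bot_in c : root_bot c \in indices.
Proof.
rewrite mem_indices; case: c => [i|mu|] /=; [|have := ltn_ord mu; lia|lia].
by have := ltn_ord i; lia.
Qed.
Hint Resolve top_in bot_in ibar_in : core.

Lemma alphaE c : alpha c = eps (root_top c) - eps (root_bot c).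
Proof.
case: c => [i|mu|] //=; have hi := ltn_ord i; case: ifP => //= h.
case: ifP => /= ho.
  have ei : l = i.+1 by lia.
  have -> : ev l = ev i.+1 by congr (_, _).
  have -> : eps (ev i.+2) = 0; last by rewrite subr0.
  rewrite /Defs.eps /=; congr (_, _); apply/matrixP => x y; rewrite !mxE /Defs.ibar /=.
  have -> : (m + 1 - i.+2)%N = i.+2 by lia.
  by rewrite subrr.
have ei : l = i.+1 by lia.
have -> : ev l = ev i.+1 by congr (_, _).
have -> : ev l.-1 = ev i by rewrite /ev; congr (_, _); lia.
rewrite [eps (ev i.+2)](_ : _ = - eps (ev i.+1)) ?opprK 1?addrC //.
rewrite -eps_bar; last by rewrite mem_indices /=; lia.
by congr (eps (_, _)) => /=; lia.
Qed.

Lemma position_ibar a : a \in indices ->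
  (position (ibar a) + position a = m + 2 * k + 1)%N.
Proof.
rewrite mem_indices /Defs.position /Defs.ibar; case: a => [[] i] /=; last lia.
by case: ifP; case: ifP; lia.
Qed.

Lemma position_inj a b : a \in indices -> b \in indices ->
  position a = position b -> a = b.
Proof.
rewrite !mem_indices /Defs.position; case: a b => [[] i] [[] j] /=.
- by case: ifP; case: ifP => *; congr (_, _); lia.
- by case: ifP; lia.
- by case: ifP; lia.
- by move=> *; congr (_, _); lia.
Qed.

Lemma position_gt a : a \in indices -> (0 < position a <= m + 2 * k)%N.
Proof.
by rewrite mem_indices /Defs.position; case: a => [[] i] /=; first case: ifP; lia.
Qed.

Lemma position_top c : position (root_top c) =
  match c with
  | sE i => if (i.+1 < l)%N || odd m then (k + i.+1)%N else (k + i)%N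
  | sO mu => mu.+1
  | sS => k
  end.
Proof.
rewrite /Defs.position; case: c => [i|mu|] /=.
- by case: (_ || _).
- by have := ltn_ord mu; case: ifP; lia.
- by rewrite leqnn.
Qed.

Lemma position_bot c : position (root_bot c) =
  match c with
  | sE i => (k + i.+2)%N
  | sO mu => mu.+2
  | sS => k.+1
  end.
Proof.
rewrite /Defs.position; case: c => [i|mu|] //=; last by rewrite addn1.
by have := ltn_ord mu; case: ifP; lia.
Qed.

Lemma position_topbot c : (position (root_top c) < position (root_bot c))%N.
Proof.
by rewrite position_top position_bot; case: c => [i|mu|] //; case: ifP; lia.
Qed.

(* pairs of indices that differ by a simple root *)
Definition edge (c : sroot m k) (b a : idx) : Prop :=
  (b = root_top c /\ a = root_bot c) \/ (b = ibar (root_bot c) /\ a = ibar (root_top c)).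

Lemma edge_in c b a : edge c b a -> b \in indices /\ a \in indices.
Proof. by case=> -[-> ->]; split; auto. Qed.

Lemma edge_alpha c b a : edge c b a -> eps b = eps a + alpha c.
Proof.
by case=> -[-> ->]; rewrite alphaE ?eps_bar //; [rewrite addrC subrK|rewrite addKr].
Qed.

(** The position, recentred so as to be antisymmetric. As a functional it separates the weights of V
    and is positive on simple roots. *)
Definition pos_fun (a : idx) : C := (m + 2 * k + 1)%:R - 2 * (position a)%:R.
Lemma pos_antisym : antisym pos_fun.
Proof.
move=> a ha; rewrite /pos_fun -(position_ibar ha) natrD; ring.
Qed.

Lemma eps_inj a b : a \in indices -> b \in indices -> eps a = eps b -> a = b.
Proof.
move=> ha hb e; apply: position_inj => //.
have := wform_cw pos_antisym ha; rewrite e (wform_cw pos_antisym hb) /pos_fun.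
move/addrI/oppr_inj/mulfI => h; apply/eqP; rewrite -(eqr_nat C); apply/eqP/esym.
by apply: h; rewrite pnatr_eq0.
Qed.

Definition root_sum (w : seq (sroot m k)) : D := \sum_(c <- w) alpha c.
Local Notation wt := root_sum.

Lemma wform_wt (A : idx -> C) w : antisym A ->
  wform (cw A) (wt w) = \sum_(c <- w) (A (root_top c) - A (root_bot c)).
Proof.
move=> hA; elim: w => [|c w IH]; first by rewrite /wt !big_nil wform0r.
by rewrite /wt !big_cons wformDr IH alphaE wformBr !wform_cw.
Qed.

Lemma wt_wlt a b w : a \in indices -> b \in indices -> eps b = eps a + wt w ->
  w = [::] \/ wlt m k a b.
Proof.
move=> ha hb e; have := wform_cw pos_antisym hb.
rewrite e wformDr (wform_cw pos_antisym ha) (wform_wt _ pos_antisym) => h.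
case: w {e} h => [|c w h]; first by left.
right; rewrite /wlt.
have e1 : \sum_(c <- c :: w) (pos_fun (root_top c) - pos_fun (root_bot c)) =
    2 * (\sum_(c <- c :: w) (position (root_bot c) - position (root_top c))%N)%:R.
  rewrite natr_sum mulr_sumr; apply: eq_bigr => d _.
  have aux (x y z : C) : x - 2 * y - (x - 2 * z) = 2 * (z - y) by ring.
  by rewrite /pos_fun aux (natrB _ (ltnW (position_topbot d))).
have : (position b + \sum_(c <- c :: w) (position (root_bot c) - position (root_top c)) =
    position a)%N.
  apply/eqP; rewrite -(eqr_nat C) natrD; apply/eqP.
  have h2 : (2 : C) != 0 by rewrite pnatr_eq0.
  apply: (mulfI h2); move: h; rewrite e1 /pos_fun => h.
  have aux (x y z v : C) : x - 2 * y + 2 * v = x - 2 * z -> 2 * (z + v) = 2 * y.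
    by move/eqP; rewrite -subr_eq0 => /eqP e0; apply/eqP; rewrite -subr_eq0 -e0;
      apply/eqP; ring.
  exact: aux h.
by rewrite big_cons; have := position_topbot c; lia.
Qed.

(** The height functional, equal to 1 on each simple root. For m = 2l the two middle indices both
    get the value 0, because the fork root joins l-1 to the dual of l. *)
Definition ht_fun (a : idx) : C :=
  if odd m then (m./2 + k + 1)%:R - (position a)%:R
  else if (position a <= k + l)%N then (k + l)%:R - (position a)%:R
  else (k + l + 1)%:R - (position a)%:R.

Lemma ht_antisym : antisym ht_fun.
Proof.
move=> a ha; rewrite /ht_fun; have := position_ibar ha; have := position_gt ha.
move: (position _) (position _) => p p' h1 h2.
have -> : p = (m + 2 * k + 1 - p')%N by lia.
case: ifP => ho.
  rewrite natrB; last lia.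
  have -> : (m + 2 * k + 1)%:R = 2 * (l + k + 1)%:R :> C.
    by rewrite -natrM; congr (_%:R); lia.
  by move: (_%:R) (p'%:R) => x y; ring.
case: ifP => h3; case: ifP => h4; try lia; rewrite natrB; try lia.
  have -> : (m + 2 * k + 1)%:R = (k + l)%:R + (k + l + 1)%:R :> C.
    by rewrite -natrD; congr (_%:R); lia.
  by move: (_%:R) (_%:R) (p'%:R) => x y z; ring.
have -> : (m + 2 * k + 1)%:R = (k + l)%:R + (k + l + 1)%:R :> C.
  by rewrite -natrD; congr (_%:R); lia.
by move: ((k + l)%:R) (_%:R) (p'%:R) => x y z; ring.
Qed.

Lemma ht_topbot c : ht_fun (root_top c) - ht_fun (root_bot c) = 1.
Proof.
have e (x y z : nat) : (x < y)%N -> y = x.+1 ->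
    (z%:R - x%:R) - (z%:R - y%:R) = 1 :> C.
  by move=> _ ->; rewrite -[x.+1]addn1 natrD; move: (z%:R) (x%:R) => u v; ring.
rewrite /ht_fun position_top position_bot; have := hm; have := hk; case: c => [i|mu|] hk' hm'.
- have hi := ltn_ord i; case ho: (odd m).
    by rewrite orbT; apply: e; lia.
  rewrite orbF (ifT _ _ (_ : (_ <= _)%N)); last by case: ifP; lia.
  case: ifP => h1; case: ifP => h2; try lia; first by apply: e; lia.
  have -> : (k + l + 1)%:R = (k + l)%:R + 1 :> C by rewrite natrD.
  have -> : (k + i.+2)%:R = (k + i)%:R + 2%:R :> C by rewrite -natrD; congr (_%:R); lia.
  by move: (_%:R) ((k + i)%:R) => x y; ring.
- have hmu := ltn_ord mu; case ho: (odd m); first by apply: e; lia.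
  by rewrite !ifT; try lia; apply: e; lia.
- case ho: (odd m); first by apply: e; lia.
  by rewrite !ifT; try lia; apply: e; lia.
Qed.

(** The weight of a word determines its length. Hence weight 0 admits only the empty word, and the
    weight of a simple root only words of length one. *)
Lemma ht_wt w : wform (cw ht_fun) (wt w) = (size w)%:R.
Proof.
rewrite (wform_wt _ ht_antisym) (eq_bigr (fun _ => 1)) => [|c _]; last exact: ht_topbot.
by rewrite big_const_seq count_predT; elim: (size w) => //= n ->; rewrite -natr1 addrC.
Qed.

Lemma wt_eq0 w : wt w = 0 -> w = [::].
Proof.
move=> e; have := ht_wt w; rewrite e wform0r => /esym/eqP.
by rewrite pnatr_eq0 => /eqP/size0nil.
Qed.

(* takes a different difference on each simple root *)
Definition sep_fun (a : idx) : C :=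
  let p := position a in
  if odd m && (p == k + l + 1)%N then 0 else
  if (p <= k + l)%N then ((2 * (k + l - p) ^ 2 + 1)%N)%:R
  else - ((2 * (p - (k + l) - 1 - odd m) ^ 2 + 1)%N)%:R.

Lemma sep_antisym : antisym sep_fun.
Proof.
move=> a ha; rewrite /sep_fun; have := position_ibar ha; have := position_gt ha.
move: (position _) (position _) => p p' h1 h2.
case ho: (odd m) => /=; last first.
  case: ifP => h3; case: ifP => h4; try lia.
    by rewrite opprK; congr ((2 * _ ^ 2 + 1)%N)%:R; lia.
  by congr (- ((2 * _ ^ 2 + 1)%N)%:R); lia.
case: eqP => h3; case: eqP => h4; try lia; first by rewrite oppr0.
case: ifP => h5; case: ifP => h6; try lia.
  by rewrite opprK; congr ((2 * _ ^ 2 + 1)%N)%:R; lia.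
by congr (- ((2 * _ ^ 2 + 1)%N)%:R); lia.
Qed.

Lemma wt_alpha w c : wt w = alpha c -> w = [:: c].
Proof.
move=> e; have sw : size w = 1%N.
  have wtc : wt [:: c] = alpha c by rewrite /wt big_seq1.
  have := ht_wt w; rewrite e -wtc ht_wt.
  by move/eqP; rewrite eqr_nat => /eqP.
case: w sw e => [|d [|]] // _; rewrite /wt big_seq1 => e; congr [:: _].
(* The numbers 2x^2 + 1 have consecutive differences 4x - 2, which are distinct and congruent to 2
   modulo 4; the last even root gets 1 or 4 instead, so no two simple roots share a value. *)
have vE (c' : sroot m k) : wform (cw sep_fun) (alpha c') =
   (match c' with
    | sE i => if (i.+1 < l)%N then 4 * (l - i.+1) - 2 else if odd m then 1 else 4
    | sO mu => 4 * (k + l - mu.+1) - 2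
    | sS => 4 * l - 2
    end)%N%:R.
  rewrite alphaE wformBr !(wform_cw sep_antisym) //; clear d e c.
  have sq (x : nat) : (0 < x)%N ->
     (2 * x ^ 2 + 1)%N%:R - (2 * x.-1 ^ 2 + 1)%N%:R = (4 * x - 2)%N%:R :> C.
    case: x => // x _; rewrite [RHS](_ : _ = (4 * x + 2)%N%:R); last by congr (_%:R); lia.
    rewrite succnK -[x.+1]addn1 !(natrD, natrM, natrX); move: (x%:R) => y; ring.
  rewrite /sep_fun position_top position_bot /=.
  have := hm; have := hk; case: c' => [i|mu|] hk' hm'.
  - have hi := ltn_ord i; case: (ltnP i.+1 l) => /= h1.
      rewrite (ifF _ _ (_ : _ && (k + i.+1 == _)%N = false)); last lia.
      rewrite (ifF _ _ (_ : _ && _ = false)); last lia.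
      rewrite !ifT; try lia; rewrite -sq; last lia.
      by congr ((2 * _ ^ 2 + 1)%N%:R - (2 * _ ^ 2 + 1)%N%:R); lia.
    case ho: (odd m) => /=.
      rewrite ifF; last lia; rewrite ifT; last lia; rewrite ifT; last lia.
      by rewrite subr0; congr (_%:R); have -> : (k + l - (k + i.+1) = 0)%N by lia.
    rewrite ifT; last lia; rewrite ifF; last lia; rewrite opprK -natrD; congr (_%:R).
    have -> : (k + l - (k + i) = 1)%N by lia.
    by have -> : (k + i.+2 - (k + l) - 1 - 0 = 0)%N by lia.
  - have hmu := ltn_ord mu.
    rewrite (ifF _ _ (_ : _ && (mu.+1 == _)%N = false)); last lia.
    rewrite (ifF _ _ (_ : _ && _ = false)); last lia.
    rewrite !ifT; try lia; rewrite -sq; last lia.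
    by congr ((2 * _ ^ 2 + 1)%N%:R - (2 * _ ^ 2 + 1)%N%:R); lia.
  - rewrite (ifF _ _ (_ : _ && (k == _)%N = false)); last lia.
    rewrite (ifF _ _ (_ : _ && _ = false)); last lia.
    rewrite !ifT; try lia; rewrite -sq; last lia.
    by congr ((2 * _ ^ 2 + 1)%N%:R - (2 * _ ^ 2 + 1)%N%:R); lia.
have := vE d; rewrite e vE => /eqP; rewrite eqr_nat => /eqP.
case: (c) => [i|mu|]; case: (d) => [j|nu|] //=.
- have hi := ltn_ord i; have hj := ltn_ord j.
  do ?[case: ifP => ?] => *; congr sE; apply: val_inj => /=; lia.
- have hi := ltn_ord i; have hj := ltn_ord nu.
  do ?[case: ifP => ?] => *; lia.
- have hi := ltn_ord i; do ?[case: ifP => ?] => *; lia.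
- have hi := ltn_ord mu; have hj := ltn_ord j.
  do ?[case: ifP => ?] => *; lia.
- have hi := ltn_ord mu; have hj := ltn_ord nu => *.
  by congr sO; apply: val_inj => /=; lia.
- have hi := ltn_ord mu; lia.
- have hj := ltn_ord j; do ?[case: ifP => ?] => *; lia.
- have hj := ltn_ord nu; lia.
Qed.

End Weights.

(** * Words in the generators *)

Section Span.
Variables (K : fieldType) (A : lmodType K).
Implicit Types (Q : A -> Prop) (u x y : A).

Inductive sums Q : A -> Prop :=
  | sums0 : sums Q 0
  | sums_add x y of Q x & sums Q y : sums Q (x + y).

Lemma sums1 Q x : Q x -> sums Q x.
Proof. by move=> qx; rewrite -[x]addr0; apply: sums_add qx (sums0 _). Qed.

Lemma sumsD Q x y : sums Q x -> sums Q y -> sums Q (x + y).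
Proof.
elim=> [|x1 x2 q1 _ IH] hy; first by rewrite add0r.
by rewrite -addrA; apply: sums_add q1 (IH hy).
Qed.

Lemma sums_map Q Q' (f : A -> A) x :
  f 0 = 0 -> {morph f : y z / y + z} -> (forall x, Q x -> sums Q' (f x)) ->
  sums Q x -> sums Q' (f x).
Proof.
move=> f0 fD fQ; elim=> [|x1 x2 q1 _ IH]; first by rewrite f0; apply: sums0.
by rewrite fD; apply: sumsD => //; apply: fQ.
Qed.

Lemma sums_impl Q Q' x : (forall x, Q x -> sums Q' x) -> sums Q x -> sums Q' x.
Proof. by move=> h; apply: (@sums_map Q Q' id). Qed.

Lemma sumsZ Q c x : (forall c x, Q x -> Q (c *: x)) -> sums Q x -> sums Q (c *: x).
Proof.
move=> qZ; apply: (@sums_map Q Q ( *:%R c)); rewrite ?scaler0 //.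
  exact: scalerDr.
by move=> y /(qZ c)/sums1.
Qed.

(** [T - p.2] kills the first term and only rescales the others, so induction on the number of terms
    applies to [(mu - p.2) *: u]. Eigenvalues in the list may repeat. *)
Lemma eigen_diff (T : {linear A -> A}) (mu : K) (s : seq (A * K)) u :
  (forall p, p \in s -> T p.1 = p.2 *: p.1) -> T u = mu *: u ->
  u = \sum_(p <- s) p.1 -> all (fun p => p.2 != mu) s -> u = 0.
Proof.
have [n] := ubnP (size s); elim: n s u => // n IH [|p s] u hn hs Tu.
  by rewrite big_nil.
rewrite big_cons => eu /= /andP [hp hall].
have hTp : T p.1 = p.2 *: p.1 by apply: hs; rewrite mem_head.
pose s' := [seq ((q.2 - p.2) *: q.1, q.2) | q <- s].
have es' : (mu - p.2) *: u = \sum_(q <- s') q.1.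
  rewrite big_map scalerBl -Tu {1}eu linearD hTp linear_sum /= eu scalerDr.
  rewrite opprD addrACA subrr add0r scaler_sumr -sumrB; apply: eq_big_seq => q qs.
  by rewrite hs ?in_cons ?qs ?orbT // scalerBl.
have : (mu - p.2) *: u = 0.
  apply: (IH s') => //.
  - by rewrite size_map.
  - move=> _ /mapP [q qs ->] /=; rewrite linearZ /= hs ?in_cons ?qs ?orbT //.
    by rewrite !scalerA mulrC.
  - by rewrite linearZ /= Tu !scalerA mulrC.
  - by apply/allP => _ /mapP [q qs ->] /=; apply: (allP hall).
by move/eqP; rewrite scaler_eq0 subr_eq0 eq_sym (negPf hp) /= => /eqP.
Qed.

(** The difference of the two sides is an eigenvector for [mu] and a sum of eigenvectors for other
    eigenvalues, hence 0. No independence of the terms [v i] enters. *)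
Lemma eigen_filter (I : Type) (T : {linear A -> A}) (mu : K) (s : seq I)
    (v : I -> A) (nu : I -> K) :
  (forall i, T (v i) = nu i *: v i) ->
  T (\sum_(i <- s) v i) = mu *: \sum_(i <- s) v i ->
  \sum_(i <- s) v i = \sum_(i <- s | nu i == mu) v i.
Proof.
move=> Tv Tu; set g := RHS.
have Tg : T g = mu *: g.
  by rewrite /g linear_sum scaler_sumr /=; apply: eq_bigr => i /eqP <-.
apply/eqP; rewrite -subr_eq0; apply/eqP.
apply: (@eigen_diff T mu [seq (v i, nu i) | i <- [seq i <- s | nu i != mu]]).
- move=> p; elim: s {Tu g Tg} => //= i s IH; case: (nu i != mu) => //=.
  by rewrite in_cons => /orP [/eqP -> /=|/IH //]; apply: Tv.
- by rewrite linearB /= Tu Tg scalerBr.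
- rewrite big_map big_filter (bigID (fun i => nu i == mu)) /= -/g.
  by rewrite addrAC subrr add0r.
- by elim: s {Tu g Tg} => //= i s IH; case: ifP => //= ->; rewrite IH.
Qed.

Lemma eigen_sums (T : {linear A -> A}) (mu : K) Q u :
  (forall x, Q x -> exists nu, T x = nu *: x) -> sums Q u -> T u = mu *: u ->
  sums (fun x => Q x /\ T x = mu *: x) u.
Proof.
move=> hQ hu Tu.
have [s [hs es]] : exists s : seq (A * K),
    (forall p, p \in s -> Q p.1 /\ T p.1 = p.2 *: p.1) /\ u = \sum_(p <- s) p.1.
  elim: hu => [|x y qx _ [s [hs ->]]]; first by exists [::]; rewrite big_nil.
  have [nu hnu] := hQ _ qx; exists ((x, nu) :: s); rewrite big_cons; split=> // p.
  by rewrite in_cons => /orP [/eqP -> //|]; apply: hs.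
pose g := \sum_(p <- s | p.2 == mu) p.1.
have hg : sums (fun x => Q x /\ T x = mu *: x) g.
  rewrite /g big_seq_cond; elim/big_rec: _ => [|p x /andP [ps /eqP ep] hx].
    exact: sums0.
  by apply: sums_add hx; rewrite -ep; apply: hs.
have Tg : T g = mu *: g.
  rewrite /g linear_sum scaler_sumr /= big_seq_cond [RHS]big_seq_cond.
  by apply: eq_bigr => p /andP [/hs [_ ->] /eqP ->].
suff /eqP : u - g = 0 by rewrite subr_eq0 => /eqP ->.
apply: (@eigen_diff T mu [seq p <- s | p.2 != mu]).
- by move=> p; rewrite mem_filter => /andP [_ /hs []].
- by rewrite linearB /= Tu Tg scalerBr.
- by rewrite big_filter es (bigID (fun p => p.2 == mu)) /= -/g addrAC subrr add0r.
- by apply/allP => p; rewrite mem_filter => /andP [].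
Qed.

Lemma eigen_sums_family (J : eqType) (js : seq J) (T : J -> {linear A -> A})
    (mu : J -> K) Q u :
  (forall j x, Q x -> exists nu, T j x = nu *: x) -> sums Q u ->
  (forall j, T j u = mu j *: u) ->
  sums (fun x => Q x /\ forall j, j \in js -> T j x = mu j *: x) u.
Proof.
move=> hQ hu hT; elim: js => [|j js IH].
  by apply: sums_impl hu => x qx; apply: sums1.
have hQ' x : (Q x /\ forall i, i \in js -> T i x = mu i *: x) ->
    exists nu, T j x = nu *: x by case=> /hQ.
apply: sums_impl (eigen_sums hQ' IH (hT j)) => x [[qx h1] h2].
by apply: sums1; split=> // i; rewrite in_cons => /orP [/eqP ->|/h1].
Qed.

End Span.

(** * Normal ordering and the degree in the Cartan generators *)

Section CartanWords.
Variables (R : realType) (m k : nat) (qp : R[i] -> R[i]).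
Local Notation C := R[i].
Local Notation D := (weight R m k).
Local Notation wform := (@wform R m k).
Local Notation alpha := (@alpha R m k).
Local Notation wt := (@root_sum R m k).
Local Notation S := (sroot m k).
Variables (A : algType C) (e : S -> A) (h t : D -> A).
Hypotheses (h_lin : forall (c : C) x y, h (c *: x + y) = c *: h x + h y)
  (hh : forall x y, h x * h y = h y * h x)
  (ht : forall x y, h x * t y = t y * h x)
  (tD : forall x y, t (x + y) = t x * t y)
  (he : forall x c, h x * e c - e c * h x = wform x (alpha c) *: e c)
  (te : forall x c, t x * e c = qp (wform x (alpha c)) *: (e c * t x))
  (et : forall x c, exists z, e c * t x = z *: (t x * e c)).

Definition cart : A -> Prop := subalgebra (fun u => exists x, u = h x \/ u = t x).

Definition root_word (w : seq S) : A := \prod_(c <- w) e c.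
Local Notation ew := root_word.

Lemma cart_comm_h P x : cart P -> P * h x = h x * P.
Proof.
elim=> [_ [y [->|->]]|c|P1 P2 _ h1 _ h2|P1 P2 _ h1 _ h2].
- exact: hh.
- by rewrite ht.
- by rewrite mulr_algl mulr_algr.
- by rewrite mulrDl mulrDr h1 h2.
- by rewrite -mulrA h2 mulrA h1 mulrA.
Qed.

Lemma e_cart c P : cart P -> exists2 P', cart P' & e c * P = P' * e c.
Proof.
elim=> [_ [y [->|->]]|a|P1 P2 _ [Q1 c1 h1] _ [Q2 c2 h2]|P1 P2 _ [Q1 c1 h1] _ [Q2 c2 h2]].
- exists (h y + (- wform y (alpha c))%:A).
    apply: subalgebra_add; last exact: subalgebra_scal.
    by apply: subalgebra_gen; exists y; left.
  by rewrite mulrDl mulr_algl scaleNr -he opprB addrC subrK.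
- have [z ez] := et y c; exists (z%:A * t y); last by rewrite ez mulr_algl scalerAl.
  apply: subalgebra_mul; first exact: subalgebra_scal.
  by apply: subalgebra_gen; exists y; right.
- by exists a%:A; [exact: subalgebra_scal | rewrite mulr_algl mulr_algr].
- by exists (Q1 + Q2); [exact: subalgebra_add | rewrite mulrDl mulrDr h1 h2].
- exists (Q1 * Q2); first exact: subalgebra_mul.
  by rewrite mulrA h1 -mulrA h2 mulrA.
Qed.

Lemma ew_cart w P : cart P -> exists2 P', cart P' & ew w * P = P' * ew w.
Proof.
rewrite /ew; elim: w P => [|c w IH] P cP.
  by exists P; rewrite // big_nil mulr1 mul1r.
have [P1 cP1 e1] := IH _ cP; have [P2 cP2 e2] := e_cart c cP1.
by exists P2; rewrite // big_cons -mulrA e1 mulrA e2 mulrA.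
Qed.

Definition cartan_word (u : A) := exists P w, cart P /\ u = P * ew w.

(** A Cartan element passes to the left of a raising generator at the cost of changing only the
    Cartan factor, so products of normally ordered words can be ordered again. *)
Lemma borel_words u :
  subalgebra (fun u => (exists c, u = e c) \/ (exists x, u = h x \/ u = t x)) u ->
  sums cartan_word u.
Proof.
elim=> [y [[c ->]|[x hx]]|c|x y _ hx _ hy|x y _ hx _ hy].
- apply: sums1; exists 1%:A, [:: c]; split; first exact: subalgebra_scal.
  by rewrite /ew big_seq1 mulr_algl scale1r.
- apply: sums1; exists y, [::]; rewrite /ew big_nil mulr1; split=> //.
  by apply: subalgebra_gen; exists x.
- apply: sums1; exists c%:A, [::]; rewrite /ew big_nil mulr1; split=> //.
  exact: subalgebra_scal.
- exact: sumsD.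
- apply: (@sums_map _ _ cartan_word cartan_word (fun z => z * y)) hx.
  + by rewrite mul0r.
  + by move=> ? ?; rewrite mulrDl.
  move=> _ [P [w [cP ->]]].
  apply: (@sums_map _ _ cartan_word cartan_word (fun z => P * ew w * z)) hy.
  + by rewrite mulr0.
  + by move=> ? ?; rewrite mulrDr.
  move=> _ [P' [w' [cP' ->]]]; apply: sums1.
  have [P2 cP2 e2] := ew_cart w cP'.
  exists (P * P2), (w ++ w'); split; first exact: subalgebra_mul.
  by rewrite mulrA -(mulrA P) e2 /ew big_cat !mulrA.
Qed.

Definition ad_cartan (x : D) (u : A) : A := h x * u - u * h x.
Local Notation adh := ad_cartan.

Lemma adh_is_linear x : linear (adh x).
Proof.
move=> c u v; rewrite /adh mulrDr mulrDl -scalerAr -scalerAl scalerBr opprD.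
by rewrite addrACA.
Qed.
HB.instance Definition _ x := GRing.isLinear.Build C A A _ (adh x) (adh_is_linear x).

Lemma adh_ew x w : adh x (ew w) = wform x (wt w) *: ew w.
Proof.
rewrite /ew /adh /wt; elim: w => [|c w IH].
  by rewrite !big_nil wform0r scale0r mulr1 mul1r subrr.
rewrite !big_cons wformDr scalerDl.
set E := (\prod_(j <- w) e j) in IH *.
have -> : h x * (e c * E) - e c * E * h x =
   (h x * e c - e c * h x) * E + e c * (h x * E - E * h x).
  by rewrite mulrBl mulrBr !mulrA addrA subrK.
by rewrite IH he -scalerAl -scalerAr.
Qed.

Lemma adh_word x P w : cart P -> adh x (P * ew w) = wform x (wt w) *: (P * ew w).
Proof.
move=> cP; rewrite scalerAr -adh_ew /adh mulrBr !mulrA.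
by rewrite (cart_comm_h x cP).
Qed.

(** Normally ordered words are common eigenvectors of all ad h, so only terms with the eigenvalues
    of [nu] are kept. The finitely many eps_a suffice as tests, since they separate the weights. *)
Lemma weight_words (nu : D) u : sums cartan_word u ->
  (forall x, adh x u = wform x nu *: u) ->
  sums (fun z => exists P w, [/\ cart P, z = P * ew w & wt w = nu]) u.
Proof.
move=> hu hnu.
have hw a x : cartan_word x -> exists c, adh (eps R m k a) x = c *: x.
  by case=> P [w [cP ->]]; exists (wform (eps R m k a) (wt w)); apply: adh_word.
apply: sums_impl (eigen_sums_family (indices m k) hw hu (fun a => hnu _)) => z.
case=> [[P [w [cP ez]]] hz].
have [->|z0] := eqVneq z 0; first exact: sums0.
apply: sums1; exists P, w; split=> //; apply: wform_nondeg => a ha.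
have := hz _ ha; rewrite /= ez adh_word // -ez => /eqP.
by rewrite -subr_eq0 -scalerBl scaler_eq0 (negPf z0) orbF subr_eq0 => /eqP.
Qed.

(* Elements of U^0 v0 filtered by the degree in the h's. *)
Section Euler.
Variables (v0 : A) (I : finType) (b : I -> D) (cc : I -> D -> C).
Variable T : I -> {lrmorphism A -> A}.
Hypotheses (Tt : forall i x, T i (t x) = t x) (Tv : forall i, T i v0 = v0)
  (Th : forall i x, T i (h x) = h x + (cc i x)%:A)
  (hb : forall x, \sum_i cc i x *: h (b i) = h x).

Definition tv (u : A) := exists c x, u = c *: (t x * v0).

(** An upper bound for the degree, kept as a predicate: without independence of the monomials an
    element has no degree of its own. *)
Fixpoint hdeg (d : nat) : A -> Prop :=
  match d with
  | 0 => sums tv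
  | d.+1 => sums (fun z => hdeg d z \/ exists x z', hdeg d z' /\ z = h x * z')
  end.

Lemma hdegD d u v : hdeg d u -> hdeg d v -> hdeg d (u + v).
Proof. by case: d => [|d]; apply: sumsD. Qed.

Lemma hdeg0 d : hdeg d 0.
Proof. by case: d => [|d]; apply: sums0. Qed.

Lemma hdegZ d c u : hdeg d u -> hdeg d (c *: u).
Proof.
elim: d c u => [|d IH] c u /=; apply: sumsZ.
  by move=> a _ [c' [x ->]]; exists (a * c'), x; rewrite scalerA.
move=> a z [/(IH a)|[x [z' [/(IH a) hz ->]]]]; first by left.
by right; exists x, (a *: z'); rewrite scalerAr.
Qed.

Lemma hdegB d u v : hdeg d u -> hdeg d v -> hdeg d (u - v).
Proof. by move=> hu hv; rewrite -scaleN1r; apply: hdegD hu (hdegZ _ hv). Qed.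

Lemma hdegS d u : hdeg d u -> hdeg d.+1 u.
Proof. by move=> hu; apply: sums1; left. Qed.

Lemma hdeg_le d d' u : (d <= d')%N -> hdeg d u -> hdeg d' u.
Proof. by move=> /subnK <- hu; elim: (d' - d)%N => // n /hdegS. Qed.

Lemma hdeg_h d x u : hdeg d u -> hdeg d.+1 (h x * u).
Proof. by move=> hu; apply: sums1; right; exists x, u. Qed.

Lemma hdeg_sum d (J : Type) (s : seq J) (f : J -> A) :
  (forall i, hdeg d (f i)) -> hdeg d (\sum_(i <- s) f i).
Proof.
by move=> hf; elim/big_rec: _ => [|i x _]; [exact: hdeg0 | apply: hdegD].
Qed.

Lemma hdeg_t d x u : hdeg d u -> hdeg d (t x * u).
Proof.
elim: d u => [|d IH] u /=.
  apply: (@sums_map _ _ tv tv (fun z => t x * z)).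
  - by rewrite mulr0.
  - by move=> ? ?; rewrite mulrDr.
  by move=> _ [c [y ->]]; apply: sums1; exists c, (x + y); rewrite -scalerAr tD mulrA.
pose Q z := hdeg d z \/ exists x z', hdeg d z' /\ z = h x * z'.
apply: (@sums_map _ _ Q Q (fun z => t x * z)).
- by rewrite mulr0.
- by move=> ? ?; rewrite mulrDr.
move=> z [/IH hz|[y [z' [/IH hz ->]]]]; apply: sums1; first by left.
by right; exists y, (t x * z'); rewrite !mulrA ht.
Qed.

Arguments hdeg : simpl never.

Lemma cart_hdeg P : cart P -> (exists z, t z = 1) -> exists d, hdeg d (P * v0).
Proof.
move=> cP [z0 tz0].
suff key : cart P -> forall u, (exists d, hdeg d u) -> exists d, hdeg d (P * u).
  apply: key => //; exists 0; apply: sums1; exists 1, z0.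
  by rewrite scale1r tz0 mul1r.
elim=> [_ [x [->|->]]|c|P1 P2 _ h1 _ h2|P1 P2 _ h1 _ h2] u [d hu].
- by exists d.+1; apply: hdeg_h.
- by exists d; apply: hdeg_t.
- by exists d; rewrite mulr_algl; apply: hdegZ.
- have [|d1 H1] := h1 u; first by exists d.
  have [|d2 H2] := h2 u; first by exists d.
  exists (maxn d1 d2); rewrite mulrDl.
  by apply: hdegD; [apply: hdeg_le H1 | apply: hdeg_le H2]; rewrite ?leq_maxl ?leq_maxr.
- by rewrite -mulrA; apply: h1; apply: h2; exists d.
Qed.

Lemma T_tv i u : tv u -> T i u = u.
Proof. by case=> c [x ->]; rewrite linearZ rmorphM /= Tt Tv. Qed.

Lemma hdeg0_T i u : hdeg 0 u -> T i u = u.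
Proof.
elim=> [|x y hx _ IH]; first by rewrite rmorph0.
by rewrite rmorphD /= IH T_tv.
Qed.

(** [T i] translates the variables [h x] by constants, so [T i - 1] is a finite difference and
    lowers the degree. *)
Lemma hdeg_T i d u : hdeg d.+1 u -> hdeg d (T i u - u).
Proof.
elim: d u => [|d IH] u hu.
  elim: hu => [|x y hx _ hy]; first by rewrite rmorph0 subrr; apply: hdeg0.
  rewrite rmorphD /= opprD addrACA; apply: hdegD => //.
  case: hx => [hx|[z [z' [hz' ->]]]]; first by have -> := hdeg0_T i hx; rewrite subrr; apply: hdeg0.
  rewrite rmorphM /= Th (hdeg0_T i hz') mulrDl mulr_algl addrAC subrr add0r.
  exact: hdegZ.
elim: hu => [|x y hx _ hy]; first by rewrite rmorph0 subrr; apply: hdeg0.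
rewrite rmorphD /= opprD addrACA; apply: hdegD => //.
case: hx => [hx|[z [z' [hz' ->]]]]; first by apply: hdegS; apply: IH.
have h1 := IH _ hz'.
rewrite rmorphM /= Th mulrDl mulr_algl addrAC -mulrBr; apply: hdegD.
  exact: hdeg_h.
by apply: hdegZ; rewrite -[T i z'](subrK z'); apply: hdegD => //; apply: hdegS.
Qed.

Lemma hdeg_h_T i d x u : hdeg d u -> hdeg d (h x * (T i u - u)).
Proof.
case: d => [|d] hu; last by apply: hdeg_h; apply: hdeg_T.
by rewrite hdeg0_T // subrr mulr0; apply: hdeg0.
Qed.

(** The Euler operator, the sum of coordinates times partial derivatives, with finite differences in
    place of derivatives. *)
Definition euler (u : A) := \sum_i h (b i) * (T i u - u).

Lemma eulerD u v : euler (u + v) = euler u + euler v.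
Proof.
rewrite /euler -big_split; apply: eq_bigr => i _ /=.
by rewrite rmorphD /= opprD addrACA mulrDr.
Qed.

(** The Leibniz rule; the last sum is the error made by differences in place of derivatives, and its
    degree is below that of [h x * u]. *)
Lemma euler_h x u : euler (h x * u) = h x * euler u + h x * u +
  \sum_i cc i x *: (h (b i) * (T i u - u)).
Proof.
rewrite -[in X in _ + X + _]hb /euler mulr_sumr mulr_suml -!big_split.
apply: eq_bigr => i _ /=.
have -> : T i (h x * u) - h x * u = h x * (T i u - u) + cc i x *: T i u.
  by rewrite rmorphM /= Th mulrDl mulr_algl addrAC -mulrBr.
rewrite mulrDr !mulrA (hh (b i)) -addrA; congr (_ + _).
by rewrite -scalerAr -scalerAl -scalerDr -mulrDr [u + _]addrC subrK.
Qed.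

(* Euler's identity for homogeneous functions, up to terms of lower degree *)
Lemma euler_hdeg d u : hdeg d.+1 u -> hdeg d (euler u - d.+1%:R *: u).
Proof.
have e0 z : hdeg 0 z -> euler z = 0.
  by move=> hz; rewrite /euler big1 // => i _; rewrite hdeg0_T // subrr mulr0.
elim: d u => [|d IH] u hu; elim: hu => [|x y hx _ hy].
- by rewrite scaler0 subr0 /euler big1 ?rmorph0 => [|i _];
    [exact: hdeg0 | rewrite rmorph0 subrr mulr0].
- rewrite eulerD scalerDr opprD addrACA; apply: hdegD => //.
  case: hx => [hx|[z [z' [hz' ->]]]].
    by rewrite e0 // sub0r -scaleN1r; apply/hdegZ/hdegZ.
  rewrite euler_h e0 // mulr0 add0r big1 => [|i _]; last first.
    by rewrite hdeg0_T // subrr mulr0 scaler0.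
  by rewrite addr0 scale1r subrr; apply: hdeg0.
- by rewrite scaler0 subr0 /euler big1 ?rmorph0 => [|i _];
    [exact: hdeg0 | rewrite rmorph0 subrr mulr0].
- rewrite eulerD scalerDr opprD addrACA; apply: hdegD => //.
  case: hx => [hx|[z [z' [hz' ->]]]].
    apply: hdegB; last exact: hdegZ.
    by apply: hdeg_sum => i; apply: hdeg_h_T.
  rewrite euler_h -[X in _ - X%:R *: _]addn1 natrD scalerDl scale1r.
  rewrite [X in X - _]addrAC [X in _ - X]addrC addrKA addrAC scalerAr -mulrBr.
  apply: hdegD; first by apply: hdeg_h; apply: IH.
  by apply: hdeg_sum => i; apply: hdegZ; apply: hdeg_h_T.
Qed.

(** If some eigenvalue [s i] is not 1, then [(s i - 1) *: u] is a difference and has lower degree.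
    If all are 1, then [euler u = 0], and Euler's identity shows that [d.+1%:R *: u] has lower
    degree. Descent ends in degree 0. *)
Lemma eigen_hdeg0 (s : I -> C) d u :
  hdeg d u -> (forall i, T i u = s i *: u) -> hdeg 0 u.
Proof.
move=> hu Tu; elim: d hu => // d IH hu; apply: IH.
have [[i si]|s1] := pselect (exists i, s i != 1).
  have := hdeg_T i hu; rewrite Tu -{2}[u]scale1r -scalerBl => h1.
  have n0 : s i - 1 != 0 by rewrite subr_eq0.
  by rewrite -[u]scale1r -(mulVf n0) -scalerA; apply: hdegZ.
have := euler_hdeg hu; rewrite {1}/euler big1 => [|i _]; last first.
  rewrite Tu (_ : s i = 1) ?scale1r ?subrr ?mulr0 //.
  by apply/eqP; apply/negPn/negP => hs; apply: s1; exists i.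
rewrite sub0r -scaleNr => h1.
have n0 : - d.+1%:R != 0 :> C by rewrite oppr_eq0 pnatr_eq0.
by rewrite -[u]scale1r -(mulVf n0) -scalerA; apply: hdegZ.
Qed.

End Euler.
End CartanWords.

(** * Characters of the additive group of C that are trivial on the integers *)

Section IntCharacter.
Local Open Scope complex_scope.

(** For non-real z the exponential of the imaginary part will do; for real z it is w |-> exp(2 pi i
    Re w). *)
Lemma int_character (R : realType) (z : R[i]) : (forall n : int, z != n%:~R) ->
  exists E : R[i] -> R[i],
    [/\ forall x y, E (x + y) = E x * E y, E 1 = 1 & E z != 1].
Proof.
case: z => x y hz; have [y0|y0] := eqVneq y 0; last first.
  exists (fun w => (expR (complex.Im w))%:C); split.
  - by move=> [a b] [c d] /=; rewrite expRD rmorphM.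
  - by rewrite /= expR0.
  - by rewrite (inj_eq (@complexI R)) /= -expR0 (inj_eq (@expR_inj R)).
pose th (w : R[i]) := pi *+ 2 * complex.Re w.
exists (fun w => cos (th w) +i* sin (th w)); split.
- move=> [a b] [c d]; rewrite /th /= mulrDr cosD sinD.
  by apply/eqP; rewrite eq_complex /= !eqxx /= addrC eqxx.
- by rewrite /th /= mulr1 cos2pi sin2pi.
have periodic_cos (n : nat) w : cos (pi *+ 2 * (w + n%:R)) = cos (pi *+ 2 * w :> R).
  elim: n => [|n IH]; first by rewrite addr0.
  by rewrite -natr1 addrA mulrDr mulr1 cosD2pi IH.
apply/negP => /eqP [] h _; move: h; rewrite /th /=.
pose f := x - (Num.floor x)%:~R.
have -> : cos (pi *+ 2 * x) = cos (pi *+ 2 * f).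
  rewrite -[x in LHS](subrK (Num.floor x)%:~R) -/f.
  case: (Num.floor x) => n; first by rewrite periodic_cos.
  by rewrite NegzE mulrNz -pmulrn -[LHS](periodic_cos n.+1) subrK.
have f0 : 0 < f.
  rewrite lt_def subr_ge0 Num.Theory.floor_le andbT subr_eq0.
  apply: contra (hz (Num.floor x)) => /eqP ex.
  by rewrite y0 -(rmorph_int (real_complex R)) /= -ex.
have f1 : f < 1 by rewrite ltrBlDr addrC -[X in _ + X]/(1%:~R) -intrD Num.Theory.floorD1_gt.
have sp : 0 < sin (pi * f).
  by apply: sin_gt0_pi; rewrite mulr_gt0 ?pi_gt0 //= gtr_pMr ?pi_gt0.
(* For the fractional part f, cos(2 pi f) = 1 - 2 sin(pi f)^2, and sin(pi f) > 0 because 0 < f <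
   1. *)
rewrite mulrnAl cos_mulr2n cos2sin2 => h.
suff /eqP : sin (pi * f) ^+ 2 = 0 by rewrite sqrf_eq0 gt_eqF.
by lra.
Qed.

End IntCharacter.

(** * Powers of q *)

Section Powers.
Variables (K : fieldType) (q : K) (qp : K -> K).
Hypotheses (hq0 : q != 0) (hqp1 : qp 1 = q)
  (hqpD : forall x y, qp (x + y) = qp x * qp y).

Lemma qp0 : qp 0 = 1.
Proof. by apply: (mulIf hq0); rewrite -{1}hqp1 -hqpD add0r mul1r. Qed.

Lemma qpNM x : qp (- x) * qp x = 1.
Proof. by rewrite -hqpD addNr qp0. Qed.

Lemma qp_neq0 x : qp x != 0.
Proof. by apply: contra_eq_neq (qpNM x) => ->; rewrite mulr0 eq_sym oner_neq0. Qed.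

Lemma qpN x : qp (- x) = (qp x)^-1.
Proof. by apply: (mulIf (qp_neq0 x)); rewrite qpNM mulVf ?qp_neq0. Qed.

Lemma qp_nat n : qp n%:R = q ^+ n.
Proof. by elim: n => [|n IH]; rewrite ?qp0 // -natr1 hqpD IH hqp1 exprSr. Qed.

Hypothesis hq : forall j : nat, (0 < j)%N -> q ^+ j != 1.

Lemma qp_int_eq1 (n : int) : qp n%:~R = 1 -> n = 0.
Proof.
case: n => n; last rewrite NegzE mulrNz qpN => /eqP; rewrite -pmulrn qp_nat.
  by case: n => // n /eqP; rewrite (negPf (hq _)).
by rewrite invr_eq1 (negPf (hq _)).
Qed.

Lemma q_sub_neq0 : q - q^-1 != 0.
Proof.
rewrite subr_eq0; apply/negP => /eqP e; have /negP [] := hq (isT : (0 < 2)%N).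
by rewrite expr2 {2}e mulfV.
Qed.
End Powers.

(** * Generators, parities and one-dimensional representations *)

Section Quantum.
Variables (R : realType) (m k : nat) (q : R[i]) (qp : R[i] -> R[i]).
Local Notation C := R[i].
Local Notation D := (weight R m k).
Local Notation alpha := (@alpha R m k).
Local Notation S := (sroot m k).
Local Notation U := (Uq m k q qp).
Local Notation UU := (UU m k q qp).
Local Notation Ue := (@Ue R m k q qp).
Local Notation Uf := (@Uf R m k q qp).
Local Notation Uh := (@Uh R m k q qp).
Local Notation Ut := (@Ut R m k q qp).

Definition is_gen (u : U) : Prop :=
  [\/ exists c, u = Ue c, exists c, u = Uf c, exists x, u = Uh x | exists x, u = Ut x].

Lemma Uq_gen (u : U) : subalgebra is_gen u.
Proof.
elim/(@pcls_ind _ (osp_presentation m k q qp)): u.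
elim=> [[c|c|x|x]|c|s hs t ht|s hs t ht].
- by apply: subalgebra_gen; apply: Or41; exists c.
- by apply: subalgebra_gen; apply: Or42; exists c.
- by apply: subalgebra_gen; apply: Or43; exists x.
- by apply: subalgebra_gen; apply: Or44; exists x.
- have -> : pcls (P := osp_presentation m k q qp) (TScal c) = c%:A.
    apply/esym; rewrite pcls1 pclsZ; apply/pclsP => A th phi _ _ _ /=.
    by rewrite scale1r mulr1.
  exact: subalgebra_scal.
- by rewrite -pclsD; apply: subalgebra_add.
- by rewrite -pclsM; apply: subalgebra_mul.
Qed.

Lemma grad_e c : grad (Ue c) = (-1) ^+ spar c *: Ue c.
Proof. by rewrite [LHS]gradE pclsZ. Qed.
Lemma grad_f c : grad (Uf c) = (-1) ^+ spar c *: Uf c.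
Proof. by rewrite [LHS]gradE pclsZ. Qed.
Lemma grad_h x : grad (Uh x) = Uh x.
Proof. by rewrite [LHS]gradE. Qed.
Lemma grad_t x : grad (Ut x) = Ut x.
Proof. by rewrite [LHS]gradE. Qed.

Lemma homog_e c : homog (spar c) (Ue c).
Proof. by rewrite /homog grad_e. Qed.
Lemma homog_f c : homog (spar c) (Uf c).
Proof. by rewrite /homog grad_f. Qed.
Lemma homog_h x : homog false (Uh x).
Proof. by rewrite /homog grad_h scale1r. Qed.
Lemma homog_t x : homog false (Ut x).
Proof. by rewrite /homog grad_t scale1r. Qed.
Lemma homog_1 : homog false (1 : U).
Proof. by rewrite /homog rmorph1 scale1r. Qed.

(** The values on h and on q^h can be prescribed separately, since the relations link them only
    through their commutation with e_c and f_c, which act by 0 here. The condition on [chi] is the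
    relation for [e_c, f_c] with vanishing left side. *)
Lemma one_dim_rep (cc : D -> C) (chi : D -> C) :
  (forall c x y, cc (c *: x + y) = c * cc x + cc y) ->
  chi 0 = 1 -> (forall x y, chi (x + y) = chi x * chi y) ->
  (forall c, chi (alpha c) = chi (- alpha c)) ->
  exists f : {lrmorphism U -> C^o},
    [/\ forall c, f (Ue c) = 0, forall c, f (Uf c) = 0, forall x, f (Uh x) = cc x,
        forall x, f (Ut x) = chi x & forall u, f (grad u) = f u].
Proof.
move=> cc_lin chi0 chiD chia.
pose phi (g : osp_gen R m k) : C^o :=
  match g with Gh x => cc x | Gt x => chi x | _ => 0 end.
have phi_grad g : phi g = teval phi (osp_grad g) by case: g => //= c; rewrite mulr0.
have serre0 (X : S -> C^o) (z : C) : (forall c, X c = 0) -> q_serre qp X z.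
  move=> X0; have ad0 b x : x.1.1 = 0 -> (adq qp X z b x).1.1 = 0.
    by move=> x0; rewrite /adq /= x0 X0 !mulr0 scaler0 subrr.
  split=> [b c N _ _ _|b c *|b c *]; last 2 first.
  - by apply: ad0; apply: X0.
  - by do 3!apply: (ad0); apply: X0.
  by elim: N => [|N IH] /=; [exact: X0 | exact: ad0].
have phi_rel : osp_rel q qp phi.
  split=> /=; try by move=> *; rewrite ?(mul0r, mulr0, scaler0, subrr, addr0).
  - by move=> x y; rewrite mulrC.
  - by move=> x y; rewrite mulrC.
  - by move=> c; rewrite !mul0r scaler0 subrr chia subrr scaler0.
  - by apply: serre0 => c; rewrite mul0r.
  - by apply: serre0 => c; rewrite mul0r.
have [f [fE fg]] := @pres_lift _ (osp_presentation m k q qp) (C^o : algType C) idfun phi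
          (fun _ => erefl) phi_grad phi_rel.
by exists f; split=> // *; apply: fE.
Qed.

Lemma tens_homog_l (p : bool) (f : {lrmorphism U -> C^o}) (u : U) :
  (forall u, f (grad u) = f u) -> homog p u -> p -> f u = 0.
Proof.
move=> fg /eqP hu pt; have := fg u; rewrite hu pt linearZ /= => /eqP.
rewrite -subr_eq0 -[X in _ - X]scale1r -scalerBl -opprD scaler_eq0 oppr_eq0.
by rewrite -(natrD _ 1 1) pnatr_eq0 /= => /eqP.
Qed.

(** This is id (x) f. It respects the sign rule of the graded tensor product because [f], being
    invariant under the grading, vanishes on odd elements. *)
Lemma slide_exists (f : {lrmorphism U -> C^o}) : (forall u, f (grad u) = f u) ->
  exists F : {lrmorphism UU -> U}, forall x y, F (tens x y) = f y *: x.
Proof.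
move=> fg; pose phi (g : U + U) : U := match g with inl x => x | inr y => (f y)%:A end.
have phi_grad g : (@grad _ (osp_presentation m k q qp)) (phi g) = teval phi (tsq_grad g).
  by case: g => x //=; rewrite linearZ /= rmorph1 fg.
have phi_rel : tsq_rel phi.
  split=> //.
  - split=> [c x y||x y] /=; first by rewrite linearP scalerDl scalerA.
      by rewrite rmorph1 scale1r.
    by rewrite rmorphM /= mulr_algl scalerA.
  - move=> p r x y hx hy /=; rewrite mulr_algl mulr_algr.
    case: r hy => [hy|_]; last by rewrite andbF scale1r.
    by rewrite (tens_homog_l fg hy) // !scale0r scaler0.
have [F [FE _]] := @pres_lift _ (tsq_presentation (counit_grad (q := q) (qp := qp)))
   (U : algType C) (@grad _ (osp_presentation m k q qp)) phi (@gradK _ _) phi_grad phi_rel.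
by exists F => x y; rewrite /tens rmorphM /= !FE /= mulr_algr.
Qed.

End Quantum.

(** * Modules and tensor products *)

(* MathComp's matrices over a noncommutative B are only a B-module; here they
   are made a K-algebra. *)
Section MatrixAlgebra.
Variables (K : comNzRingType) (B : algType K) (d : nat).

Definition mxalg : Type := 'M[B]_d.+1.
HB.instance Definition _ := GRing.NzRing.on mxalg.

Definition mxalg_scale (c : K) (M : mxalg) : mxalg := \matrix_(i, j) (c *: M i j).

Fact mxalg_scaleA a b v : mxalg_scale a (mxalg_scale b v) = mxalg_scale (a * b) v.
Proof. by apply/matrixP => i j; rewrite !mxE scalerA. Qed.
Fact mxalg_scale1 : left_id 1 mxalg_scale.
Proof. by move=> v; apply/matrixP => i j; rewrite !mxE scale1r. Qed.
Fact mxalg_scaleDr : right_distributive mxalg_scale +%R.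
Proof. by move=> c u v; apply/matrixP => i j; rewrite !mxE scalerDr. Qed.
Fact mxalg_scaleDl v : {morph mxalg_scale^~ v : a b / a + b}.
Proof. by move=> a b; apply/matrixP => i j; rewrite !mxE scalerDl. Qed.
HB.instance Definition _ := GRing.Zmodule_isLmodule.Build K mxalg
  mxalg_scaleA mxalg_scale1 mxalg_scaleDr mxalg_scaleDl.

Fact mxalg_scaleAl (a : K) (u v : mxalg) : a *: (u * v) = (a *: u) * v.
Proof.
apply/matrixP => i j; rewrite !mxE scaler_sumr; apply: eq_bigr => x _.
by rewrite mxE scalerAl.
Qed.
HB.instance Definition _ := GRing.Lmodule_isLalgebra.Build K mxalg mxalg_scaleAl.
Fact mxalg_scaleAr (a : K) (u v : mxalg) : a *: (u * v) = u * (a *: v).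
Proof.
apply/matrixP => i j; rewrite !mxE scaler_sumr; apply: eq_bigr => x _.
by rewrite mxE scalerAr.
Qed.
HB.instance Definition _ := GRing.Lalgebra_isAlgebra.Build K mxalg mxalg_scaleAr.

Variables (p : 'I_d.+1 -> bool) (g : {lrmorphism B -> B}).

Definition mxgrad (M : mxalg) : mxalg :=
  \matrix_(i, j) ((-1) ^+ (p i (+) p j) *: g (M i j)).

Fact mxgrad_linear : linear mxgrad.
Proof.
move=> a u v; apply/matrixP => i j; rewrite !mxE linearP scalerDr.
by rewrite !scalerA mulrC.
Qed.
Fact mxgrad_mult : monoid_morphism mxgrad.
Proof.
split=> [|u v]; apply/matrixP => i j; rewrite !mxE.
  by case: eqP => [->|_]; rewrite ?addbb ?rmorph1 ?rmorph0 ?scale1r ?scaler0.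
rewrite linear_sum scaler_sumr; apply: eq_bigr => x _; rewrite !mxE rmorphM /=.
rewrite -scalerAl -scalerAr scalerA -signr_addb; congr (_ ^+ nat_of_bool _ *: _).
by rewrite addbA -(addbA _ (p x) (p x)) addbb addbF.
Qed.
HB.instance Definition _ := GRing.isLinear.Build K mxalg mxalg _ mxgrad mxgrad_linear.
HB.instance Definition _ := GRing.isMonoidMorphism.Build mxalg mxalg mxgrad mxgrad_mult.

Lemma mxgradK : involutive g -> involutive mxgrad.
Proof.
move=> gK u; apply/matrixP => i j; rewrite !mxE linearZ /= gK scalerA -signr_addb.
by rewrite addbb scale1r.
Qed.
End MatrixAlgebra.

(** * Matrix representations of the graded tensor square *)

Section Lift.
Variables (R : realType) (m k : nat) (q : R[i]) (qp : R[i] -> R[i]).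
Local Notation C := R[i].
Local Notation U := (Uq m k q qp).
Local Notation UU := (UU m k q qp).

Definition mx_rep (B : algType C) d (g : B -> B) (p : 'I_d -> bool) (f : U -> 'M[B]_d) :=
  [/\ forall c x y, f (c *: x + y) = map_mx ( *:%R c) (f x) + f y, f 1 = 1%:M,
      forall x y, f (x * y) = f x *m f y &
      forall x i j, f (grad x) i j = (-1) ^+ (p i (+) p j) *: g (f x i j)].

Lemma UU_lift_mx (B : algType C) d (g : {lrmorphism B -> B}) (p : 'I_d -> bool)
    (f1 f2 : U -> 'M[B]_d) : involutive g -> mx_rep g p f1 -> mx_rep g p f2 ->
  (forall (r s : bool) x y, homog r x -> homog s y ->
     f2 y *m f1 x = map_mx ( *:%R ((-1) ^+ (r && s))) (f1 x *m f2 y)) ->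
  exists F : UU -> 'M[B]_d,
    [/\ forall c x y, F (c *: x + y) = map_mx ( *:%R c) (F x) + F y, F 1 = 1%:M,
        forall x y, F (x * y) = F x *m F y,
        forall x i j, F (grad x) i j = (-1) ^+ (p i (+) p j) *: g (F x i j) &
        forall x y, F (tens x y) = f1 x *m f2 y].
Proof.
case: d p f1 f2 => [|d] p f1 f2 gK [l1 u1 m1 g1] [l2 u2 m2 g2] sc.
  (* Size 0 is treated apart: the matrices then form the zero ring, which is not an admissible
     target of the universal property. *)
  have e0 (M N : 'M[B]_0) : M = N by rewrite [M]flatmx0 [N]flatmx0.
  by exists (fun _ => 0); split=> // x [].
pose phi (z : U + U) : mxalg B d := match z with inl x => f1 x | inr y => f2 y end.
have scE (c : C) (M : mxalg B d) : c *: M = map_mx ( *:%R c) M.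
  by apply/matrixP => i j; rewrite !mxE.
have phi_grad z : mxgrad p g (phi z) = teval phi (tsq_grad z).
  by case: z => x /=; apply/matrixP => i j; rewrite mxE ?g1 ?g2.
have phi_rel : tsq_rel phi.
  split=> [||r s x y hx hy] /=.
  - by split=> // c x y; rewrite scE -l1.
  - by split=> // c x y; rewrite scE -l2.
  - by rewrite scE -sc.
have [F [FE Fg]] := @pres_lift _ (tsq_presentation (counit_grad (q := q) (qp := qp)))
   (mxalg B d) (mxgrad p g) phi (mxgradK p gK) phi_grad phi_rel.
exists F; split.
- by move=> c x y; rewrite -scE; exact: (linearP F).
- exact: (rmorph1 F).
- exact: (rmorphM F).
- by move=> x i j; have := congr1 (fun M : 'M_d.+1 => M i j) (Fg x); rewrite /= => ->; rewrite mxE.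
- by move=> x y; rewrite /tens (rmorphM F) /= !FE.
Qed.

Lemma wmodule_rep d (W : wmodule m k q qp d) (p : bool) x i j :
  homog p x -> wpar W i (+) wpar W j != p -> W x i j = 0.
Proof.
by move=> hx; apply: contraNeq => /(wact_par hx) ->.
Qed.

Lemma wact0 d (W : wmodule m k q qp d) : W 0 = 0.
Proof.
have := wactP W 1 0 0; rewrite !scale1r addr0 => /eqP.
by rewrite -subr_eq0 opprD addrA subrr sub0r oppr_eq0 => /eqP.
Qed.
Lemma wactD d (W : wmodule m k q qp d) x y : W (x + y) = W x + W y.
Proof. by have := wactP W 1 x y; rewrite !scale1r. Qed.
Lemma wactZ d (W : wmodule m k q qp d) c x : W (c *: x) = c *: W x.
Proof. by have := wactP W c x 0; rewrite !addr0 wact0 addr0. Qed.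
Lemma wactB d (W : wmodule m k q qp d) x y : W (x - y) = W x - W y.
Proof. by rewrite -[- y]scaleN1r wactD wactZ scaleN1r. Qed.
Lemma wact_sum d (W : wmodule m k q qp d) (I : Type) (s : seq I) (P : pred I) f :
  W (\sum_(i <- s | P i) f i) = \sum_(i <- s | P i) W (f i).
Proof. exact: (big_morph W (@wactD d W) (wact0 W)). Qed.

Lemma homog_parts (x : U) : exists x0 x1,
  [/\ homog false x0, homog true x1, x = x0 + x1 & grad x = x0 - x1].
Proof.
have n2 : (2 : C) != 0 by rewrite pnatr_eq0.
have half (y : U) : 2^-1 *: (y + y) = y.
  by rewrite -[y + y]mulr2n -[y *+ 2]scaler_nat scalerA mulVf // scale1r.
exists (2^-1 *: (x + grad x)), (2^-1 *: (x - grad x)); split.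
- by rewrite /homog linearZ linearD /= gradK scale1r addrC.
- by rewrite /homog linearZ linearB /= gradK scaleN1r -scalerN opprB.
- by rewrite -scalerDr addrACA subrr addr0 half.
- by rewrite -scalerBr opprB [x + _ + _]addrC addrA subrK half.
Qed.

Lemma wact_grad d (W : wmodule m k q qp d) x i j :
  W (grad x) i j = (-1) ^+ (wpar W i (+) wpar W j) * W x i j.
Proof.
have [x0 [x1 [h0 h1 -> ->]]] := homog_parts x.
rewrite wactB wactD !mxE; case e: (wpar W i (+) wpar W j).
  by rewrite (wmodule_rep (i := i) (j := j) h0) ?e // !add0r mulN1r.
by rewrite (wmodule_rep (i := i) (j := j) h1) ?e // !addr0 oppr0 addr0 mul1r.
Qed.

End Lift.

Lemma sum_deltal (A : pzRingType) (I : finType) (i : I) (F : I -> A) :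
  \sum_j (i == j)%:R * F j = F i.
Proof.
rewrite (bigD1 i) //= eqxx mul1r big1 ?addr0 // => j /negPf.
by rewrite eq_sym => ->; rewrite mul0r.
Qed.

(** * Bases of tensor products indexed by pairs *)

Section Pairs.
Variables (d d' : nat).
Local Notation D := #|{: 'I_d * 'I_d'}|.

Definition pk (i : 'I_d) (x : 'I_d') : 'I_D := enum_rank (i, x).

Lemma pkE i x : enum_val (pk i x) = (i, x).
Proof. exact: enum_rankK. Qed.

Lemma pk_surj (y : 'I_D) : y = pk (enum_val y).1 (enum_val y).2.
Proof. by rewrite /pk -surjective_pairing enum_valK. Qed.

Lemma pk_eq i x j y : (pk i x == pk j y) = (i == j) && (x == y).
Proof. by rewrite (inj_eq enum_rank_inj) xpair_eqE. Qed.

Lemma sum_pk (A : nmodType) (F : 'I_D -> A) : \sum_z F z = \sum_i \sum_x F (pk i x).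
Proof.
rewrite (reindex (@enum_rank [the finType of ('I_d * 'I_d')%type])) /=; last first.
  by apply: onW_bij; exists enum_val; [exact: enum_rankK | exact: enum_valK].
by rewrite pair_big; apply: eq_bigr => -[i x] _.
Qed.

Lemma pk_ext (A : Type) (M N : 'M[A]_D) :
  (forall i x j y, M (pk i x) (pk j y) = N (pk i x) (pk j y)) -> M = N.
Proof. by move=> h; apply/matrixP => a b; rewrite (pk_surj a) (pk_surj b). Qed.
End Pairs.

(** * Tensor products of weight modules *)

Section Modules.
Variables (R : realType) (m k : nat) (q : R[i]) (qp : R[i] -> R[i]).
Local Notation C := R[i].
Local Notation wform := (@wform R m k).
Local Notation U := (Uq m k q qp).
Local Notation UU := (UU m k q qp).
Local Notation Uh := (@Uh R m k q qp).
Local Notation Ut := (@Ut R m k q qp).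
Local Notation wmodule := (wmodule m k q qp).

Local Notation gradUU := (@grad _ (tsq_presentation (@counit_grad R m k q qp))).

Hypotheses (hq0 : q != 0) (hqp1 : qp 1 = q)
  (hqpD : forall x y : C, qp (x + y) = qp x * qp y).

Variables (Delta : {lrmorphism U -> UU}) (hDelta : is_coproduct Delta).

Lemma tensDl x y z : tens (x + y) z = tens x z + tens y z :> UU.
Proof.
apply: UU_ext => A phi f [[l1 _ _] _ _] fE; rewrite rmorphD /tens !rmorphM /= !fE.
by rewrite -[x]scale1r l1 !scale1r mulrDl.
Qed.
Lemma tensDr x y z : tens z (x + y) = tens z x + tens z y :> UU.
Proof.
apply: UU_ext => A phi f [_ [l1 _ _] _] fE; rewrite rmorphD /tens !rmorphM /= !fE.
by rewrite -[x]scale1r l1 !scale1r mulrDr.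
Qed.
Lemma tens0l x : tens 0 x = 0 :> UU.
Proof. by apply: (addrI (tens 0 x)); rewrite -tensDl !addr0. Qed.
Lemma tens0r x : tens x 0 = 0 :> UU.
Proof. by apply: (addrI (tens x 0)); rewrite -tensDr !addr0. Qed.
Lemma tensZl c x z : tens (c *: x) z = c *: tens x z :> UU.
Proof.
apply: UU_ext => A phi f [[l1 _ _] _ _] fE; rewrite linearZ /tens /= !rmorphM /= !fE.
have l0 := l1 (-1) 0 0; rewrite scaleN1r oppr0 addr0 scaleN1r addNr in l0.
by rewrite -[c *: x]addr0 l1 l0 addr0 scalerAl.
Qed.
Lemma tensZr c x z : tens z (c *: x) = c *: tens z x :> UU.
Proof.
apply: UU_ext => A phi f [_ [l1 _ _] _] fE; rewrite linearZ /tens /= !rmorphM /= !fE.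
have l0 := l1 (-1) 0 0; rewrite scaleN1r oppr0 addr0 scaleN1r addNr in l0.
by rewrite -[c *: x]addr0 l1 l0 addr0 scalerAr.
Qed.
Lemma tens11 : tens 1 1 = 1 :> UU.
Proof.
apply: UU_ext => A phi f [[_ l1 _] [_ r1 _] _] fE; rewrite /tens !rmorphM rmorph1 /= !fE.
by rewrite l1 r1 mul1r.
Qed.

Lemma grad_tens x y : gradUU (tens x y) = tens (grad x) (grad y).
Proof. by rewrite /tens rmorphM /=; congr (_ * _); rewrite [LHS]gradE. Qed.

Lemma Delta_grad u : Delta (grad u) = gradUU (Delta u).
Proof.
elim: (Uq_gen u) => {u} [u|c|x y _ hx _ hy|x y _ hx _ hy].
- case=> [] [c ->].
  + rewrite grad_e linearZ /= (coprod_e hDelta) [gradUU _]linearD /= !grad_tens grad_e !grad_t.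
    by rewrite tensZl tensZr scalerDr.
  + rewrite grad_f linearZ /= (coprod_f hDelta) [gradUU _]linearD /= !grad_tens grad_f !grad_t.
    by rewrite tensZl tensZr scalerDr.
  + rewrite grad_h (coprod_h hDelta) [gradUU _]linearD /= !grad_tens grad_h.
    by rewrite rmorph1.
  + by rewrite grad_t (coprod_t hDelta) grad_tens grad_t.
- by rewrite !linearZ /= !rmorph1.
- by rewrite !rmorphD /= hx hy.
- by rewrite !rmorphM /= hx hy.
Qed.

Section Skron.
Variables (d d' : nat) (W : wmodule d) (W' : wmodule d').

Lemma skronE A B i x j y : skron W W' A B (pk i x) (pk j y) =
  (-1) ^+ ((wpar W' x (+) wpar W' y) && wpar W j) * (A i j * B x y).
Proof. by rewrite mxE !pkE. Qed.

Lemma skron1r A i x j y : skron W W' A 1%:M (pk i x) (pk j y) = A i j * (x == y)%:R.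
Proof.
by rewrite skronE mxE; case: eqP => [->|]; rewrite ?addbb ?mul1r // !mulr0.
Qed.

Lemma skron1l B i x j y : skron W W' 1%:M B (pk i x) (pk j y) =
  (i == j)%:R * ((-1) ^+ ((wpar W' x (+) wpar W' y) && wpar W i) * B x y).
Proof.
by rewrite skronE mxE; case: eqP => [->|]; rewrite ?mul1r // !mul0r mulr0.
Qed.

Lemma skron_split A B : skron W W' A 1%:M *m skron W W' 1%:M B = skron W W' A B.
Proof.
apply: pk_ext => i x j y; rewrite mxE sum_pk skronE.
rewrite (bigD1 j) //= (bigD1 x) //= !big1 ?addr0.
- by rewrite skron1r skron1l !eqxx mulr1 mul1r; ring.
- by move=> u hu; rewrite big1 // => v _; rewrite skron1l (negPf hu) mul0r mulr0.
- by move=> v hv; rewrite skron1r eq_sym (negPf hv) mulr0 mul0r.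
Qed.

Lemma skron_swap (r s : bool) x y : homog r x -> homog s y ->
  skron W W' 1%:M (W' y) *m skron W W' (W x) 1%:M =
  (-1) ^+ (r && s) *: skron W W' (W x) (W' y).
Proof.
move=> hx hy; apply: pk_ext => i a j b; rewrite mxE sum_pk mxE skronE.
rewrite (bigD1 i) //= (bigD1 b) //= !big1 ?addr0.
- rewrite skron1r skron1l !eqxx mulr1 mul1r.
  have [->|h1] := eqVneq (W x i j) 0; first by rewrite !(mulr0, mul0r).
  have [->|h2] := eqVneq (W' y a b) 0; first by rewrite !(mulr0, mul0r).
  rewrite -(wact_par hx h1) -(wact_par hy h2).
  by case: (wpar W i); case: (wpar W j); case: (wpar W' a); case: (wpar W' b);
    rewrite /= ?(expr0, expr1); ring.
- by move=> u hu; rewrite big1 // => v _; rewrite skron1l eq_sym (negPf hu) !mul0r.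
- by move=> v hv; rewrite skron1r (negPf hv) !mulr0.
Qed.

Definition tpar (z : 'I_#|{: 'I_d * 'I_d'}|) : bool :=
  wpar W (enum_val z).1 (+) wpar W' (enum_val z).2.

Lemma tpar_pk i x : tpar (pk i x) = wpar W i (+) wpar W' x.
Proof. by rewrite /tpar pkE. Qed.

Lemma mx_rep_l : mx_rep (B := C^o) id tpar (fun x : U => skron W W' (W x) 1%:M).
Proof.
split.
- move=> c x y; apply: pk_ext => i a j b; rewrite [RHS]mxE [X in _ = X + _]mxE !skron1r wactP !mxE.
  by rewrite mulrDl -mulrA.
- by apply: pk_ext => i a j b; rewrite skron1r wact1 !mxE pk_eq -mulnb natrM.
- move=> x y; apply: pk_ext => i a j b; rewrite skron1r wactM !mxE sum_pk mulr_suml.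
  apply: eq_bigr => u _; rewrite (bigD1 a) //= big1 ?addr0 => [|v hv].
    by rewrite !skron1r eqxx mulr1 mulrA.
  by rewrite skron1r eq_sym (negPf hv) mulr0 mul0r.
- move=> x z z'; rewrite (pk_surj z) (pk_surj z') !tpar_pk !skron1r wact_grad.
  case: eqP => [->|]; last by rewrite !mulr0 scaler0.
  by rewrite !mulr1 addbACA addbb addbF.
Qed.

Lemma mx_rep_r : mx_rep (B := C^o) id tpar (fun x : U => skron W W' 1%:M (W' x)).
Proof.
split.
- move=> c x y; apply: pk_ext => i a j b; rewrite [RHS]mxE [X in _ = X + _]mxE !skron1l wactP !mxE.
  by rewrite !mulrDr; congr (_ + _); rewrite -[RHS]/(c * _); ring.
- apply: pk_ext => i a j b; rewrite skron1l wact1 !mxE pk_eq -(mulnb (i == j)) natrM.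
  by congr (_ * _); case: eqP => [->|]; rewrite ?addbb ?mulr1 ?mulr0.
- move=> x y; apply: pk_ext => i a j b; rewrite skron1l wactM !mxE sum_pk.
  rewrite (bigD1 i) //= [X in _ = _ + X]big1 ?addr0 => [|u hu]; last first.
    by rewrite big1 // => v _; rewrite skron1l eq_sym (negPf hu) !mul0r.
  rewrite !mulr_sumr; apply: eq_bigr => v _; rewrite !skron1l eqxx mul1r.
  case: (wpar W i); case: (wpar W' a); case: (wpar W' b); case: (wpar W' v);
    by rewrite /= ?(expr0, expr1); ring.
- move=> x z z'; rewrite (pk_surj z) (pk_surj z') !tpar_pk !skron1l wact_grad.
  case: eqP => [->|]; last by rewrite !mul0r scaler0.
  by rewrite !mul1r addbACA addbb addFb mulrCA.
Qed.

(** The axiom for (Delta (x) id)R speaks of a given module realising the tensor product, so it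
    yields something only once such a module exists. The action lifts from the two commuting factors
    by the universal property. *)
Lemma tensor_module : exists W'' : wmodule #|{: 'I_d * 'I_d'}|,
  is_tensor_module W W' Delta W''.
Proof.
have [|F [Fl F1 FM Fg FT]] := UU_lift_mx (q := q) (qp := qp) (g := idfun : {lrmorphism C^o -> C^o})
  (fun _ => erefl) mx_rep_l mx_rep_r.
  move=> r s x y hx hy; rewrite (skron_swap hx hy) skron_split.
  by apply/matrixP => a b; rewrite !mxE.
have F0 : F 0 = 0.
  have := Fl (-1) 0 0; rewrite scaleN1r oppr0 addr0 => ->.
  by apply/matrixP => a b; rewrite !mxE scaleN1r addNr.
have FD x y : F (x + y) = F x + F y.
  rewrite -[x in LHS]scale1r Fl; congr (_ + _).
  by apply/matrixP => a b; rewrite !mxE scale1r.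
have T x y : F (tens x y) = skron W W' (W x) (W' y) by rewrite FT skron_split.
pose wt'' (z : 'I_#|{: 'I_d * 'I_d'}|) := wwt W (enum_val z).1 + wwt W' (enum_val z).2.
have p1 c x y : F (Delta (c *: x + y)) = c *: F (Delta x) + F (Delta y) :> 'M[C]__.
  rewrite linearP Fl; congr (_ + _).
  by apply/matrixP => a b; rewrite !mxE.
have p2 : F (Delta 1) = 1%:M by rewrite rmorph1 F1.
have p3 x y : F (Delta (x * y)) = F (Delta x) *m F (Delta y) by rewrite rmorphM FM.
have p4 p x : homog p x -> forall i j, F (Delta x) i j != 0 -> tpar i (+) tpar j = p.
  move=> /eqP hx i j; apply: contraNeq => hp.
  have := Fg (Delta x) i j; rewrite -Delta_grad hx linearZ /=.
  rewrite -[_ *: Delta x]addr0 Fl F0 addr0 mxE => /eqP.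
  rewrite -subr_eq0 -scalerBl; case: p hx hp => _; case: (_ (+) _) => //= _;
    by rewrite ?(expr0, expr1) scaler_eq0 ?opprK -?opprD ?oppr_eq0 -?(natrD _ 1 1) pnatr_eq0.
have p5 x : F (Delta (Uh x)) = diag_mx (\row_i wform x (wt'' i)).
  rewrite (coprod_h hDelta) FD !T !wact1 !wact_h; apply: pk_ext => i a j b.
  rewrite mxE skron1r skron1l !mxE pk_eq /wt'' pkE /= wformDr.
  case: (i == j); case: (eqVneq a b) => [->|_] /=;
    by rewrite ?addbb ?mulr0n ?mulr1n ?mulr1 ?mul1r ?mulr0 ?mul0r ?addr0.
have p6 x : F (Delta (Ut x)) = diag_mx (\row_i qp (wform x (wt'' i))).
  rewrite (coprod_t hDelta) T !wact_t; apply: pk_ext => i a j b.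
  rewrite skronE !mxE pk_eq /wt'' pkE /= wformDr hqpD.
  case: (i == j); case: (eqVneq a b) => [->|_] /=;
    by rewrite ?addbb ?mulr0n ?mulr1n ?mulr1 ?mul1r ?mulr0 ?mul0r ?addr0 ?mulr0.
exists (WModule p1 p2 p3 p4 p5 p6); split=> [//|a s [_ e]] /=.
rewrite e; elim: s {e} => [|w s IH]; first by rewrite !big_nil.
by rewrite !big_cons FD T IH.
Qed.
End Skron.

(* (id (x) W)(x (x) y) as a matrix over U *)
Lemma slide_module d (W : wmodule d) : exists Theta : UU -> 'M[U]_d,
  [/\ forall c x y i j, Theta (c *: x + y) i j = c *: Theta x i j + Theta y i j &
      forall x y i j, Theta (tens x y) i j =
        W y i j *: (if wpar W i then grad x else x)].
Proof.
pose gr (b : bool) (x : U) := if b then grad x else x.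
have grL b : linear (gr b) by case: b => c x y //=; rewrite linearP.
have gr1 b : gr b 1 = 1 by case: b => //=; rewrite rmorph1.
have grM b x y : gr b (x * y) = gr b x * gr b y by case: b => //=; rewrite rmorphM.
have gr0 b : gr b 0 = 0 by case: b => //=; rewrite rmorph0.
(* The grading involution on the odd rows is the sign for moving [x] past a basis vector of W; it
   makes [f1] and [f2] commute in the graded sense. *)
pose f1 (x : U) : 'M[U]_d := \matrix_(i, j) (if i == j then gr (wpar W i) x else 0).
pose f2 (y : U) : 'M[U]_d := \matrix_(i, j) (W y i j)%:A.
have r1 : mx_rep (@grad _ (osp_presentation m k q qp)) (wpar W) f1.
  split.
  - move=> c x y; apply/matrixP => i j; rewrite !mxE.
    by case: eqP => _; rewrite ?grL // scaler0 addr0.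
  - by apply/matrixP => i j; rewrite !mxE; case: eqP => _; rewrite ?gr1.
  - move=> x y; apply/matrixP => i j; rewrite !mxE (bigD1 i) //= big1 ?addr0 => [|u hu].
      by rewrite !mxE eqxx; case: eqP => _; rewrite ?grM ?mulr0.
    by rewrite !mxE eq_sym (negPf hu) mul0r.
  - move=> x i j; rewrite !mxE; case: eqP => [<-|_]; last by rewrite rmorph0 scaler0.
    by rewrite addbb scale1r /gr; case: (wpar W i).
have r2 : mx_rep (@grad _ (osp_presentation m k q qp)) (wpar W) f2.
  split.
  - move=> c x y; apply/matrixP => i j; rewrite !mxE wactP !mxE.
    by rewrite scalerDl scalerA.
  - by apply/matrixP => i j; rewrite !mxE wact1 mxE; case: eqP; rewrite ?scale1r ?scale0r.
  - move=> x y; apply/matrixP => i j; rewrite !mxE wactM mxE scaler_suml.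
    by apply: eq_bigr => u _; rewrite !mxE mulr_algl scalerA.
  - by move=> x i j; rewrite !mxE wact_grad linearZ /= rmorph1 scalerA.
have [|F [Fl F1 FM _ FT]] := UU_lift_mx (q := q) (qp := qp) (@gradK _ _) r1 r2.
  move=> r s x y hx hy; apply/matrixP => i j; rewrite !mxE.
  rewrite (bigD1 j) //= [in RHS](bigD1 i) //= !big1 ?addr0 => [|u hu|u hu].
  - rewrite !mxE !eqxx mulr_algl mulr_algr scalerA.
    have [->|h2] := eqVneq (W y i j) 0; first by rewrite mulr0 !scale0r.
    rewrite -(wact_par hy h2) mulrC -scalerA; congr (_ *: _); rewrite /gr.
    by case: (wpar W i); case: (wpar W j); rewrite //= ?andbT ?andbF ?scale1r //
       (eqP hx) ?scalerA -?signr_addb ?addbb ?scale1r.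
  - by rewrite !mxE eq_sym (negPf hu) mul0r.
  - by rewrite !mxE (negPf hu) mulr0.
exists F; split=> [c x y i j|x y i j]; first by rewrite Fl !mxE.
rewrite FT !mxE (bigD1 i) //= big1 ?addr0 => [|u hu].
  by rewrite !mxE eqxx mulr_algr /gr.
by rewrite !mxE eq_sym (negPf hu) mul0r.
Qed.

End Modules.

Lemma sub_swap (Z : zmodType) (a b c d : Z) : a + d = c + b -> c - d = a - b.
Proof. by move=> e; apply/eqP; rewrite subr_eq addrAC e addrK. Qed.

(** * Index labels and matrix positions *)

Section Labels.
Variables (m k : nat).
Hypothesis hm : (0 < m)%N.
Local Notation indices := (indices m k).
Local Notation N := (m + 2 * k)%N.
Local Notation lab := (@lab m k).

Lemma size_indices : size indices = N.
Proof. by rewrite size_cat !size_map !size_iota. Qed.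

Lemma lab_in (i : 'I_N) : lab i \in indices.
Proof. by rewrite mem_nth // size_indices. Qed.

Lemma lab_inj : injective lab.
Proof.
move=> i j /eqP; rewrite nth_uniq ?size_indices ?uniq_indices // => /eqP e.
exact: val_inj.
Qed.

Lemma N_gt0 : (0 < N)%N.
Proof. by rewrite addn_gt0 hm. Qed.

(** Inverse of [lab]; the default position 0 is taken only for labels outside [indices]. *)
Definition ix (a : idx) : 'I_N := insubd (Ordinal N_gt0) (index a indices).

Lemma ixK a : a \in indices -> lab (ix a) = a.
Proof.
move=> ha; rewrite /Defs.lab /ix val_insubd.
have -> : (index a indices < N)%N by rewrite -size_indices index_mem.
by rewrite nth_index.
Qed.

Lemma labK i : ix (lab i) = i.
Proof. by apply: lab_inj; rewrite ixK ?lab_in. Qed.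

End Labels.

(** * The graph of simple roots on the weights of V *)

Section Edges.
Variables (R : realType) (m k : nat).
Hypotheses (hm : (2 < m)%N) (hk : (0 < k)%N).
Local Notation C := R[i].
Local Notation l := m./2.
Local Notation wform := (@wform R m k).
Local Notation alpha := (@alpha R m k).
Local Notation eps := (eps R m k).
Local Notation indices := (indices m k).
Local Notation ibar := (ibar m k).
Local Notation N := (m + 2 * k)%N.
Local Notation lab := (@lab m k).

Lemma top_neq_bot (c : sroot m k) : root_top c != root_bot c.
Proof.
by apply/eqP => e; have := position_topbot hm hk c; rewrite e ltnn.
Qed.

Lemma top_neq_ibar_bot (c : sroot m k) : root_top c != ibar (root_bot c).
Proof.
apply/eqP => e; have := position_ibar hm hk (bot_in hm hk c); rewrite -e.
rewrite position_top // position_bot //; case: c {e} => [i|mu|].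
- by have := ltn_ord i; case: ifP; lia.
- by have := ltn_ord mu; lia.
- lia.
Qed.

Lemma top_neq_ibar_top (c : sroot m k) : root_top c != ibar (root_top c).
Proof.
apply/eqP => e; have := position_ibar hm hk (top_in hm hk c); rewrite -e.
rewrite position_top //; case: c {e} => [i|mu|].
- by have := ltn_ord i; case: ifP; lia.
- by have := ltn_ord mu; lia.
- lia.
Qed.

(** Turns equalities along simple roots into equalities for all indices. The indices of the upper
    half and their duals form two chains, which meet at the last even root. *)
Lemma connected (T : Type) (Y : idx -> T) :
  (forall c : sroot m k, Y (root_top c) = Y (root_bot c)) ->
  (forall c : sroot m k, Y (ibar (root_top c)) = Y (ibar (root_bot c))) ->
  forall a, a \in indices -> Y a = Y (ev 1).
Proof.
move=> h1 h2.
have up i : (i < l)%N -> Y (ev i.+1) = Y (ev 1).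
  elim: i => // i IH hi; rewrite -IH; last lia.
  have hi' : (i < l)%N by lia.
  by have := h1 (sE k (Ordinal hi')); rewrite /root_top /root_bot hi => ->.
have dn i : (i < l)%N -> Y (ibar (ev i.+1)) = Y (ibar (ev 1)).
  elim: i => // i IH hi; rewrite -IH; last lia.
  have hi' : (i < l)%N by lia.
  by have := h2 (sE k (Ordinal hi')); rewrite /root_top /root_bot hi => ->.
have hl : (l.-1 < l)%N by lia.
(* For odd [m] both chains end at the self-dual index; for m = 2l the fork root joins l-1 to the
   dual of l. *)
have link : Y (ibar (ev 1)) = Y (ev 1).
  have := h1 (sE k (Ordinal hl)); have := h2 (sE k (Ordinal hl)).
  rewrite /root_top /root_bot [nat_of_ord _]/=; have -> : l.-1.+1 = l by lia.
  rewrite ltnn orFb; case ho: (odd m).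
    have -> : ibar (ev l.+1) = ev l.+1 by rewrite /Defs.ibar /ev /=; congr (_, _); lia.
    have -> : ev l = ev l.-1.+1 by rewrite /ev; congr (_, _); lia.
    by rewrite (up l.-1) // (dn l.-1) // => -> ->.
  move=> _; have -> : ev l.-1 = ev (l.-2).+1 by rewrite /ev; congr (_, _); lia.
  rewrite (up l.-2); last lia; have -> : ev l.+1 = ibar (ev l.-1.+1).
    by rewrite /Defs.ibar /ev /=; congr (_, _); lia.
  by rewrite (dn l.-1) // => ->.
have mid : odd m -> Y (ev l.+1) = Y (ev 1).
  move=> ho; have := h1 (sE k (Ordinal hl)).
  rewrite /root_top /root_bot [nat_of_ord _]/= ho orbT (up l.-1) //.
  have -> : l.-1.+2 = l.+1 by lia.
  by move=> <-.
have oup i : (i < k)%N -> Y (od (k - i)) = Y (ev 1).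
  elim: i => [|i IH] hi; first by rewrite subn0 (h1 (sS m k)).
  rewrite -IH; last lia.
  have hi' : (k - i.+2 < k.-1)%N by lia.
  have := h1 (sO m (Ordinal hi')); rewrite /root_top /root_bot [nat_of_ord _]/=.
  have -> : (k - i.+2).+1 = (k - i.+1)%N by lia.
  by have -> : (k - i.+1).+1 = (k - i)%N by [lia]; move=> ->.
have odn i : (i < k)%N -> Y (ibar (od (k - i))) = Y (ibar (ev 1)).
  elim: i => [|i IH] hi; first by rewrite subn0 (h2 (sS m k)).
  rewrite -IH; last lia.
  have hi' : (k - i.+2 < k.-1)%N by lia.
  have := h2 (sO m (Ordinal hi')); rewrite /root_top /root_bot [nat_of_ord _]/=.
  have -> : (k - i.+2).+1 = (k - i.+1)%N by lia.
  by have -> : (k - i.+1).+1 = (k - i)%N by [lia]; move=> ->.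
move=> [[] i]; rewrite mem_indices /= => hi.
  case: (leqP i k) => hik.
    have -> : (true, i) = od (k - (k - i)) by rewrite /od; congr (_, _); lia.
    by apply: oup; lia.
  have -> : (true, i) = ibar (od (k - (i - k.+1))).
    by rewrite /Defs.ibar /od /=; congr (_, _); lia.
  by rewrite (odn (i - k.+1)%N) //; lia.
case: (leqP i l) => hil.
  have -> : (false, i) = ev (i.-1).+1 by rewrite /ev; congr (_, _); lia.
  by apply: up; lia.
have [ei|ni] := eqVneq i (m - l)%N; last first.
  have -> : (false, i) = ibar (ev (m - i).+1) by rewrite /Defs.ibar /ev /=; congr (_, _); lia.
  by rewrite (dn (m - i)%N) //; lia.
case ho: (odd m).
  have -> : (false, i) = ev l.+1 by rewrite /ev; congr (_, _); lia.
  exact: mid.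
by lia.
Qed.

Lemma wform_topbot (c : sroot m k) : wform (eps (root_top c)) (eps (root_bot c)) = 0.
Proof.
rewrite wform_eps0 ?top_in ?bot_in // ?[root_bot c == root_top c]eq_sym ?top_neq_bot //.
rewrite eq_sym ibar_eq ?top_in ?bot_in //; exact: top_neq_ibar_bot.
Qed.

Lemma wform_alpha_nondeg (c : sroot m k) : exists d, wform (alpha d) (alpha c) != 0.
Proof.
case: c => [i|mu|]; last 1 first.
(* The odd root alpha_s is isotropic, so it is paired with its neighbour alpha_1; as m > 2, this
   root is eps_1 - eps_2 (with eps_2 = 0 if m = 3). *)
- have hl : (0 < l)%N by lia.
  exists (sE k (Ordinal hl)); rewrite alphaE // [alpha (sS m k)]alphaE //.
  rewrite wformBr !wformBl /= ifT; last lia.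
  have i1 : ev 1 \in indices by rewrite mem_indices /=; lia.
  have i2 : ev 2 \in indices by rewrite mem_indices /=; lia.
  have ik : od k \in indices by rewrite mem_indices /=; lia.
  rewrite !wform_eps //= /Defs.ibar /= !expr0 !mul1r !(xpair_eqE, eqxx, andTb) /=.
  have -> : (1 == (m + 1 - 1))%N = false by apply/negP => /eqP; lia.
  have -> : (1 == (m + 1 - 2))%N = false by apply/negP => /eqP; lia.
  by rewrite !subr0 !sub0r oppr_eq0 oner_eq0.
- exists (sE k i); rewrite alphaE // wformBr !wformBl [wform (eps (root_bot _)) (eps (root_top _))]wformC.
  rewrite !wform_topbot !subr0 sub0r opprK !wform_eps ?top_in ?bot_in // !eqxx.
  rewrite (negPf (top_neq_ibar_top _)) subr0.
  have -> : (root_top (sE k i)).1 = false by rewrite /=; case: ifP.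
  rewrite /= !expr0 !mul1r; case: (ev i.+2 == _); first by rewrite subrr addr0 oner_eq0.
  by rewrite subr0 -(natrD _ 1 1) pnatr_eq0.
- exists (sO m mu); rewrite alphaE // wformBr !wformBl [wform (eps (root_bot _)) (eps (root_top _))]wformC.
  rewrite !wform_topbot !subr0 sub0r opprK !wform_eps ?top_in ?bot_in // !eqxx.
  rewrite (negPf (top_neq_ibar_top _)) subr0 /= expr1 !mulN1r.
  have -> : (od mu.+2 == ibar (od mu.+2)) = false.
    by apply/negP => /eqP []; have := ltn_ord mu; lia.
  by rewrite subr0 -opprD oppr_eq0 -(natrD _ 1 1) pnatr_eq0.
Qed.

Definition Sig_sign (p r : idx) : C := (-1) ^+ (p.1 && (p.1 (+) r.1)) * xi R p * xi R r.
Local Notation sgn := Sig_sign.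

Lemma SigE p r i j : Sig R m k p r i j =
  ((lab i == p) && (lab j == r))%:R -
  sgn p r * ((lab i == ibar r) && (lab j == ibar p))%:R.
Proof. by rewrite /Sig !mxE. Qed.

Lemma vec_eE (c : sroot m k) : vec_e R c = Sig R m k (root_top c) (root_bot c).
Proof.
case: c => [i|mu|] //=; have hi := ltn_ord i; case: ifP => //= h.
case ho: (odd m).
  have -> : ev l = ev i.+1 by rewrite /ev; congr (_, _); lia.
  by have -> : ev l.+1 = ev i.+2 by rewrite /ev; congr (_, _); lia.
have -> : ev l.-1 = ev i by rewrite /ev; congr (_, _); lia.
by have -> : ibar (ev l) = ev i.+2 by rewrite /Defs.ibar /ev /=; congr (_, _); lia.
Qed.

Lemma vec_fE (c : sroot m k) :
  vec_f R c = (-1) ^+ (root_top c).1 *: Sig R m k (root_bot c) (root_top c).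
Proof.
case: c => [i|mu|] /=; rewrite ?expr1 ?scaleN1r //; have hi := ltn_ord i.
rewrite [X in (-1) ^+ X](_ : _ = 0%N) ?scale1r; last by case: ifP.
case: ifP => //= h; case ho: (odd m).
  have -> : ev l = ev i.+1 by rewrite /ev; congr (_, _); lia.
  by have -> : ev l.+1 = ev i.+2 by rewrite /ev; congr (_, _); lia.
have -> : ev l.-1 = ev i by rewrite /ev; congr (_, _); lia.
by have -> : ibar (ev l) = ev i.+2 by rewrite /Defs.ibar /ev /=; congr (_, _); lia.
Qed.

End Edges.

(** * The graded half-sum of the positive roots *)

Section Rho.
Variables (R : realType) (m k : nat).
Hypotheses (hm : (2 < m)%N) (hk : (0 < k)%N).
Local Notation C := R[i].
Local Notation l := m./2.
Local Notation wform := (@wform R m k).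
Local Notation alpha := (@alpha R m k).
Local Notation ibar := (ibar m k).

(** The values (rho, eps_a), where rho is half the sum of the even minus half the sum of the odd
    positive roots. Only (rho, alpha) = (alpha, alpha)/2 for simple alpha, proved in [rho_alpha], is
    used of rho beyond its definition. *)
Definition rho_fun (a : idx) : C :=
  if a.1 then (if (a.2 <= k)%N then m%:R / 2 - 1 - k%:R + a.2%:R
               else - (m%:R / 2) - k%:R + a.2%:R)
  else if (2 * a.2 < m + 1)%N then m%:R / 2 - a.2%:R
  else if (2 * a.2 == m + 1)%N then 0 else m%:R / 2 + 1 - a.2%:R.

Lemma rho_antisym : antisym m k rho_fun.
Proof.
move=> [[] i]; rewrite mem_indices /rho_fun /Defs.ibar /= => hi.
  have -> : (2 * k + 1 - i)%:R = 2 * k%:R + 1 - i%:R :> C.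
    by rewrite natrB; [rewrite natrD natrM | lia].
  by move: (m%:R / 2) (k%:R) (i%:R) => x y z; case: ifP => h1; case: ifP => h2; try lia; ring.
have -> : (m + 1 - i)%:R = 2 * (m%:R / 2) + 1 - i%:R :> C.
  by rewrite natrB; [rewrite natrD [2 * _]mulrC divfK // pnatr_eq0 | lia].
move: (m%:R / 2) (i%:R) => x y.
by do ![case: ifP => ?]; try lia; rewrite ?oppr0 //; ring.
Qed.

Definition rho := cw m k rho_fun.

Lemma rho_eps a : a \in indices m k -> wform rho (eps R m k a) = rho_fun a.
Proof. exact: wform_cw rho_antisym. Qed.

Lemma rho_alpha c : wform rho (alpha c) = wform (2^-1 *: alpha c) (alpha c).
Proof.
have h2 : (2 : C) != 0 by rewrite pnatr_eq0.
have fld (x : C) : 2^-1 * (x + x) = x.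
  by rewrite -mulr2n -[x *+ 2]mulr_natl mulrA mulVf ?mul1r.
have -> : wform (2^-1 *: alpha c) (alpha c) = 2^-1 * ((-1) ^+ (root_top c).1 +
    (-1) ^+ (root_bot c).1 * (1 - (root_bot c == ibar (root_bot c))%:R)).
  rewrite wformZl alphaE // wformBr !wformBl [wform (eps R m k (root_bot _)) (eps R m k (root_top _))]wformC.
  rewrite !wform_topbot // !subr0 sub0r opprK !wform_eps ?top_in ?bot_in // !eqxx.
  by rewrite (negPf (top_neq_ibar_top _ _ _)) // subr0 mulr1.
rewrite alphaE // wformBr !rho_eps ?top_in ?bot_in // /rho_fun /Defs.ibar /root_top /root_bot.
case: c => [i|mu|].
- have hi := ltn_ord i; case: (ltnP i.+1 l) => h /=.
    have -> : (2 * i.+1 < m + 1)%N by lia.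
    have -> : (2 * i.+2 < m + 1)%N by lia.
    have /negPf -> : ev i.+2 != (false, m + 1 - i.+2)%N.
      by apply/negP => /eqP []; lia.
    rewrite subr0 !expr0 mulr1 fld -[i.+2]addn1 natrD; move: (m%:R / 2) (i.+1%:R) => x y; ring.
  case ho: (odd m) => /=.
    have -> : (2 * i.+1 < m + 1)%N by lia.
    have -> : (2 * i.+2 < m + 1)%N = false by lia.
    have -> : (2 * i.+2 == m + 1)%N by lia.
    have -> : ev i.+2 = (false, m + 1 - i.+2)%N by rewrite /ev; congr (_, _); lia.
    rewrite eqxx subrr mulr0 addr0 subr0 mulr1.
    have -> : m%:R = 2 * i.+1%:R + 1 :> C by rewrite -natrM natr1; congr (_%:R); lia.
    by move: (i.+1%:R) => x; field.
  have -> : (2 * i < m + 1)%N by lia.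
  have -> : (2 * i.+2 < m + 1)%N = false by lia.
  have -> : (2 * i.+2 == m + 1)%N = false by lia.
  have /negPf -> : ev i.+2 != (false, m + 1 - i.+2)%N.
    by apply/negP => /eqP []; lia.
  rewrite subr0 !expr0 mulr1 fld -[i.+2]addn2 natrD; move: (m%:R / 2) (i%:R) => x y.
  ring.
- have hmu := ltn_ord mu; rewrite /=.
  have -> : (mu < k)%N by lia.
  have -> : (mu.+1 < k)%N by lia.
  have /negPf -> : od mu.+2 != (true, 2 * k + 1 - mu.+2)%N.
    by apply/negP => /eqP []; lia.
  rewrite subr0 !expr1 mulr1 fld -[mu.+2]addn1 natrD; move: (m%:R / 2) (mu.+1%:R) (k%:R) => x y z.
  ring.
- rewrite /= leqnn; have -> : (2 * 1 < m + 1)%N by lia.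
  have /negPf -> : ev 1 != (false, m + 1 - 1)%N by apply/negP => /eqP []; lia.
  rewrite subr0 [X in _ = _ * X](_ : _ = 0); last by rewrite !expr0 expr1 mulr1 addNr.
  by rewrite mulr0; move: (m%:R / 2) (k%:R) => x y; ring.
Qed.

End Rho.

(** * The R-matrix on invariant vectors *)

Section Invariant.
Variables (R : realType) (m k : nat) (q : R[i]) (qp : R[i] -> R[i]).
Local Notation C := R[i].
Local Notation D := (weight R m k).
Local Notation wform := (@wform R m k).
Local Notation alpha := (@alpha R m k).
Local Notation U := (Uq m k q qp).
Local Notation UU := (UU m k q qp).
Local Notation Ue := (@Ue R m k q qp).
Local Notation Uf := (@Uf R m k q qp).
Local Notation Uh := (@Uh R m k q qp).
Local Notation Ut := (@Ut R m k q qp).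
Local Notation wmodule := (wmodule m k q qp).

Hypotheses (hq0 : q != 0) (hqp1 : qp 1 = q) (hqpD : forall x y : C, qp (x + y) = qp x * qp y).

Variables (Delta : {lrmorphism U -> UU}) (hDelta : is_coproduct Delta).
Variables (cR : forall d : nat, wmodule d -> 'M[U]_d) (hR : is_universal_R Delta cR).

Lemma legs_entry d d' (W : wmodule d) (W' : wmodule d')
    (W'' : wmodule #|{: 'I_d * 'I_d'}|) : is_tensor_module W W' Delta W'' ->
  forall i x j y, cR W'' (pk i x) (pk j y) =
    (-1) ^+ ((wpar W' x (+) wpar W' y) && wpar W i) *: (cR W i j * cR W' x y).
Proof.
move=> hW i x j y; rewrite (univR_coprod_id hR hW) /gmul mxE sum_pk.
rewrite (bigD1 j) //= [X in _ + X]big1 ?addr0 => [|u hu]; last first.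
  by rewrite big1 // => v _; rewrite [leg23 _ _ _ _ _]mxE !pkE /= (negPf hu) mulr0.
rewrite (bigD1 x) //= big1 ?addr0 => [|v hv]; last first.
  rewrite [leg13 _ _ _ _]mxE !pkE /= eq_sym (negPf hv).
  by rewrite rmorph0; case: ifP; rewrite mul0r.
rewrite [leg13 _ _ _ _]mxE [leg23 _ _ _ _ _]mxE !pkE /= !eqxx.
have hij := univR_even hR W i j.
have -> : wpar W'' (pk j x) (+) wpar W'' (pk j y) = wpar W' x (+) wpar W' y.
  by rewrite !(hW.1) !pkE /= addbACA addbb.
have -> : (if wpar W' x (+) wpar W' y then grad (cR W i j) else cR W i j) =
    (-1) ^+ ((wpar W' x (+) wpar W' y) && (wpar W i (+) wpar W j)) *: cR W i j.
  by case: (_ (+) _); rewrite ?scale1r //; apply/eqP.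
rewrite -scalerAl -scalerAr scalerA -signr_addb; congr (_ ^+ nat_of_bool _ *: _).
by case: (_ (+) wpar W' y); case: (wpar W i); case: (wpar W j).
Qed.

Lemma trivial_module : exists W0 : wmodule 1,
  [/\ forall x, wpar W0 x = false, forall c, W0 (Ue c) = 0, forall c, W0 (Uf c) = 0,
      forall x, W0 (Uh x) = 0 & forall x, W0 (Ut x) = 1%:M].
Proof.
have [||||f [fe ff fh ft fg]] := @one_dim_rep R m k q qp (fun _ => 0) (fun _ => 1).
- by move=> *; rewrite mulr0 addr0.
- by [].
- by move=> *; rewrite mulr1.
- by [].
pose act (u : U) : 'M[C]_1 := (f u)%:M.
have a1 c x y : act (c *: x + y) = c *: act x + act y.
  by apply/matrixP => i j; rewrite /act linearP !mxE mulrnDl mulrnAr.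
have a2 : act 1 = 1%:M by rewrite /act rmorph1.
have a3 x y : act (x * y) = act x *m act y by rewrite /act rmorphM /= -scalar_mxM.
have a4 p x : homog p x -> forall i j : 'I_1, act x i j != 0 ->
    (fun _ => false) i (+) (fun _ => false) j = p.
  move=> hp i j; rewrite /act mxE !ord1 eqxx mulr1n => n0.
  by case: p hp => // hp; rewrite (tens_homog_l fg hp) ?eqxx in n0.
have a5 x : act (Uh x) = diag_mx (\row_i wform x ((fun _ : 'I_1 => 0 : D) i)).
  by apply/matrixP => i j; rewrite /act fh !mxE wform0r !ord1.
have a6 x : act (Ut x) = diag_mx (\row_i qp (wform x ((fun _ : 'I_1 => 0 : D) i))).
  by apply/matrixP => i j; rewrite /act ft !mxE wform0r (qp0 hq0 hqp1 hqpD) !ord1.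
exists (WModule a1 a2 a3 a4 a5 a6); split=> //= x; rewrite /act ?fe ?ff ?fh ?ft //;
  by rewrite raddf0.
Qed.

Lemma sweedler_t x : sweedler (Delta (Ut x)) [:: ((false, Ut x), (false, Ut x))].
Proof.
split; last by rewrite (coprod_t hDelta) !big_cons big_nil addr0.
by move=> w; rewrite !inE => /eqP -> /=; rewrite homog_t.
Qed.

Lemma sweedler_h x : sweedler (Delta (Uh x))
  [:: ((false, Uh x), (false, 1)); ((false, 1), (false, Uh x))].
Proof.
split; last by rewrite (coprod_h hDelta) !big_cons big_nil addr0.
by move=> w; rewrite !inE => /orP [] /eqP -> /=; rewrite homog_h homog_1.
Qed.

Lemma sweedler_ef c X : homog (spar c) X ->
  Delta X = tens (Ut (2^-1 *: alpha c)) X + tens X (Ut (- (2^-1 *: alpha c))) ->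
  sweedler (Delta X) [:: ((false, Ut (2^-1 *: alpha c)), (spar c, X));
                         ((spar c, X), (false, Ut (- (2^-1 *: alpha c))))].
Proof.
move=> hX dX; split; last by rewrite dX !big_cons big_nil addr0.
by move=> w; rewrite !inE => /orP [] /eqP -> /=; rewrite hX homog_t.
Qed.

Lemma intertwine d d' (W : wmodule d) (W' : wmodule d') (g : 'M[C]_(d', d)) :
  (forall u, is_gen u -> g *m W u = W' u *m g) -> forall u, g *m W u = W' u *m g.
Proof.
move=> hg u; elim: (Uq_gen u) => {u} [u hu|c|x y _ hx _ hy|x y _ hx _ hy].
- exact: hg.
- by rewrite !wactZ !wact1 -scalemxAr -scalemxAl mulmx1 mul1mx.
- by rewrite !wactD mulmxDr mulmxDl hx hy.
- by rewrite !wactM mulmxA hx -mulmxA hy mulmxA.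
Qed.

Section TensorInvariant.
Variables (d d' : nat) (W : wmodule d) (W' : wmodule d').
Variables (W0 : wmodule 1) (W'' : wmodule #|{: 'I_d * 'I_d'}|).
Hypotheses (p0 : forall x, wpar W0 x = false) (e0 : forall c, W0 (Ue c) = 0)
  (f0 : forall c, W0 (Uf c) = 0) (h0 : forall x, W0 (Uh x) = 0)
  (t0 : forall x, W0 (Ut x) = 1%:M).
Hypothesis hW : is_tensor_module W W' Delta W''.
Variable v : 'I_d -> 'I_d' -> C.
Hypotheses (v_par : forall i x, v i x != 0 -> wpar W i = wpar W' x)
  (v_wt : forall i x, v i x != 0 -> wwt W i + wwt W' x = 0)
  (v_ef : forall c X, X = Ue c \/ X = Uf c -> forall i x,
     qp (wform (2^-1 *: alpha c) (wwt W i)) *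
       (\sum_y (-1) ^+ ((wpar W' x (+) wpar W' y) && wpar W i) * W' X x y * v i y) +
     qp (- wform (2^-1 *: alpha c) (wwt W' x)) * (\sum_j W X i j * v j x) = 0).

Let g : 'M[C]_(#|{: 'I_d * 'I_d'}|, 1) :=
  \matrix_(z, o) v (enum_val z).1 (enum_val z).2.

Let gE i x o : g (pk i x) o = v i x. Proof. by rewrite mxE pkE. Qed.

(** The vector [v] is even, of weight 0 and, by [v_ef], killed by the coproducts of e_c and f_c. So
    1 |-> v is a map of modules from the trivial module, and the claim is naturality of R under
    it. *)
Lemma invariant_R i x :
  \sum_j \sum_y v j y *: cR W'' (pk i x) (pk j y) = v i x *: cR W0 0 0.
Proof.
have hg : forall u, g *m W0 u = W'' u *m g.
  have ef c X : X = Ue c \/ X = Uf c -> W0 X = 0 -> homog (spar c) X ->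
      Delta X = tens (Ut (2^-1 *: alpha c)) X + tens X (Ut (- (2^-1 *: alpha c))) ->
      g *m W0 X = W'' X *m g.
    move=> hX -> hX1 hX2; rewrite mulmx0 (hW.2 _ _ (sweedler_ef hX1 hX2)) !big_cons big_nil addr0 /=.
    apply/matrixP => z o; rewrite (pk_surj z); move: (_.1) (_.2) => a b; rewrite mxE.
    rewrite mxE sum_pk -[LHS](v_ef hX a b) !mulr_sumr.
    transitivity (\sum_j \sum_y
       (((a == j)%:R * (qp (wform (2^-1 *: alpha c) (wwt W a)) *
         ((-1) ^+ ((wpar W' b (+) wpar W' y) && wpar W a) * W' X b y * v a y))) +
        ((b == y)%:R * (qp (- wform (2^-1 *: alpha c) (wwt W' b)) * (W X a j * v j b))))).
      under [RHS]eq_bigr do rewrite big_split /= sum_deltal.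
      rewrite big_split /=; congr (_ + _); rewrite exchange_big /=.
      by apply: eq_bigr => y _; rewrite sum_deltal.
    apply: eq_bigr => j _; apply: eq_bigr => y _; rewrite gE mxE !skronE !wact_t !mxE.
    rewrite mulrDl; congr (_ + _).
      by case: eqP => [->|_]; rewrite ?mulr1n ?mulr0n ?mul1r ?mul0r ?mulr0 ?mul0r //; ring.
    case: eqP => [->|_]; rewrite ?mulr1n ?mulr0n ?mul1r ?mul0r ?mulr0 ?mul0r //.
    by rewrite addbb wformNl; ring.
  apply: intertwine => u [] [c ->].
  - by apply: (ef c) => //; [left | exact: homog_e | exact: coprod_e].
  - by apply: (ef c) => //; [right | exact: homog_f | exact: coprod_f].
  - rewrite h0 mulmx0 (hW.2 _ _ (sweedler_h c)) !big_cons big_nil addr0 /= !wact1 !wact_h.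
    apply/matrixP => z o; rewrite (pk_surj z); move: (_.1) (_.2) => a b; rewrite mxE.
    rewrite mxE sum_pk (bigD1 a) //= (bigD1 b) //= !big1 ?addr0.
    + rewrite mxE skron1r skron1l !mxE !eqxx addbb !mulr1n mulr1 !mul1r pkE /= -wformDr.
      have [->|n] := eqVneq (v a b) 0; first by rewrite mulr0.
      by rewrite (v_wt n) wform0r mul0r.
    + move=> j hj; rewrite big1 // => y _.
      by rewrite mxE skron1r skron1l !mxE eq_sym (negPf hj) mulr0n !mul0r addr0 mul0r.
    + move=> y hy.
      by rewrite mxE skron1r skron1l !mxE [b == y]eq_sym (negPf hy) mulr0n !mulr0 addr0 mul0r.
  - rewrite t0 mulmx1 (hW.2 _ _ (sweedler_t c)) !big_cons big_nil addr0 /= !wact_t.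
    apply/matrixP => z o; rewrite (pk_surj z); move: (_.1) (_.2) => a b.
    rewrite [RHS]mxE sum_pk (bigD1 a) //= (bigD1 b) //= !big1 ?addr0.
    + rewrite skronE !mxE !eqxx addbb !mulr1n mul1r pkE /= -hqpD -wformDr.
      have [->|n] := eqVneq (v a b) 0; first by rewrite mulr0.
      by rewrite (v_wt n) wform0r (qp0 hq0 hqp1 hqpD) mul1r.
    + move=> j hj; rewrite big1 // => y _.
      by rewrite skronE !mxE eq_sym (negPf hj) mulr0n mul0r mulr0 mul0r.
    + move=> y hy.
      by rewrite skronE !mxE [b == y]eq_sym (negPf hy) mulr0n !mulr0 mul0r.
have gp z o : g z o != 0 -> wpar W'' z = wpar W0 o.
  by rewrite mxE p0 (hW.1) => /v_par ->; rewrite addbb.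
have := univR_natural hR gp hg; move/(congr1 (fun M : 'M_(_, 1) => M (pk i x) 0)).
rewrite /= !mxE big_ord1 sum_pk !mxE pkE /= => e.
rewrite -mulr_algl -[RHS]/(_) e; apply: eq_bigr => j _; apply: eq_bigr => y _.
by rewrite !mxE pkE /= mulr_algr.
Qed.
End TensorInvariant.

End Invariant.

(** * Sums of two weights of V *)

Section WeightPairs.
Variables (R : realType) (m k : nat).
Local Notation wform := (@wform R m k).
Local Notation eps := (eps R m k).
Local Notation indices := (indices m k).
Local Notation ibar := (ibar m k).
Hypotheses (hm : (2 < m)%N) (hk : (0 < k)%N).

(** Pair with eps_a: up to a common sign the left side gives 1, while the right side counts +1 for
    each of u, v equal to a and -1 for each equal to its dual. *)
Lemma eps_split a c u v : a \in indices -> c \in indices -> u \in indices -> v \in indices ->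
  a != ibar a -> c != a -> c != ibar a -> eps a + eps c = eps u + eps v -> u = a \/ v = a.
Proof.
move=> ha hc hu hv h1 h2 h3 /(congr1 (wform (eps a))).
rewrite !wformDr !wform_eps // eqxx (negPf h1) (negPf h2) (negPf h3) -!mulrDr.
have s0 : (-1) ^+ a.1 != 0 :> R[i] by rewrite signr_eq0.
move/(mulfI s0); rewrite !subr0 addr0.
case: (eqVneq u a) => [->|_]; first by left.
case: (eqVneq v a) => [->|_]; first by right.
rewrite !sub0r -opprD => /eqP; rewrite -subr_eq0 opprK -!natrD pnatr_eq0.
by case: (u == ibar a); case: (v == ibar a).
Qed.

(** At most one index is self-dual, so [eps_split] applies to a or to c; cancellation gives the
    other index. *)
Lemma eps_pair a c u v : a \in indices -> c \in indices -> u \in indices -> v \in indices ->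
  c != a -> c != ibar a -> eps a + eps c = eps u + eps v ->
  (u = a /\ v = c) \/ (u = c /\ v = a).
Proof.
move=> ha hc hu hv h2 h3 e.
have fin x y z t : x \in indices -> y \in indices -> z \in indices -> t \in indices ->
    eps x + eps y = eps z + eps t -> z = x \/ t = x ->
    (z = x /\ t = y) \/ (z = y /\ t = x).
  move=> hx hy hz ht exy [ez|et]; [left|right]; split=> //; apply: (eps_inj hm hk) => //.
    by apply: (addrI (eps x)); rewrite -{1}ez exy.
  by apply: (addIr (eps x)); rewrite -{1}et -exy addrC.
have [ea|na] := eqVneq a (ibar a); last by apply: fin => //; apply: (eps_split _ hc).
have [ec|nc] := eqVneq c (ibar c); last first.
  have e' : eps c + eps a = eps u + eps v by rewrite addrC.
  have h : u = c \/ v = c.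
    by apply: (eps_split _ ha) => //; rewrite eq_sym // ibar_eq.
  by case: (fin _ _ _ _ hc ha hu hv e' h) => -[-> ->]; [right|left].
case/eqP: h2; apply: (position_inj hm hk hc ha).
by have := position_ibar hm hk ha; have := position_ibar hm hk hc; rewrite -ea -ec; lia.
Qed.

End WeightPairs.

(** * Intermediate indices for the recursion *)

Section Between.
Variables (m k : nat).
Local Notation indices := (indices m k).
Local Notation ibar := (ibar m k).
Local Notation position := (position m k).
Local Notation l := m./2.
Hypotheses (hm : (2 < m)%N) (hk : (0 < k)%N).

Lemma position_surj p : (0 < p <= m + 2 * k)%N -> exists2 a, a \in indices & position a = p.
Proof.
move=> hp; case: (leqP p k) => h1.
  by exists (od p); rewrite ?mem_indices /Defs.position /= ?h1 //; lia.
case: (leqP p (k + m)) => h2.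
  by exists (ev (p - k)); rewrite ?mem_indices /Defs.position /=; lia.
by exists (od (p - m)); rewrite ?mem_indices /Defs.position /=; [|case: ifP]; lia.
Qed.

(** The bound stops before the middle pair of even [m], formed by l and its dual, which no simple
    root joins; for odd [m] it reaches the pair ending at the self-dual index. *)
Lemma adjacent_root p : (0 < p)%N -> (p < k + l + odd m)%N -> exists c : sroot m k,
  position (root_top c) = p /\ position (root_bot c) = p.+1.
Proof.
move=> p0 hp; case: (ltngtP p k) => hpk.
- have h : (p.-1 < k.-1)%N by lia.
  by exists (sO m (Ordinal h)); rewrite position_top // position_bot //=; lia.
- have h : (p - k.+1 < l)%N by lia.
  exists (sE k (Ordinal h)); rewrite position_top // position_bot //=.
  by have -> : ((p - k.+1).+1 < l)%N || odd m by [case ho: (odd m); lia]; lia.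
- by exists (sS m k); rewrite position_top // position_bot //; lia.
Qed.

Lemma fork_root : ~~ odd m -> exists c : sroot m k,
  position (root_top c) = (k + l).-1 /\ position (root_bot c) = (k + l).+1.
Proof.
move=> ho; have h : (l.-1 < l)%N by lia.
exists (sE k (Ordinal h)); rewrite position_top // position_bot //= (negPf ho) orbF.
by case: ifP; lia.
Qed.

(** Supplies the induction in [V_L_antidiag]: a pair is either joined by a simple root, or admits an
    intermediate index to which the exchange relation applies. The two positions after b are enough
    to try. *)
Lemma edge_or_between a b : a \in indices -> b \in indices -> wlt m k a b -> b != ibar a ->
  (exists c : sroot m k, edge c b a) \/
  exists2 c, c \in indices & [/\ wlt m k a c, wlt m k c b, c != ibar a & c != ibar b].
Proof.
move=> ha hb; rewrite /wlt => ab nab.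
have bar_pos x : x \in indices -> position (ibar x) = (m + 2 * k + 1 - position x)%N.
  by move=> hx; have := position_ibar hm hk hx; lia.
have npos x y : x \in indices -> y \in indices -> x != ibar y ->
    (position x + position y != m + 2 * k + 1)%N.
  move=> hx hy; apply: contra_neq => e; apply: (position_inj hm hk) => //; first exact: ibar_in.
  by rewrite bar_pos //; lia.
have posn x y : (position x + position y != m + 2 * k + 1)%N -> y \in indices -> x != ibar y.
  by move=> h hy; apply: contra_neq h => ->; rewrite (position_ibar hm hk).
have := npos _ _ hb ha nab; have := position_gt hm hk ha; have := position_gt hm hk hb.
move=> pb pa pab.
have edge_top (c : sroot m k) : position b = position (root_top c) ->
    position a = position (root_bot c) -> exists c : sroot m k, edge c b a.
  move=> e1 e2; exists c; left; split; apply: (position_inj hm hk); rewrite ?top_in ?bot_in //.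
have edge_bar (c : sroot m k) : position a + position (root_top c) = m + 2 * k + 1 ->
    position b + position (root_bot c) = m + 2 * k + 1 -> exists c : sroot m k, edge c b a.
  move=> e1 e2; exists c; right; split; apply: (position_inj hm hk); 
    rewrite ?ibar_in ?top_in ?bot_in //;
    by rewrite bar_pos ?top_in ?bot_in //; lia.
case: (posnP (position a - (position b).+1)) => d1.
  left; have [s|s] := leqP (position a + position b) (m + 2 * k + 1).
    have [||c [h1 h2]] := @adjacent_root (position b); [lia|lia|].
    by apply: (edge_top c); lia.
  have [||c [h1 h2]] := @adjacent_root (m + 2 * k + 1 - position a); [lia|lia|].
  by apply: (edge_bar c); lia.
pose good p := [&& position b < p, p < position a, p + position a != m + 2 * k + 1 &
  p + position b != m + 2 * k + 1]%N.
have pick p : good p -> exists2 c, c \in indices &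
    [/\ wlt m k a c, wlt m k c b, c != ibar a & c != ibar b].
  case/and4P => h1 h2 h3 h4; have [|c hc e] := @position_surj p; first lia.
  by exists c => //; rewrite /wlt; split; rewrite ?e //; apply: posn; rewrite ?e.
have [g|g1] := boolP (good (position b).+1); first by right; apply: pick g.
have [g|g2] := boolP (good (position b).+2); first by right; apply: pick g.
(* If a is at least three positions after b, its dual and that of b are as far apart, so they cannot
   block two adjacent positions. Hence a is two positions after b with a blocked index between,
   which forces the middle of even [m] and the fork root. *)
have ho : ~~ odd m by move: g1 g2; rewrite /good; lia.
have [c [h1 h2]] := fork_root ho; left.
have [s|s] := leqP (position a + position b) (m + 2 * k + 1).
  by apply: (edge_top c); move: g1 g2; rewrite /good; lia.
by apply: (edge_bar c); move: g1 g2; rewrite /good; lia.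
Qed.

End Between.

(** * Dual bases of the Cartan subalgebra *)

Section CartanExpansion.
Variables (R : realType) (m k : nat).
Local Notation wform := (@wform R m k).
Local Notation eps := (eps R m k).
Local Notation indices := (indices m k).
Local Notation ibar := (ibar m k).
Local Notation cindices := (cartan_indices m k).

Lemma mem_cartan_indices a :
  (a \in cindices) = (0 < a.2 <= if a.1 then k else m./2)%N.
Proof.
rewrite mem_cat; case: a => [[] i] /=; apply/idP/idP.
- case/orP=> /mapP [j]; rewrite mem_iota // => h [->]; lia.
- by move=> h; apply/orP; right; apply/mapP; exists i; rewrite // mem_iota; lia.
- case/orP=> /mapP [j]; rewrite mem_iota // => h [->]; lia.
- by move=> h; apply/orP; left; apply/mapP; exists i; rewrite // mem_iota; lia.
Qed.

Lemma uniq_cartan_indices : uniq cindices.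
Proof.
have i1 : injective ev by move=> x y [].
have i2 : injective od by move=> x y [].
rewrite cat_uniq !map_inj_uniq ?iota_uniq //= andbT.
by apply/hasPn => x /mapP [j _ ->]; apply/mapP => -[].
Qed.

(** Identifies the exponent in [cartan_part] on a vector of weight y with y itself. It suffices to
    pair with the eps_b; those outside the basis are negatives of basis elements, or 0. *)
Lemma cartan_expansion y :
  \sum_(a <- cindices) (wform (eps a) y * (-1) ^+ a.1) *: eps a = y.
Proof.
have sub a : a \in cindices -> a \in indices.
  by rewrite mem_cartan_indices mem_indices; case: a.1; lia.
have cE b : b \in cindices ->
    wform (eps b) (\sum_(a <- cindices) (wform (eps a) y * (-1) ^+ a.1) *: eps a) = wform (eps b) y.
  move=> hb; rewrite (big_morph _ (fun u v => wformDr u v (eps b)) (wform0r _)).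
  rewrite (bigD1_seq b) ?uniq_cartan_indices //= big_seq_cond big1 ?addr0 => [|a /andP [ha nab]].
    rewrite wformZr wform_eps ?sub // eqxx.
    have -> : (b == ibar b) = false.
      apply/negP => /eqP/(congr1 snd); move: hb; rewrite mem_cartan_indices /Defs.ibar /=.
      by case: b.1; lia.
    by rewrite subr0 mulr1 -mulrA -signr_addb addbb mulr1.
  rewrite wformZr wform_eps0 ?sub ?mulr0 //.
  apply: contraL ha => /eqP ->; move: hb; rewrite !mem_cartan_indices /Defs.ibar /=.
  by case: b.1; lia.
apply: wform_nondeg => b hb.
have [c1|n1] := boolP (b \in cindices); first exact: cE.
have [c2|n2] := boolP (ibar b \in cindices).
  by have := cE _ c2; rewrite eps_bar // !wformNl => /oppr_inj.
have eb : b = ibar b.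
  move: hb n1 n2; rewrite mem_indices !mem_cartan_indices /Defs.ibar /=.
  by case: b => [[] i] /= *; congr (_, _); lia.
have -> : eps b = 0; last by rewrite !wform0l.
have := eps_bar R hb; rewrite -eb => /eqP.
by rewrite -addr_eq0 -mulr2n -scaler_nat scaler_eq0 pnatr_eq0 => /eqP.
Qed.

End CartanExpansion.

(** * The Lax operator *)

Section LaxOperator.
Variables (R : realType) (m k : nat) (q : R[i]) (qp : R[i] -> R[i]).
Local Notation C := R[i].
Local Notation D := (weight R m k).
Local Notation wform := (@wform R m k).
Local Notation alpha := (@alpha R m k).
Local Notation eps := (eps R m k).
Local Notation U := (Uq m k q qp).
Local Notation UU := (UU m k q qp).
Local Notation Ue := (@Ue R m k q qp).
Local Notation Uf := (@Uf R m k q qp).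
Local Notation Uh := (@Uh R m k q qp).
Local Notation Ut := (@Ut R m k q qp).
Local Notation wmodule := (wmodule m k q qp).
Local Notation N := (m + 2 * k)%N.
Local Notation lab := (@lab m k).
Local Notation wt := (@root_sum R m k).
Local Notation cart := (@cart R m k U Uh Ut).
Local Notation ew := (@root_word R m k U Ue).
Local Notation adh := (@ad_cartan R m k U Uh).
Local Notation l := m./2.
Local Notation indices := (indices m k).
Local Notation ibar := (ibar m k).
Local Notation sgn := (@Sig_sign R).
Local Notation rho := (rho R m k).
Local Notation position := (position m k).
Local Notation UE := (@UE R m k q qp).

Hypotheses (hm : (2 < m)%N) (hk : (0 < k)%N).
Hypotheses (hq0 : q != 0) (hq : forall j : nat, (0 < j)%N -> q ^+ j != 1)
  (hqp1 : qp 1 = q) (hqpD : forall x y : C, qp (x + y) = qp x * qp y).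
Variables (Delta : {lrmorphism U -> UU}) (hDelta : is_coproduct Delta).
Variables (V : wmodule N) (hV : is_vector_rep V).
Variables (cR : forall d : nat, wmodule d -> 'M[U]_d) (hR : is_universal_R Delta cR).
Local Notation L := (cR V).
Local Notation pp := (wpar V).

Let rels := Uq_relations m k q qp.
Let hm0 : (0 < m)%N. Proof. exact: ltnW (ltnW hm). Qed.
Local Notation ix := (ix k hm0).

Lemma Ut_e x c : Ut x * Ue c = qp (wform x (alpha c)) *: (Ue c * Ut x).
Proof. exact: rel_te rels x c. Qed.
Lemma Ut_f x c : Ut x * Uf c = qp (- wform x (alpha c)) *: (Uf c * Ut x).
Proof. exact: rel_tf rels x c. Qed.
Lemma UtD x y : Ut (x + y) = Ut x * Ut y.
Proof. exact: rel_tD rels x y. Qed.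
Lemma Ut0 : Ut 0 = 1.
Proof. exact: rel_t0 rels. Qed.
Lemma e_Ut x c : Ue c * Ut x = qp (- wform x (alpha c)) *: (Ut x * Ue c).
Proof. by rewrite Ut_e scalerA (qpNM hq0 hqp1 hqpD) scale1r. Qed.
Lemma f_Ut x c : Uf c * Ut x = qp (wform x (alpha c)) *: (Ut x * Uf c).
Proof. by rewrite Ut_f scalerA mulrC (qpNM hq0 hqp1 hqpD) scale1r. Qed.
Lemma UtNM x : Ut (- x) * Ut x = 1.
Proof. by rewrite -UtD addNr Ut0. Qed.
Lemma UtMN x : Ut x * Ut (- x) = 1.
Proof. by rewrite -UtD subrr Ut0. Qed.

Lemma Ut_inj x u v : Ut x * u = Ut x * v -> u = v.
Proof. by move=> e; rewrite -[u]mul1r -(UtNM x) -mulrA e mulrA UtNM mul1r. Qed.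

Lemma Uplus_words (nu : D) u : Uplus u -> (forall x, adh x u = wform x nu *: u) ->
  sums (fun z => exists P w, [/\ cart P, z = P * ew w & wt w = nu]) u.
Proof.
move=> hu hnu.
have rt x c : exists z, Ue c * Ut x = z *: (Ut x * Ue c).
  by exists (qp (- wform x (alpha c))); apply: e_Ut.
exact: (weight_words (rel_hh rels) (rel_ht rels) (rel_he rels)
  (borel_words (rel_he rels) rt hu) hnu).
Qed.

Definition lab_weight (i : 'I_N) : D := eps (lab i).
Local Notation ee := lab_weight.

Lemma ee_inj : injective ee.
Proof. by move=> i j /(eps_inj hm hk (lab_in i) (lab_in j)) /lab_inj. Qed.

Lemma wwtV i : wwt V i = ee i.
Proof.
apply: wform_nondeg => a ha; rewrite /ee wform_eps ?lab_in //.
have := congr1 (fun M : 'M_N => M i i) (wact_h V (eps a)).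
rewrite /= (vec_h hV ha) !mxE eqxx mulr1n => <-.
rewrite addbb andbF expr0 mul1r xi_sq mul1r !andbb.
by [].
Qed.

Lemma V_t x i j : V (Ut x) i j = qp (wform x (ee i)) *+ (i == j).
Proof. by rewrite wact_t !mxE wwtV. Qed.
Lemma V_h x i j : V (Uh x) i j = wform x (ee i) *+ (i == j).
Proof. by rewrite wact_h !mxE wwtV. Qed.

Lemma V_weight u nu i j : (forall x, adh x u = wform x nu *: u) -> V u i j != 0 ->
  ee i = ee j + nu.
Proof.
move=> hu hV0; apply: wform_nondeg => a _.
have := congr1 (fun w => V w i j) (hu (eps a)).
rewrite /ad_cartan wactB wactZ !wactM mxE [X in _ + X]mxE [X in X - _]mxE [X in _ - X]mxE [RHS]mxE.
rewrite (bigD1 i) //= [X in _ - X](bigD1 j) //= !big1 ?addr0.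
- rewrite !V_h !eqxx !mulr1n => /eqP; rewrite [V u i j * _]mulrC -mulrBl.
  by rewrite (inj_eq (mulIf hV0)) subr_eq wformDr addrC => /eqP.
- by move=> x hx; rewrite V_h (negPf hx) mulr0.
- by move=> x hx; rewrite V_h eq_sym (negPf hx) mul0r.
Qed.

Lemma adh_e x c : adh x (Ue c) = wform x (alpha c) *: Ue c.
Proof. exact: rel_he rels x c. Qed.
Lemma adh_f x c : adh x (Uf c) = wform x (- alpha c) *: Uf c.
Proof. by rewrite wformNr; exact: rel_hf rels x c. Qed.

Lemma Ve_weight c i j : V (Ue c) i j != 0 -> ee i = ee j + alpha c.
Proof. by apply: V_weight => x; apply: adh_e. Qed.
Lemma Vf_weight c i j : V (Uf c) i j != 0 -> ee i = ee j - alpha c.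
Proof. by apply: V_weight => x; apply: adh_f. Qed.

(** * Intertwining relations, entry by entry *)

Lemma homog_L i j : homog (pp i (+) pp j) (L i j).
Proof. exact: univR_even hR N V i j. Qed.

Lemma grad_L i j (b : bool) : (if b then grad (L i j) else L i j) =
  (-1) ^+ (b && (pp i (+) pp j)) *: L i j.
Proof. by case: b; rewrite ?scale1r //; apply/eqP/homog_L. Qed.

(* R Delta(X) = Delta^T(X) R, componentwise, for X = e_c or f_c *)
Lemma twist_entry c X (hX : homog (spar c) X)
    (dX : Delta X = tens (Ut (2^-1 *: alpha c)) X + tens X (Ut (- (2^-1 *: alpha c)))) i j :
  qp (wform (2^-1 *: alpha c) (ee j)) *: (L i j * X) +
  \sum_x ((-1) ^+ (spar c && (pp i (+) pp x)) * V X x j) *: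
     (L i x * Ut (- (2^-1 *: alpha c))) =
  \sum_x V X i x *: (Ut (2^-1 *: alpha c) * L x j) +
  ((-1) ^+ (spar c && (pp i (+) pp j)) * qp (- wform (2^-1 *: alpha c) (ee i))) *: (X * L i j).
Proof.
set a := 2^-1 *: alpha c.
pose s : hsum m k q qp :=
  [:: ((false, Ut a), (spar c, X)); ((spar c, X), (false, Ut (- a)))].
have sw : sweedler (Delta X) s.
  split; last by rewrite dX /s !big_cons big_nil addr0.
  by move=> w; rewrite !inE => /orP [] /eqP -> /=; rewrite hX homog_t.
have := congr1 (fun M : 'M_N => M i j) (univR_twist hR V sw).
rewrite /= /act_id /act_id_twist /s !big_cons !big_nil !addr0 /= !andbF !expr0 !scale1r.
rewrite !mxE.
rewrite (eq_bigr (fun x => qp (wform a (ee j)) *: ((L i x * X) *+ (x == j)) +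
   ((-1) ^+ (spar c && (pp i (+) pp x)) * V X x j) *: (L i x * Ut (- a)))); last first.
  move=> x _; rewrite !mxE grad_L V_t -scalerAl mulrDr -!scalerAr scalerDr !scalerA.
  congr (_ + _).
    case: eqP => [->|_]; first by rewrite addbb expr0 mul1r !mulr1n.
    by rewrite !mulr0n mulr0 scale0r scaler0.
  have [->|hx] := eqVneq (V X x j) 0; first by rewrite !mulr0 !scale0r.
  by rewrite (wact_par hX hx).
rewrite big_split /= (bigD1 j) //= eqxx mulr1n [X in _ + X + _]big1 ?addr0; last first.
  by move=> x /negPf ->; rewrite mulr0n scaler0.
move=> ->.
rewrite (eq_bigr (fun x => V X i x *: (Ut a * L x j) +
   ((-1) ^+ (spar c && (pp i (+) pp j)) * qp (- wform a (ee i))) *: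
      ((X * L x j) *+ (i == x)))); last first.
  move=> x _; rewrite !mxE V_t wformNl.
  have -> : (if pp x (+) pp j then grad (V X i x *: Ut a + (qp (- wform a (ee i)) *+ (i == x)) *: X)
     else V X i x *: Ut a + (qp (- wform a (ee i)) *+ (i == x)) *: X) =
     V X i x *: Ut a + ((-1) ^+ (spar c && (pp x (+) pp j)) * (qp (- wform a (ee i)) *+ (i == x))) *: X.
    case: (pp x (+) pp j); rewrite ?andbF ?andbT ?mul1r //.
    by rewrite linearD !linearZ /= grad_t (eqP hX) scalerA [X in _ = _ + X *: _]mulrC.
  rewrite mulrDl -!scalerAl; congr (_ + _).
  by case: eqP => [<-|_]; rewrite ?mulr1n // !mulr0n mulr0 scale0r scaler0.
rewrite big_split /= [X in _ + X = _](bigD1 i) //= eqxx mulr1n [X in _ + (_ + X) = _]big1 ?addr0 //.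
by move=> x hx; rewrite eq_sym (negPf hx) mulr0n scaler0.
Qed.

Lemma twist_e c i j :
  qp (wform (2^-1 *: alpha c) (ee j)) *: (L i j * Ue c) +
  \sum_x ((-1) ^+ (spar c && (pp i (+) pp x)) * V (Ue c) x j) *:
     (L i x * Ut (- (2^-1 *: alpha c))) =
  \sum_x V (Ue c) i x *: (Ut (2^-1 *: alpha c) * L x j) +
  ((-1) ^+ (spar c && (pp i (+) pp j)) * qp (- wform (2^-1 *: alpha c) (ee i))) *: (Ue c * L i j).
Proof. exact: (twist_entry (homog_e _ _ c) (coprod_e hDelta c)). Qed.

Lemma twist_f c i j :
  qp (wform (2^-1 *: alpha c) (ee j)) *: (L i j * Uf c) +
  \sum_x ((-1) ^+ (spar c && (pp i (+) pp x)) * V (Uf c) x j) *: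
     (L i x * Ut (- (2^-1 *: alpha c))) =
  \sum_x V (Uf c) i x *: (Ut (2^-1 *: alpha c) * L x j) +
  ((-1) ^+ (spar c && (pp i (+) pp j)) * qp (- wform (2^-1 *: alpha c) (ee i))) *: (Uf c * L i j).
Proof. exact: (twist_entry (homog_f _ _ c) (coprod_f hDelta c)). Qed.

Lemma L_weight x i j : adh x (L i j) = wform x (ee j - ee i) *: L i j.
Proof.
pose s : hsum m k q qp :=
  [:: ((false, Uh x), (false, 1)); ((false, 1), (false, Uh x))].
have sw : sweedler (Delta (Uh x)) s.
  split; last by rewrite (coprod_h hDelta) /s !big_cons big_nil addr0.
  by move=> w; rewrite !inE => /orP [] /eqP -> /=; rewrite homog_h homog_1.
have := congr1 (fun M : 'M_N => M i j) (univR_twist hR V sw).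
rewrite /= /act_id /act_id_twist /s !big_cons !big_nil !addr0 /= !expr0 !scale1r.
rewrite !mxE.
rewrite (eq_bigr (fun y => (wform x (ee j) *: L i y + L i y * Uh x) *+ (y == j))); last first.
  move=> y _; rewrite !mxE grad_L V_h wact1 mxE.
  case: eqP => [->|_]; last by rewrite !mulr0n !scale0r addr0 mulr0.
  by rewrite addbb expr0 !scale1r !mulr1n mulrDr -scalerAr mulr1.
rewrite (bigD1 j) //= eqxx mulr1n big1 ?addr0; last by move=> y /negPf ->.
rewrite (eq_bigr (fun y => (Uh x * L y j + wform x (ee i) *: L y j) *+ (i == y))); last first.
  move=> y _; rewrite !mxE V_h wact1 mxE.
  case: eqP => [->|_]; last first.
    by rewrite !mulr0n !scale0r addr0; case: ifP; rewrite ?rmorph0 mul0r.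
  rewrite !mulr1n !scale1r.
  have -> : (if pp y (+) pp j then grad (Uh x + wform x (ee y) *: 1)
     else Uh x + wform x (ee y) *: 1) = Uh x + wform x (ee y) *: 1.
    by case: ifP => // _; rewrite linearD linearZ /= grad_h rmorph1.
  by rewrite mulrDl mulr_algl.
rewrite (bigD1 i) //= eqxx mulr1n big1 ?addr0; last first.
  by move=> y; rewrite eq_sym => /negPf ->.
move=> e; rewrite /ad_cartan wformBr scalerBl.
exact: (sub_swap e).
Qed.

Lemma L_Ut x i j : Ut x * L i j = qp (wform x (ee j - ee i)) *: (L i j * Ut x).
Proof.
pose s : hsum m k q qp := [:: ((false, Ut x), (false, Ut x))].
have sw : sweedler (Delta (Ut x)) s.
  split; last by rewrite (coprod_t hDelta) /s !big_cons big_nil addr0.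
  by move=> w; rewrite !inE => /eqP -> /=; rewrite homog_t.
have := congr1 (fun M : 'M_N => M i j) (univR_twist hR V sw).
rewrite /= /act_id /act_id_twist /s !big_cons !big_nil !addr0 /= !expr0 !scale1r.
rewrite !mxE.
rewrite (eq_bigr (fun y => (qp (wform x (ee j)) *: (L i y * Ut x)) *+ (y == j))); last first.
  move=> y _; rewrite !mxE grad_L V_t.
  case: eqP => [->|_]; last by rewrite !mulr0n !scale0r mulr0.
  by rewrite addbb expr0 !scale1r !mulr1n -scalerAr.
rewrite (bigD1 j) //= eqxx mulr1n big1 ?addr0; last by move=> y /negPf ->.
rewrite (eq_bigr (fun y => (qp (wform x (ee i)) *: (Ut x * L y j)) *+ (i == y))); last first.
  move=> y _; rewrite !mxE V_t.
  case: eqP => [->|_]; last first.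
    by rewrite !mulr0n !scale0r; case: ifP; rewrite ?rmorph0 mul0r.
  rewrite !mulr1n (_ : (if _ then _ else _) = qp (wform x (ee y)) *: Ut x) ?scalerAl //.
  by case: ifP => // _; rewrite linearZ /= grad_t.
rewrite (bigD1 i) //= eqxx mulr1n big1 ?addr0; last first.
  by move=> y; rewrite eq_sym => /negPf ->.
move/(congr1 (fun z => qp (- wform x (ee i)) *: z)); rewrite !scalerA.
by rewrite (qpNM hq0 hqp1 hqpD) scale1r -hqpD addrC wformBr => <-.
Qed.

(** In R_13 R_12 the left matrix factor carries the second tensor factor, hence the reversed order;
    the sign of the matrix product cancels against that of the graded tensor product. *)
Lemma Delta_L i j : Delta (L i j) = \sum_x tens (L x j) (L i x).
Proof.
have := congr1 (fun M : 'M_N => M i j) (univR_id_coprod hR V).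
rewrite /= mxE => ->; rewrite mxE; apply: eq_bigr => x _; rewrite !mxE.
have h1 : homog (pp x (+) pp j) (L x j) := homog_L x j.
have -> : (if pp x (+) pp j then @grad _ (tsq_presentation (@counit_grad R m k q qp)) (tens 1 (L i x))
    else tens 1 (L i x)) = (-1) ^+ ((pp x (+) pp j) && (pp i (+) pp x)) *: tens 1 (L i x).
  rewrite grad_tens rmorph1 -tensZr -grad_L; by case: ifP.
rewrite -scalerAl (tensM _ _ (homog_L i x) h1) scalerA -signr_addb addbb scale1r.
by rewrite mul1r mulr1.
Qed.

Lemma L_borel i j : Uplus (L i j).
Proof.
have [s [hs ->]] := univR_borel hR V.
rewrite summxE big_seq; elim/big_rec: _ => [|w u hw hu].
  by rewrite -(scale0r 1); apply: subalgebra_scal.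
apply: subalgebra_add hu; rewrite mxE -mulr_algl.
by apply: subalgebra_mul; [exact: subalgebra_scal | case: (hs _ hw)].
Qed.

(** * Weights and triangularity of the entries *)

Lemma L_words i j :
  sums (fun z => exists P w, [/\ cart P, z = P * ew w & wt w = ee j - ee i]) (L i j).
Proof. by apply: Uplus_words; [exact: L_borel | move=> x; exact: L_weight]. Qed.

Lemma L_neq0 i j : L i j != 0 -> exists w, ee j = ee i + wt w.
Proof.
case: (L_words i j) => [|x y [P [w [_ _ e]]] _]; first by rewrite eqxx.
by exists w; rewrite e addrC subrK.
Qed.

Lemma L_diag_cart i : cart (L i i).
Proof.
have := L_words i i; rewrite subrr; elim=> [|x y [P [w [cP -> e]]] _ hy].
  by rewrite -(scale0r 1); apply: subalgebra_scal.
apply: subalgebra_add hy; rewrite (wt_eq0 hm hk e).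
by rewrite /root_word big_nil mulr1.
Qed.

Lemma L_edge_cart c i j : ee j = ee i + alpha c -> exists2 P, cart P & L i j = P * Ue c.
Proof.
move=> e; have := L_words i j; rewrite e addrC addKr.
elim=> [|x y [P [w [cP -> ew']]] _ [P' cP' ->]].
  by exists 0%:A; [exact: subalgebra_scal | rewrite scale0r mul0r].
exists (P + P'); first exact: subalgebra_add.
by rewrite (wt_alpha hm hk ew') /root_word big_seq1 mulrDl.
Qed.

Lemma L_triang i j : L i j != 0 -> i = j \/ wlt m k (lab i) (lab j).
Proof.
move=> /L_neq0 [w e]; have [w0|] := wt_wlt hm hk (lab_in i) (lab_in j) e; last by right.
by left; apply: ee_inj; rewrite e w0 /root_sum big_nil addr0.
Qed.

(** A nonzero weight and its negative are not both sums of simple roots. *)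
Lemma L_loop i j : L i j != 0 -> L j i != 0 -> i = j.
Proof.
move=> /L_neq0 [w e] /L_neq0 [w' e'].
have : wt (w ++ w') = 0.
  apply: (addrI (ee i)); rewrite addr0 /root_sum big_cat /= addrA.
  by rewrite -[\sum_(c <- w) _]/(wt w) -e -[\sum_(c <- w') _]/(wt w') -e'.
move/(wt_eq0 hm hk); case: w e => // e _; apply: ee_inj.
by rewrite e /root_sum big_nil addr0.
Qed.

(** A simple root is not the sum of two nonempty sums of simple roots, so nothing lies strictly
    between i and j. *)
Lemma L_between c i x j : ee j = ee i + alpha c -> L i x != 0 -> L x j != 0 ->
  x = i \/ x = j.
Proof.
move=> ec /L_neq0 [w e] /L_neq0 [w' e'].
have : wt (w ++ w') = alpha c.
  apply: (addrI (ee i)); rewrite -ec /root_sum big_cat /= addrA.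
  by rewrite -[\sum_(c <- w) _]/(wt w) -e -[\sum_(c <- w') _]/(wt w') -e'.
move/(wt_alpha hm hk); case: w e => [e _|c1 [|//] e] /=.
  by left; apply: ee_inj; rewrite e /root_sum big_nil addr0.
case=> _ w0; right; apply: ee_inj.
by rewrite e' w0 /root_sum big_nil addr0.
Qed.

Lemma L_edge_rev0 c i j : ee j = ee i + alpha c -> L j i = 0.
Proof.
move=> e; apply/eqP/negP => /negP /L_neq0 [w e'].
suff : wt (c :: w) = 0 by move/(wt_eq0 hm hk).
apply: (addrI (ee i)).
by rewrite addr0 /root_sum big_cons addrA -e -[\sum_(c <- w) _]/(wt w) -e'.
Qed.

(** Both sums in the intertwining relation vanish, as their entries of L would have weight
    -alpha_c. *)
Lemma L_diag_f c i : qp (wform (alpha c) (ee i)) *: (L i i * Uf c) = Uf c * L i i.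
Proof.
have := twist_f c i i; rewrite addbb andbF mul1r big1 ?addr0 => [|x _]; last first.
  have [->|hx] := eqVneq (V (Uf c) x i) 0; first by rewrite mulr0 scale0r.
  have ex : ee i = ee x + alpha c by rewrite (Vf_weight hx) subrK.
  by rewrite (L_edge_rev0 ex) mul0r scaler0.
rewrite big1 ?add0r => [|x _]; last first.
  have [->|hx] := eqVneq (V (Uf c) i x) 0; first by rewrite scale0r.
  have ex : ee x = ee i + alpha c by rewrite (Vf_weight hx) subrK.
  by rewrite (L_edge_rev0 ex) mulr0 scaler0.
move/(congr1 (fun z => qp (wform (2^-1 *: alpha c) (ee i)) *: z)); rewrite !scalerA.
rewrite -!hqpD subrr (qp0 hq0 hqp1 hqpD) scale1r -wformDl -scalerDl.
have -> : 2^-1 + 2^-1 = 1 :> C by rewrite -div1r -splitr.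
by rewrite scale1r.
Qed.

Lemma L_edge_f c i j : V (Uf c) i j != 0 ->
  qp (wform (2^-1 *: alpha c) (ee j)) *: (L i j * Uf c) -
  ((-1) ^+ spar c * qp (- wform (2^-1 *: alpha c) (ee i))) *: (Uf c * L i j) =
  V (Uf c) i j *: (Ut (2^-1 *: alpha c) * L j j - L i i * Ut (- (2^-1 *: alpha c))).
Proof.
move=> v0; have e := Vf_weight v0; have := twist_f c i j.
rewrite (bigD1 i) //= addbb andbF mul1r [X in _ + (_ + X) = _]big1 => [|x hx]; last first.
  have [->|hx'] := eqVneq (V (Uf c) x j) 0; first by rewrite mulr0 scale0r.
  have ex : ee x = ee i by rewrite (Vf_weight hx') e.
  by rewrite (ee_inj ex) eqxx in hx.
rewrite (bigD1 j) //= [X in _ = _ + X + _]big1 => [|x hx]; last first.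
  have [->|hx'] := eqVneq (V (Uf c) i x) 0; first by rewrite scale0r.
  have ex : ee x = ee j by apply: (addIr (- alpha c)); rewrite -(Vf_weight hx') -e.
  by rewrite (ee_inj ex) eqxx in hx.
rewrite !addr0 (wact_par (homog_f _ _ c) v0) andbb => h; rewrite scalerBr.
exact: sub_swap (esym h).
Qed.

(** * Functionals that separate the elements q^h *)

Lemma ht_alpha c : wform (cw m k (ht_fun R m k)) (alpha c) = 1.
Proof. by have := ht_wt R hm hk [:: c]; rewrite /root_sum big_seq1. Qed.

Lemma alpha_neq0 c : alpha c != 0.
Proof. by apply: contra_eq_neq (ht_alpha c) => ->; rewrite wform0r eq_sym oner_neq0. Qed.

(* Th = id (x) phi, up to the grading involution on the first factor, for a
   functional phi that is a character on the q^h and kills the root vectors. *)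
Definition slide (Th : {linear UU -> U}) (phi : U -> C) (b : bool) : Prop :=
  [/\ forall u v, Th (tens u v) = phi v *: (if b then grad u else u),
      forall x y, phi (Ut (x + y)) = phi (Ut x) * phi (Ut y),
      phi 1 = 1 &
      forall u c, (forall x, adh x u = wform x (alpha c) *: u) -> phi u = 0].

Lemma slide_char (f : {lrmorphism U -> C^o}) : (forall u, f (grad u) = f u) ->
  exists F : {lrmorphism UU -> U}, (forall x y, F (tens x y) = f y *: x) /\ slide F f false.
Proof.
move=> fg; have [F FE] := slide_exists fg; exists F; split=> //; split=> //.
- by move=> x y; rewrite UtD rmorphM.
- by rewrite rmorph1.
- move=> u c hu; have := congr1 f (hu (cw m k (ht_fun R m k))).
  rewrite /ad_cartan linearB linearZ /= !rmorphM /= ht_alpha scale1r => <-.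
  by rewrite mulrC subrr.
Qed.

Lemma slide_V b : exists Th : {linear UU -> U}, slide Th (fun u => V u b b) (pp b).
Proof.
have [Th [ThL ThE]] := slide_module V.
pose F (z : UU) := Th z b b.
have FL : linear F by move=> c x y; rewrite /F ThL.
pose lF := GRing.isLinear.Build C UU U _ F FL.
pose T : {linear UU -> U} := HB.pack F lF.
exists T; split=> [u v|x y||u c hu].
- exact: ThE.
- by rewrite !V_t eqxx !mulr1n wformDl hqpD.
- by rewrite wact1 mxE eqxx.
- apply/eqP/negP => /negP /(V_weight hu)/esym; rewrite -[RHS]addr0 => /addrI /eqP.
  by rewrite (negPf (alpha_neq0 c)).
Qed.

Lemma wform_eps_alpha_int a c : a \in indices -> exists n : int, wform (eps a) (alpha c) = n%:~R.
Proof.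
move=> ha; rewrite alphaE // wformBr !wform_eps ?top_in ?bot_in //.
exists ((-1) ^+ a.1 * ((root_top c == a)%:R - (root_top c == ibar a)%:R) -
  (-1) ^+ a.1 * ((root_bot c == a)%:R - (root_bot c == ibar a)%:R)).
by rewrite !(rmorphB, rmorphM, rmorphXn, rmorphN1, rmorph_nat).
Qed.

(* The q^x are separated by these characters: modulo the lattice spanned by the
   eps_a through one-dimensional representations, and inside it through V. *)
Lemma slide_sep (x y : D) : x != y ->
  exists Th phi b, slide Th phi b /\ phi (Ut x) != phi (Ut y).
Proof.
move=> xy.
have [a ha na] : exists2 a, a \in indices & wform (eps a) x != wform (eps a) y.
  apply: contrapT => h; case/negP: xy; apply/eqP; apply: wform_nondeg => a ha.
  by apply/eqP; apply: contrapT => /negP n; apply: h; exists a.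
pose w := wform (eps a) (x - y).
have ew : wform (eps a) x = w + wform (eps a) y by rewrite /w wformBr subrK.
have w0 : w != 0 by rewrite /w wformBr subr_eq0.
have [[n en]|hn] := pselect (exists n : int, w = n%:~R).
  have [Th hTh] := slide_V (ix a).
  do 3!eexists; split; first exact: hTh.
  rewrite /= !V_t eqxx !mulr1n /lab_weight ixK // ![wform _ (eps a)]wformC ew hqpD.
  rewrite -[X in _ != X]mul1r (inj_eq (mulIf (qp_neq0 hq0 hqp1 hqpD _))) en.
  apply: contra w0 => /eqP /(qp_int_eq1 hq0 hqp1 hqpD hq) n0.
  by rewrite en n0.
have [n|E [ED E1 Ew]] := @int_character R w.
  by apply/negP => /eqP e; apply: hn; exists n.
have En0 : E 0 = 1.
  have e0 : E 1 != 0 by rewrite E1 oner_neq0.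
  by apply: (mulIf e0); rewrite -ED add0r mul1r.
have ez z : E (- z) * E z = 1 by rewrite -ED addNr.
have Ez0 z : E z != 0 by apply: contra_eq_neq (ez z) => ->; rewrite mulr0 eq_sym oner_neq0.
have EN z : E (- z) = (E z)^-1 by apply: (mulIf (Ez0 z)); rewrite ez mulVf.
have En (n : int) : E n%:~R = 1.
  have Enat (j : nat) : E j%:R = 1.
    by elim: j => // j IH; rewrite -natr1 ED IH E1 mulr1.
  by case: n => j; rewrite ?NegzE ?mulrNz -?pmulrn ?EN Enat ?invr1.
(* [E] is 1 on the integers, and (eps_a, alpha_c) is an integer for every simple root; this gives
   the condition that [one_dim_rep] puts on [chi]. *)
have [] := @one_dim_rep R m k q qp (fun _ => 0) (fun z => E (wform (eps a) z)).
- by move=> c u v; rewrite mulr0 addr0.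
- by rewrite wform0r.
- by move=> u v; rewrite wformDr ED.
- move=> c; have [n en'] := wform_eps_alpha_int c ha.
  by rewrite wformNr en' EN En invr1.
move=> f [_ _ _ ft fg]; have [F [_ hF]] := slide_char fg.
exists F, f, false; split=> //; rewrite !ft ew ED.
by rewrite -[X in _ != X]mul1r (inj_eq (mulIf (Ez0 _))).
Qed.

Lemma Ut_injective x y : Ut x = Ut y -> x = y.
Proof.
move=> e; apply/eqP/negP => /negP /slide_sep [Th [phi [b [_]]]].
by rewrite e eqxx.
Qed.

(** Makes all q^x v0 eigenvectors of each (id (x) phi)Delta, with eigenvalues that differ as soon as
    the phi(q^x) do. It is needed for v0 = 1, for diagonal entries, and v0 = e_c, for entries of
    weight alpha_c. *)
Definition t_scaled (v0 : U) := forall Th phi b, slide Th phi b ->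
  exists2 kap : C, kap != 0 & forall x, Th (Delta (Ut x * v0)) = (kap * phi (Ut x)) *: (Ut x * v0).

Lemma slide_Ut Th phi b : slide Th phi b -> forall x, phi (Ut x) != 0.
Proof.
case=> _ phiD phi1 _ x; have : phi (Ut (x - x)) = 1 by rewrite subrr Ut0.
by rewrite phiD => e; apply: contra_eq_neq e => ->; rewrite mul0r eq_sym oner_neq0.
Qed.

Lemma t_scaled1 : t_scaled 1.
Proof.
move=> Th phi b [h1 _ _ _]; exists 1; rewrite ?oner_neq0 // => x.
by rewrite mulr1 mul1r (coprod_t hDelta) h1 grad_t; case: b {h1}.
Qed.

(** Of the two terms of Delta(q^x e_c), phi kills the one with e_c in the second factor. *)
Lemma t_scaled_e c : t_scaled (Ue c).
Proof.
move=> Th phi b hTh; have [h1 phiD _ phi0] := hTh.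
exists ((-1) ^+ (b && spar c) * phi (Ut (- (2^-1 *: alpha c)))).
  by rewrite mulf_neq0 ?signr_eq0 // (slide_Ut hTh).
move=> x; rewrite rmorphM /= (coprod_t hDelta) (coprod_e hDelta) mulrDr.
rewrite (tensM _ _ (homog_t _ _ x) (homog_t _ _ _)) (tensM _ _ (homog_t _ _ x) (homog_e _ _ c)).
rewrite /= !scale1r linearD /= !h1 -[X in phi (X) *: _ + _]mul1r.
rewrite (phi0 _ c) ?scale0r ?add0r; last first.
  move=> y; rewrite mul1r /ad_cartan mulrA (rel_ht rels) -!mulrA -mulrBr.
  by rewrite (rel_he rels) scalerAr.
rewrite andbF expr0 scale1r h1 -UtD phiD.
have -> : (if b then grad (Ut x * Ue c) else Ut x * Ue c) = (-1) ^+ (b && spar c) *: (Ut x * Ue c).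
  by case: b {hTh h1}; rewrite ?scale1r // rmorphM /= grad_t grad_e scalerAr.
by rewrite scalerA; congr (_ *: _); ring.
Qed.

(** As long as two different exponents occur in a presentation of [u], a functional separating them
    allows [eigen_filter] to drop one of the two terms; the process ends with a single exponent. *)
Lemma tv_unique v0 u : t_scaled v0 -> sums (tv Ut v0) u -> u != 0 ->
  (forall Th phi b, slide Th phi b -> exists s, Th (Delta u) = s *: u) ->
  exists c x, u = c *: (Ut x * v0).
Proof.
move=> hv0 hu u0 hs.
have [s es] : exists s : seq (C * D), u = \sum_(p <- s) p.1 *: (Ut p.2 * v0).
  elim: hu => [|x y [c [z ->]] _ [s ->]]; first by exists [::]; rewrite big_nil.
  by exists ((c, z) :: s); rewrite big_cons.
have [n] := ubnP (size s); elim: n s es => // n IH s es sn.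
have [[p [p' [ps ps' np]]]|hall] := pselect (exists p p', [/\ p \in s, p' \in s & p.2 != p'.2]).
  have [Th [phi [b [hTh nphi]]]] := slide_sep np.
  have [kap kap0 hkap] := hv0 _ _ _ hTh; have [mu hmu] := hs _ _ _ hTh.
  have TL : linear (fun z : U => Th (Delta z)) by move=> c x y; rewrite !linearP.
  pose lT := GRing.isLinear.Build C U U _ (fun z : U => Th (Delta z)) TL.
  pose T : {linear U -> U} := HB.pack (fun z : U => Th (Delta z)) lT.
  have := @eigen_filter C U _ T mu s (fun p => p.1 *: (Ut p.2 * v0)) (fun p => kap * phi (Ut p.2)).
  rewrite -es -big_filter => ef; apply: (IH _ (ef _ _)).
  - by move=> i; rewrite linearZ /= hkap !scalerA mulrC.
  - exact: hmu.
  - rewrite size_filter; apply: leq_trans (_ : size s <= n)%N; last by [].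
    rewrite ltn_neqAle count_size andbT -all_count; apply/negP => /allP ha.
    have := ha _ ps; rewrite -(eqP (ha _ ps')) /= (inj_eq (mulfI kap0)).
    exact/negP.
case: s es sn hall => [|p s] es sn hall; first by rewrite es big_nil eqxx in u0.
exists (\sum_(p' <- p :: s) p'.1), p.2; rewrite es scaler_suml.
apply: eq_big_seq => p' hp'; have [->|n2] := eqVneq p'.2 p.2; first by [].
by case: hall; exists p', p; rewrite hp' mem_head.
Qed.

(* The eigenvectors in U^0 v0 of all the maps (id (x) phi) Delta are the multiples
   of the q^x v0: the characters phi of U^0 that are additive on the h's bound the
   degree in the h's, and those of [slide_sep] separate the remaining q^x. *)
Lemma cart_unique v0 P : t_scaled v0 -> cart P -> P * v0 != 0 ->
  (forall f : {lrmorphism U -> C^o}, forall F : {lrmorphism UU -> U},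
    (forall x y, F (tens x y) = f y *: x) -> (forall c, f (Ue c) = 0) ->
    (forall x, f (Ut x) = 1) -> F (Delta v0) = v0) ->
  (forall Th phi b, slide Th phi b -> exists s, Th (Delta (P * v0)) = s *: (P * v0)) ->
  exists c x, P * v0 = c *: (Ut x * v0).
Proof.
move=> hv0 cP P0 hF hs; apply: tv_unique => //.
have [d hd] := cart_hdeg (rel_ht rels) (rel_tD rels) v0 cP (ex_intro _ 0 Ut0).
pose I := ('I_l + 'I_k)%type.
pose b (i : I) : D := match i with inl j => (delta_mx 0 j, 0) | inr j => (0, delta_mx 0 j) end.
pose cc (i : I) (x : D) : C := match i with inl j => x.1 0 j | inr j => x.2 0 j end.
have ex i : exists fF : {lrmorphism U -> C^o} * {lrmorphism UU -> U},
   [/\ forall x y, fF.2 (tens x y) = fF.1 y *: x, slide fF.2 fF.1 false,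
     forall c, fF.1 (Ue c) = 0, forall x, fF.1 (Ut x) = 1 & forall x, fF.1 (Uh x) = cc i x].
  have [||||f [fe _ fh ft fg]] := @one_dim_rep R m k q qp (cc i) (fun _ => 1).
  - by move=> c x y; case: i => j; rewrite /cc !mxE.
  - by [].
  - by move=> *; rewrite mulr1.
  - by [].
  by have [F [FE hF']] := slide_char fg; exists (f, F).
have [fF hfF] := choice ex.
(* The character in [fF i] takes the i-th coordinate on h and 1 on q^h, so [T i] fixes q^x and adds
   that coordinate to h_x, as the degree argument requires. *)
pose T i : {lrmorphism U -> U} := (fF i).2 \o Delta.
have TE i z : T i z = (fF i).2 (Delta z) by [].
have ex_s i : exists s, T i (P * v0) = s *: (P * v0).
  by have [_ h _ _ _] := hfF i; apply: hs h.
have [s hs'] := choice ex_s.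
apply: (@eigen_hdeg0 R m k U Uh Ut (rel_hh rels) v0 I b cc T _ _ _ _ s d _ hd hs').
- by move=> i x; have [h1 _ _ h2 _] := hfF i; rewrite TE (coprod_t hDelta) h1 h2 scale1r.
- by move=> i; have [h1 _ h3 h2 _] := hfF i; rewrite TE (hF _ _ h1 h3 h2).
- move=> i x; have [h1 _ _ h2 h3] := hfF i; rewrite TE (coprod_h hDelta) linearD /= !h1.
  by rewrite h3 rmorph1 scale1r.
have Uh0 : Uh 0 = 0.
  by have := rel_h_lin rels (-1) 0 0; rewrite scaler0 addr0 scaleN1r addNr.
have UhZ c x : Uh (c *: x) = c *: Uh x.
  by have := rel_h_lin rels c x 0; rewrite !addr0 Uh0 addr0.
have UhDD x y : Uh (x + y) = Uh x + Uh y.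
  by have := rel_h_lin rels 1 x y; rewrite !scale1r.
move=> x; rewrite (eq_bigr (fun i => Uh (cc i x *: b i))) => [|i _]; last by rewrite UhZ.
rewrite -(big_morph Uh UhDD Uh0); congr (Uh _); rewrite big_sumType /=.
have e1 (s' : seq 'I_l) : \sum_(j <- s') x.1 0 j *: ((delta_mx 0 j, 0) : D) =
     (\sum_(j <- s') x.1 0 j *: delta_mx 0 j, 0).
  elim: s' => [|j s' IH]; first by rewrite !big_nil.
  rewrite !big_cons IH; congr (_, _) => /=; by rewrite scaler0 addr0.
have e2 (s' : seq 'I_k) : \sum_(j <- s') x.2 0 j *: ((0, delta_mx 0 j) : D) =
     (0, \sum_(j <- s') x.2 0 j *: delta_mx 0 j).
  elim: s' => [|j s' IH]; first by rewrite !big_nil.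
  rewrite !big_cons IH; congr (_, _) => /=; by rewrite scaler0 addr0.
rewrite e1 e2 [RHS]surjective_pairing [in RHS](matrix_sum_delta x.1).
by rewrite [in RHS](matrix_sum_delta x.2) !big_ord1; congr (_, _) => /=; rewrite ?addr0 ?add0r.
Qed.

(** * Diagonal entries are elements q^x *)

Lemma grad_even i (b : bool) : (if b then grad (L i i) else L i i) = L i i.
Proof. by rewrite grad_L addbb andbF scale1r. Qed.

Lemma slide_L_diag Th phi b i : slide Th phi b -> Th (Delta (L i i)) = phi (L i i) *: L i i.
Proof.
case=> h1 _ _ _; rewrite Delta_L linear_sum (bigD1 i) //= big1 ?addr0 => [|x hx].
  by rewrite h1 grad_even.
have [->|n1] := eqVneq (L x i) 0; first by rewrite tens0l linear0.
have [->|n2] := eqVneq (L i x) 0; first by rewrite tens0r linear0.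
by rewrite (L_loop n1 n2) eqxx in hx.
Qed.

(** Only L_ij (x) L_ii and L_jj (x) L_ij occur in Delta(L_ij), and phi kills the second because L_ij
    has weight alpha_c. *)
Lemma slide_L_edge Th phi b c i j : slide Th phi b -> ee j = ee i + alpha c ->
  Th (Delta (L i j)) = ((-1) ^+ (b && (pp i (+) pp j)) * phi (L i i)) *: L i j.
Proof.
case=> h1 _ _ h0 e.
have nij : i != j.
  apply/negP => /eqP ij; move: e; rewrite ij -[LHS]addr0 => /addrI/esym/eqP.
  by rewrite (negPf (alpha_neq0 c)).
rewrite Delta_L linear_sum (bigD1 i) //= (bigD1 j) /=; last by rewrite eq_sym.
rewrite big1 ?addr0 => [|x /andP [hx hx']].
  rewrite !h1 (h0 (L i j) c) ?scale0r ?addr0 => [|x].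
    by rewrite grad_L scalerA mulrC.
  by rewrite L_weight e addrC addKr.
have [->|n1] := eqVneq (L x j) 0; first by rewrite tens0l linear0.
have [->|n2] := eqVneq (L i x) 0; first by rewrite tens0r linear0.
have [ex|ex] := L_between e n2 n1.
  by rewrite ex eqxx in hx.
by rewrite ex eqxx in hx'.
Qed.

(** A character that is 0 on e_c and 1 on q^h kills the off-diagonal entries of L; applied to the
    i-th diagonal entry of R R^(-1) = 1 it shows that its value on L_ii is invertible. *)
Lemma L_diag_neq0 i : L i i != 0.
Proof.
have [||||f [fe _ fh ft fg]] := @one_dim_rep R m k q qp (fun _ => 0) (fun _ => 1).
- by move=> *; rewrite mulr0 addr0.
- by [].
- by move=> *; rewrite mulr1.
- by [].
have [M [LM _]] := univR_inv hR V.
have := congr1 (fun M : 'M_N => f (M i i)) LM.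
rewrite /= !mxE eqxx rmorph1 linear_sum (bigD1 i) //= big1 ?addr0 => [|x hx].
  rewrite addbb rmorphM /= => e; apply: contra_eq_neq e => ->.
  by rewrite rmorph0 mul0r eq_sym oner_neq0.
suff fL : f (L i x) = 0.
  by rewrite rmorphM /=; case: ifP => _; rewrite ?fg fL mul0r.
have := L_words i x.
elim=> [|u v [P [w [_ -> e]]] _ IH]; first by rewrite rmorph0.
rewrite rmorphD /= IH addr0 rmorphM /=; case: w e => [|c w] e.
  move/eqP: e; rewrite /root_sum big_nil eq_sym subr_eq0 => /eqP /ee_inj ex.
  by rewrite ex eqxx in hx.
by rewrite /root_word big_cons rmorphM /= fe mul0r mulr0.
Qed.

Lemma L_diag_t i : exists x, L i i = Ut x.
Proof.
have [|||c [x e]] := @cart_unique 1 (L i i) t_scaled1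
  (L_diag_cart i).
- by rewrite mulr1 L_diag_neq0.
- by move=> f F FE _ _; rewrite rmorph1 -tens11 FE rmorph1 scale1r.
- by move=> Th phi b hTh; exists (phi (L i i)); rewrite mulr1 (slide_L_diag i hTh).
rewrite !mulr1 in e; exists x.
(* The scalar is fixed by a counit argument: with f(q^x) = 1, the map (id (x) f)Delta fixes L_ii,
   but it also multiplies L_ii by f(L_ii) = c, so c = 1. *)
have [||||f [fe _ fh ft fg]] := @one_dim_rep R m k q qp (fun _ => 0) (fun _ => 1).
- by move=> *; rewrite mulr0 addr0.
- by [].
- by move=> *; rewrite mulr1.
- by [].
have [F [FE hF]] := slide_char fg.
have ef : f (L i i) = c by rewrite e linearZ /= ft; exact: mulr1.
have eF : F (Delta (L i i)) = L i i.
  by rewrite e !linearZ /= (coprod_t hDelta) FE ft scale1r.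
have eq1 : F (Delta (L i i)) = f (L i i) *: L i i := slide_L_diag i hF.
move: eq1; rewrite eF ef -{1}[L i i]scale1r => /eqP.
rewrite -subr_eq0 -scalerBl scaler_eq0 (negPf (L_diag_neq0 i)) orbF subr_eq0 => /eqP c1.
by rewrite e -c1 scale1r.
Qed.

(** * Entries attached to simple roots *)

Lemma sgnC_sq (c : sroot m k) : sgn (root_top c) (root_bot c) * sgn (root_bot c) (root_top c) =
  (-1) ^+ (root_top c).1 * (-1) ^+ (root_bot c).1.
Proof.
rewrite /Sig_sign.
set x := xi R (root_top c); set y := xi R (root_bot c).
have hx : x * x = 1 := xi_sq R (root_top c).
have hy : y * y = 1 := xi_sq R (root_bot c).
transitivity ((-1) ^+ ((root_top c).1 && ((root_top c).1 (+) (root_bot c).1)) *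
  (-1) ^+ ((root_bot c).1 && ((root_bot c).1 (+) (root_top c).1)) * (x * x) * (y * y) : C); first by ring.
rewrite hx hy !mulr1 -!signr_addb; congr (_ ^+ nat_of_bool _).
by case: (root_top c).1; case: (root_bot c).1.
Qed.

Lemma Ve_entry c i j : V (Ue c) i j = ((lab i == root_top c) && (lab j == root_bot c))%:R -
  sgn (root_top c) (root_bot c) * ((lab i == ibar (root_bot c)) && (lab j == ibar (root_top c)))%:R.
Proof. by rewrite (vec_actE hV) vec_eE // SigE. Qed.

Lemma Vf_entry c i j : V (Uf c) i j = (-1) ^+ (root_top c).1 *
  (((lab i == root_bot c) && (lab j == root_top c))%:R -
  sgn (root_bot c) (root_top c) * ((lab i == ibar (root_top c)) && (lab j == ibar (root_bot c)))%:R).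
Proof. by rewrite (vec_actF hV) vec_fE // mxE SigE. Qed.

Let bar_eq a b : a \in indices -> b \in indices -> (ibar a == ibar b) = (a == b).
Proof. by move=> ha hb; rewrite ibar_eq ?ibarK ?ibar_in. Qed.

Lemma edge_entries c i j : edge c (lab j) (lab i) ->
  (lab j = root_top c /\ V (Uf c) i j = (-1) ^+ (root_top c).1 \/
   lab j = ibar (root_bot c) /\ V (Uf c) i j = - ((-1) ^+ (root_top c).1 * sgn (root_bot c) (root_top c))) /\
  V (Uf c) i j * V (Ue c) j i = (-1) ^+ (lab j).1.
Proof.
have hb := bot_in hm hk c; have ht := top_in hm hk c.
have h1 : (root_bot c == ibar (root_top c)) = false.
  rewrite eq_sym ibar_eq //; exact/negbTE/(top_neq_ibar_bot hm hk).
have h2 : (root_top c == ibar (root_bot c)) = false by exact/negbTE/(top_neq_ibar_bot hm hk).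
case=> -[e1 e2]; rewrite Vf_entry Ve_entry e1 e2 ?bar_eq // !eqxx.
  by rewrite h1 h2 /= !mulr0 !subr0 !mulr1; split; first by left.
rewrite ![_ == root_top c]eq_sym ![_ == root_bot c]eq_sym h1 h2 !andbF /= !sub0r !mulr1 mulrN.
split; first by right.
rewrite mulrNN -mulrA [sgn (root_bot c) _ * _]mulrC sgnC_sq mulrA -signr_addb addbb mul1r.
by [].
Qed.

Lemma Vf_edge_neq0 c i j : edge c (lab j) (lab i) -> V (Uf c) i j != 0.
Proof.
case/edge_entries => _ e; apply: contra_eq_neq e => ->.
by rewrite mul0r eq_sym signr_eq0.
Qed.

Lemma Uf_neq0 c : Uf c != 0.
Proof.
have hb := bot_in hm hk c; have ht := top_in hm hk c.
have : V (Uf c) (ix (root_bot c)) (ix (root_top c)) != 0.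
  by apply: Vf_edge_neq0; rewrite !ixK //; left.
by apply: contra_neq => ->; rewrite wact0 mxE.
Qed.

Lemma Ut_mul_neq0 x u : u != 0 -> Ut x * u != 0.
Proof.
apply: contra_neq => e; apply: (@Ut_inj x); by rewrite e mulr0.
Qed.

Lemma Ut_neq0 x : Ut x != 0.
Proof. by rewrite -[Ut x]mulr1; apply/Ut_mul_neq0/oner_neq0. Qed.

(** A map with different eigenvalues on q^x and q^y, applied to the relation and compared with a
    multiple of it, leaves one term. *)
Lemma Ut_pair a b x y : x != y -> a *: Ut x = b *: Ut y -> a = 0 /\ b = 0.
Proof.
move=> xy e.
have [Th [phi [bb [hTh np]]]] := slide_sep xy.
have t1 := t_scaled1 hTh; case: t1 => kap kap0 hk'.
have h z : Th (Delta (Ut z)) = (kap * phi (Ut z)) *: Ut z by have := hk' z; rewrite mulr1.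
have := congr1 (fun z => Th (Delta z)) e; rewrite !linearZ /= !h !scalerA.
rewrite [b * _]mulrC -[_ *: Ut y]scalerA -e scalerA [in LHS]mulrC => /eqP.
rewrite -subr_eq0 -scalerBl scaler_eq0 (negPf (Ut_neq0 _)) orbF -mulrBl mulf_eq0.
rewrite -mulrBr mulf_eq0 (negPf kap0) subr_eq0 (negPf np) /= => /eqP a0.
split=> //; move: e; rewrite a0 scale0r => /esym/eqP.
by rewrite scaler_eq0 (negPf (Ut_neq0 _)) orbF => /eqP.
Qed.

(** If s is neither p nor r, a map separating q^s from q^p eliminates q^s; [Ut_pair] then gives a =
    0, so q^r = q^s, a contradiction. *)
Lemma Ut_triple (a : C) p r s : p != r -> a *: Ut p + (1 - a) *: Ut r = Ut s ->
  (s = p /\ a = 1) \/ (s = r /\ a = 0).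
Proof.
move=> pr e.
have [sp|sp] := eqVneq s p.
  left; split=> //; move/eqP: e; rewrite sp addrC -subr_eq0 -addrA -{2}[Ut p]scale1r -scalerBl.
  rewrite addr_eq0 -scaleNr opprB => /eqP /esym /(Ut_pair pr) [/eqP].
  by rewrite subr_eq0 => /eqP ->.
have [sr|sr] := eqVneq s r.
  right; split=> //; move/eqP: e; rewrite sr scalerBl scale1r addrCA -subr_eq0 addrAC subrr add0r.
  by rewrite subr_eq0 => /eqP /(Ut_pair pr) [].
have [Th [phi [bb [hTh np]]]] := slide_sep sp.
have t1 := t_scaled1 hTh; case: t1 => kap kap0 hk'.
have h z : Th (Delta (Ut z)) = (kap * phi (Ut z)) *: Ut z by have := hk' z; rewrite mulr1.
have := congr1 (fun z => Th (Delta z)) e; rewrite !linearD /= !linearZ /= !h !scalerA.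
rewrite -[X in _ = _ *: X]e scalerDr !scalerA => /eqP.
rewrite -subr_eq0 opprD addrACA -!scalerBl addr_eq0 -[X in _ == X]scaleNr => /eqP /(Ut_pair pr) [].
rewrite [X in _ - X]mulrC -mulrBr => /eqP; rewrite mulf_eq0 -mulrBr mulf_eq0 (negPf kap0).
rewrite subr_eq0 [phi (Ut p) == _]eq_sym (negPf np) /= orbF => /eqP a0 _.
have rs : r != s by rewrite eq_sym.
move: e; rewrite a0 scale0r add0r subr0 -[Ut s]scale1r => e.
by case: (Ut_pair rs e) => /eqP; rewrite oner_eq0.
Qed.

Definition xx (i : 'I_N) : D := projT1 (cid (L_diag_t i)).

Lemma L_diag_xx i : L i i = Ut (xx i).
Proof. exact: (projT2 (cid (L_diag_t i))). Qed.

(** Moving q^(x_i) past f_c shows only its scaling factor, so this is an equality of powers of q,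
    not of weights. *)
Lemma xx_alpha i c : qp (wform (xx i) (alpha c)) = qp (wform (ee i) (alpha c)).
Proof.
have := L_diag_f c i.
rewrite L_diag_xx f_Ut // => /eqP; rewrite -subr_eq0 -scalerBl scaler_eq0 subr_eq0.
rewrite (negPf (Ut_mul_neq0 _ (Uf_neq0 c))) orbF => /eqP <-.
by rewrite wformC.
Qed.

Lemma slide_te Th phi b x c : slide Th phi b -> Th (Delta (Ut x * Ue c)) =
  ((-1) ^+ (b && spar c) * phi (Ut (x - 2^-1 *: alpha c))) *: (Ut x * Ue c).
Proof.
move=> hTh; have [h1 phiD _ phi0] := hTh.
rewrite rmorphM /= (coprod_t hDelta) (coprod_e hDelta) mulrDr.
rewrite (tensM _ _ (homog_t _ _ x) (homog_t _ _ _)) (tensM _ _ (homog_t _ _ x) (homog_e _ _ c)).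
rewrite /= !scale1r linearD /= !h1 (phi0 (Ut x * Ue c) c) ?scale0r ?add0r; last first.
  move=> y; rewrite /ad_cartan mulrA (rel_ht rels) -!mulrA -mulrBr.
  by rewrite (rel_he rels) scalerAr.
rewrite andbF expr0 scale1r h1 -UtD.
have -> : (if b then grad (Ut x * Ue c) else Ut x * Ue c) = (-1) ^+ (b && spar c) *: (Ut x * Ue c).
  by case: b {hTh h1}; rewrite ?scale1r // rmorphM /= grad_t grad_e scalerAr.
by rewrite scalerA mulrC.
Qed.

(** [cart_unique] with v0 = e_c leaves an unknown exponent x. Two expressions for the eigenvalue of
    (id (x) phi)Delta on L_ij, one through L_ii and one through q^x e_c, force x - alpha_c/2 = x_i,
    because the phi separate. *)
Lemma L_edge_form c i j : V (Uf c) i j != 0 -> exists a : C,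
  L i j = a *: (Ut (xx i + 2^-1 *: alpha c) * Ue c).
Proof.
move=> v0; have e : ee j = ee i + alpha c by rewrite (Vf_weight v0) subrK.
have hp : pp i (+) pp j = spar c := wact_par (homog_f _ _ c) v0.
have [->|L0] := eqVneq (L i j) 0; first by exists 0; rewrite scale0r.
have [P cP eP] := L_edge_cart e.
have [|||a [x ex]] := cart_unique (t_scaled_e c) cP.
- by rewrite -eP.
- move=> f F FE fe ft; rewrite (coprod_e hDelta) linearD /= !FE fe ft.
  by rewrite scale0r scale1r add0r.
- move=> Th phi b hTh; rewrite -eP.
  by eexists; apply: (slide_L_edge hTh e).
exists a; rewrite eP ex; congr (_ *: (Ut _ * _)).
apply: (addIr (- (2^-1 *: alpha c))); rewrite addrK.
apply/eqP/negP => /negP ne.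
have [Th [phi [b [hTh np]]]] := slide_sep ne.
have e1 : Th (Delta (L i j)) =
    ((-1) ^+ (b && spar c) * phi (Ut (x - 2^-1 *: alpha c))) *: L i j.
  by rewrite eP ex [Delta _]linearZ /= [Th _]linearZ /= (slide_te _ _ hTh) !scalerA mulrC.
move: e1; rewrite (slide_L_edge hTh e) hp L_diag_xx => /eqP.
rewrite -subr_eq0 -scalerBl scaler_eq0 (negPf L0) orbF -mulrBr mulf_eq0.
by rewrite signr_eq0 /= subr_eq0 eq_sym (negPf np).
Qed.

Let half2 : 2^-1 + 2^-1 = 1 :> C. Proof. by rewrite -div1r -splitr. Qed.

(** In the f_c-relation the two products of e_c and f_c combine into [e_c, f_c], whose Cartan value
    leaves an identity among elements q^x alone. *)
Lemma L_edge_coef c i j (a : C) (w := 2^-1 *: alpha c) : V (Uf c) i j != 0 ->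
  L i j = a *: (Ut (xx i + w) * Ue c) ->
  (a * qp (wform w (ee j)) / (q - q^-1)) *: (Ut (xx i + w + alpha c) - Ut (xx i - w)) =
  V (Uf c) i j *: (Ut (w + xx j) - Ut (xx i - w)).
Proof.
move=> v0 ea; have e : ee j = ee i + alpha c by rewrite (Vf_weight v0) subrK.
have ww : w + w = alpha c by rewrite -scalerDl half2 scale1r.
set tau := qp (wform w (ee j)).
have tauE : (-1) ^+ spar c * qp (- wform w (ee i)) * a * qp (wform (xx i + w) (alpha c)) =
   a * tau * (-1) ^+ spar c.
  rewrite wformDl hqpD xx_alpha.
  have -> : tau = qp (- wform w (ee i)) * qp (wform (ee i) (alpha c)) * qp (wform w (alpha c)).
    rewrite -!hqpD /tau e; congr qp; rewrite wformDr -ww !wformDr [wform (ee i) w]wformC; ring.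
  by ring.
have := L_edge_f v0; rewrite -/w -/tau ea !L_diag_xx -!UtD => <-.
rewrite -[(a *: _) * Uf c]scalerAl -[Uf c * (a *: _)]scalerAr !mulrA f_Ut //.
rewrite -[(_ *: (_ * Uf c)) * Ue c]scalerAl !scalerA tauE.
rewrite [tau * a]mulrC -[(a * tau * (-1) ^+ _) *: _]scalerA -scalerBr -!mulrA.
rewrite [(-1) ^+ _ *: _]scalerAr -mulrBr (rel_ef rels) -[Ut _ * (_ *: _)]scalerAr mulrBr -!UtD scalerA.
have -> : xx i + w - alpha c = xx i - w by rewrite -ww opprD addrA addrK.
by rewrite -[in RHS]mulrA.
Qed.

(** [Ut_triple] leaves two cases for x_j. The case x_j = x_i - alpha_c contradicts [xx_alpha]: it
    would give q^(2(alpha_c, alpha_d)) = 1 for every simple root, while some integer (alpha_c,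
    alpha_d) is nonzero. *)
Lemma xx_edge c i j : V (Uf c) i j != 0 -> xx j = xx i + alpha c /\
  L i j = ((q - q^-1) * V (Uf c) i j * qp (- wform (2^-1 *: alpha c) (ee j))) *:
     (Ut (xx i + 2^-1 *: alpha c) * Ue c).
Proof.
move=> v0; have e : ee j = ee i + alpha c by rewrite (Vf_weight v0) subrK.
have [a ea] := L_edge_form v0; have := L_edge_coef v0 ea.
set w := 2^-1 *: alpha c in ea *.
have ww : w + w = alpha c by rewrite -scalerDl half2 scale1r.
set tau := qp (wform w (ee j)).
have tau0 : tau != 0 := qp_neq0 hq0 hqp1 hqpD _.
have q0 := q_sub_neq0 hq0 hq.
move/(congr1 (fun z => (V (Uf c) i j)^-1 *: z)); rewrite !scalerA mulVf // scale1r.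
set a' := _^-1 * _; set A := (_ + alpha c); set B := xx i - w => E.
have AB : A = B + (alpha c + alpha c).
  by rewrite /A /B addrA; congr (_ + _); rewrite -ww addrA subrK.
have nAB : A != B.
  rewrite AB -subr_eq0 addrAC subrr add0r; apply/eqP.
  move/(congr1 (wform (cw m k (ht_fun R m k)))); rewrite wformDr wform0r ht_alpha.
  by move/eqP; rewrite -(natrD _ 1 1) pnatr_eq0.
have tri : a' *: Ut A + (1 - a') *: Ut B = Ut (w + xx j).
  by rewrite scalerBl scale1r [Ut B - _]addrC addrA -scalerBr E subrK.
have [[s a1]|[s _]] := Ut_triple nAB tri; last first.
  have [d hd] := wform_alpha_nondeg R hm hk c.
  have [n1 en1] := wform_eps_alpha_int d (top_in hm hk c).
  have [n2 en2] := wform_eps_alpha_int d (bot_in hm hk c).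
  have exj : xx j = xx i - alpha c.
    by apply: (addrI w); rewrite s /B -ww opprD [RHS]addrC -!addrA addNr addr0.
  have := xx_alpha j d; rewrite exj e wformBl wformDl (hqpD _ (- _)) (hqpD _ (wform (alpha c) _)) xx_alpha.
  move/(mulfI (qp_neq0 hq0 hqp1 hqpD _)).
  have -> : wform (alpha c) (alpha d) = (n1 - n2)%:~R.
    by rewrite (alphaE R hm hk c) wformBl en1 en2 rmorphB.
  move=> e2; have : qp ((n1 - n2) + (n1 - n2))%:~R = 1.
    by rewrite rmorphD /= hqpD -{1}e2 -hqpD addNr (qp0 hq0 hqp1 hqpD).
  move/(qp_int_eq1 hq0 hqp1 hqpD hq) => n0; case/negP: hd; rewrite wformC.
  rewrite (alphaE R hm hk c) wformBl en1 en2 -rmorphB intr_eq0.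
  by apply/eqP; lia.
split.
  by apply: (addrI w); rewrite s /A [w + (xx i + _)]addrA [w + xx i]addrC.
rewrite ea; congr (_ *: _); apply: (mulIf tau0); rewrite -[RHS]mulrA (qpNM hq0 hqp1 hqpD) mulr1.
have field_aux (v z y : C) : v != 0 -> z != 0 -> y = z * v * (v^-1 * (y / z)).
  by move=> vn zn; field; rewrite vn zn.
by rewrite -[RHS]mulr1 -a1 /a'; apply: field_aux.
Qed.

(** * Duality and the invariant vector of V (x) V *)

Definition ib (i : 'I_N) : 'I_N := ix (ibar (lab i)).

Lemma lab_ib i : lab (ib i) = ibar (lab i).
Proof. by rewrite ixK // ibar_in // lab_in. Qed.

Lemma ibK i : ib (ib i) = i.
Proof. by apply: lab_inj; rewrite !lab_ib ibarK ?lab_in. Qed.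

Lemma ee_ib i : ee (ib i) = - ee i.
Proof. by rewrite /lab_weight lab_ib eps_bar ?lab_in. Qed.

Lemma pp_lab i : pp i = (lab i).1.
Proof. exact: vec_par hV i. Qed.

Lemma pp_ib i : pp (ib i) = pp i.
Proof. by rewrite !pp_lab lab_ib. Qed.

(* the elements of osp are antisymmetric for the invariant form *)
Lemma Sig_bar p r i j : p \in indices -> r \in indices ->
  Sig R m k p r (ib i) (ib j) =
  - ((-1) ^+ ((lab j).1 && ((lab i).1 (+) (lab j).1)) * xi R (lab i) * xi R (lab j)) *
    Sig R m k p r j i.
Proof.
move=> hp hr; rewrite !SigE !lab_ib !ibar_eq ?ibar_in ?lab_in // !ibarK //.
have [[e1 e2]|h1] := pselect (lab j = p /\ lab i = r).
  have hb : ((lab i == ibar p) && (lab j == ibar r)) = ((lab j == ibar r) && (lab i == ibar p)).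
    exact: andbC.
  rewrite hb e1 e2 !eqxx /=.
  case: ((p == ibar r) && (r == ibar p)) / andP => [[/eqP f1 /eqP f2]|_].
    rewrite /Sig_sign f1 /Defs.ibar /= addbb andbF expr0 !mul1r; move: (xi_ibar R hr); rewrite /Defs.ibar => ->.
    have := xi_sq R r; move: (xi R r) => x hx; case: r.1; rewrite ?expr1 ?expr0; ring: hx.
  rewrite /= !mulr0 subr0 sub0r mulr1 /Sig_sign addbC; ring.
have n1 : ((lab j == p) && (lab i == r)) = false.
  by apply/negP => /andP [/eqP e1 /eqP e2]; apply: h1.
rewrite n1 [(lab i == r) && _]andbC n1 /= mulr0 subr0 sub0r [(lab j == _) && _]andbC.
case: andP => [[/eqP e1 /eqP e2]|_]; last by rewrite !mulr0 oppr0 mulr0.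
rewrite mulr1 e1 e2 mulrNN /Sig_sign !(xi_ibar R) // /Defs.ibar /=.
have := xi_sq R r; have := xi_sq R p; move: (xi R r) (xi R p) => x y hx hy.
case: r.1; case: p.1; rewrite /= ?expr1 ?expr0 ?mul1r ?mulr1; ring: hx hy.
Qed.

Lemma V_bar c X i j : X = Ue c \/ X = Uf c -> V X (ib i) (ib j) =
  - ((-1) ^+ (pp j && (pp i (+) pp j)) * xi R (lab i) * xi R (lab j)) * V X j i.
Proof.
have ht := top_in hm hk c; have hb := bot_in hm hk c; rewrite !pp_lab.
case=> ->; first by rewrite (vec_actE hV) vec_eE // Sig_bar.
by rewrite (vec_actF hV) vec_fE // [LHS]mxE [X in _ = _ * X]mxE Sig_bar // [RHS]mulrCA.
Qed.

(** The coefficient of |ibar x> (x) |x> in the invariant vector. The power of q with exponent (rho,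
    eps_x) compensates the factors q^(h_c/2) and q^(-h_c/2) of the coproduct, through
    [rho_alpha]. *)
Let coef (x : 'I_N) : C := (-1) ^+ pp x * xi R (lab x) * qp (wform rho (ee x)).

Lemma coef_ef c X : X = Ue c \/ X = Uf c -> forall i x,
  qp (wform (2^-1 *: alpha c) (ee i)) *
     ((-1) ^+ ((pp x (+) pp (ib i)) && pp i) * V X x (ib i) * coef (ib i)) +
  qp (- wform (2^-1 *: alpha c) (ee x)) * (V X i (ib x) * coef x) = 0.
Proof.
move=> hX i x; have := V_bar (ib x) i hX; rewrite ibK => ->.
have [->|n0] := eqVneq (V X i (ib x)) 0; first by rewrite !(mulr0, mul0r, addr0).
rewrite !pp_ib lab_ib (xi_ibar R (lab_in x)) -pp_lab /coef ee_ib wformNr lab_ib.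
rewrite (xi_ibar R (lab_in i)) -pp_lab pp_ib.
set w := 2^-1 *: alpha c.
have rw : wform rho (alpha c) = wform w (alpha c) := rho_alpha R hm hk c.
have E : qp (wform w (ee i)) * qp (- wform rho (ee i)) =
    qp (- wform w (ee x)) * qp (wform rho (ee x)).
  rewrite -!hqpD; congr qp; case: hX n0 => ->.
    move/(Ve_weight); rewrite ee_ib => ->.
    by rewrite !wformDr !wformNr rw; ring.
  move/(Vf_weight); rewrite ee_ib => ->.
  by rewrite !wformDr !wformNr rw; ring.
have hx := xi_sq R (lab x); have hi := xi_sq R (lab i).
move: E hx hi; move: (xi R (lab x)) (xi R (lab i)) (V X i (ib x)) => y z X0.
move: (qp (wform w _)) (qp (- wform rho _)) (qp (- wform w _)) (qp (wform rho _)) => a b c' d E hy hz.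
case: (pp x); case: (pp i); rewrite /= ?expr1 ?expr0 ?mul1r ?mulr1; ring: E hz.
Qed.

Lemma L_both i j : L i j != 0 -> L (ib i) (ib j) != 0 -> i = j.
Proof.
move=> /(L_neq0) [w e] /(L_neq0) [w' e'].
have : wt (w ++ w') = 0.
  rewrite /root_sum big_cat /=.
  have -> : \sum_(c <- w) alpha c = ee j - ee i by rewrite e addrC addKr.
  have -> : \sum_(c <- w') alpha c = ee i - ee j.
    by rewrite !ee_ib in e'; rewrite [RHS]addrC e' addrAC addNr add0r.
  by rewrite addrA subrK subrr.
move/(wt_eq0 hm hk); case: w e => [|c0 w] e // _; apply: ee_inj.
by rewrite e /root_sum big_nil addr0.
Qed.

(** The vector 1 (x) 1 is invariant in the tensor square of the trivial module, where R acts by the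
    square of its value on one factor. *)
Lemma R_trivial (W0 : wmodule 1) : (forall x, wpar W0 x = false) ->
  (forall c, W0 (Ue c) = 0) -> (forall c, W0 (Uf c) = 0) ->
  (forall x, W0 (Uh x) = 0) -> (forall x, W0 (Ut x) = 1%:M) ->
  cR W0 0 0 = cR W0 0 0 * cR W0 0 0.
Proof.
move=> p0 e0 f0 h0 t0; have [W'' hW] := tensor_module hqpD hDelta W0 W0.
have w0 i : wwt W0 i = 0.
  apply: wform_nondeg => a ha; rewrite wform0r.
  have := congr1 (fun M : 'M_1 => M i i) (wact_h W0 (eps a)).
  by rewrite h0 !mxE eqxx mulr1n => <-.
have v_par (i x : 'I_1) : (1 : C) != 0 -> wpar W0 i = wpar W0 x by rewrite !p0.
have v_wt (i x : 'I_1) : (1 : C) != 0 -> wwt W0 i + wwt W0 x = 0 by rewrite !w0 addr0.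
have v_ef c X : X = Ue c \/ X = Uf c -> forall i x : 'I_1,
     qp (wform (2^-1 *: alpha c) (wwt W0 i)) *
       (\sum_y (-1) ^+ ((wpar W0 x (+) wpar W0 y) && wpar W0 i) * W0 X x y * 1) +
     qp (- wform (2^-1 *: alpha c) (wwt W0 x)) * (\sum_j W0 X i j * 1) = 0.
  move=> hX i x; have -> : W0 X = 0 by case: hX => ->.
  by rewrite !big1 ?mulr0 ?addr0 // => y _; rewrite mxE ?mulr0 ?mul0r.
have := invariant_R hq0 hqp1 hqpD hDelta hR p0 e0 f0 h0 t0 hW v_par v_wt v_ef 0 0.
by rewrite !big_ord1 !scale1r (legs_entry hR hW) !p0 /= scale1r => ->.
Qed.

(* R acts as the identity on the invariant vector of V (x) V; on its component
   (i, ib i), by triangularity, it acts as L_ii L_(ib i)(ib i). *)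
Lemma xx_bar i : xx i + xx (ib i) = 0.
Proof.
have [W0 [p0 e0 f0 h0 t0]] := trivial_module m k hq0 hqp1 hqpD.
have [W'' hW] := tensor_module hqpD hDelta V V.
pose v (j y : 'I_N) : C := if y == ib j then coef y else 0.
have vE j y : v j y = (ib j == y)%:R * coef y.
  by rewrite /v [ib j == y]eq_sym; case: (y == _); rewrite ?mul1r ?mul0r.
have vE' j y : v j y = (j == ib y)%:R * coef y.
  by rewrite vE -[j == _](inj_eq (can_inj ibK)) ibK.
have e : cR W0 0 0 = Ut (xx i + xx (ib i)).
  have v_par (j y : 'I_N) : v j y != 0 -> pp j = pp y.
    by rewrite /v; case: (eqVneq y (ib j)) => [->|_]; rewrite ?eqxx // pp_ib.
  have v_wt (j y : 'I_N) : v j y != 0 -> wwt V j + wwt V y = 0.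
    rewrite /v; case: (eqVneq y (ib j)) => [->|_]; rewrite ?eqxx // => _.
    by rewrite !wwtV ee_ib subrr.
  have v_ef c X : X = Ue c \/ X = Uf c -> forall j y : 'I_N,
     qp (wform (2^-1 *: alpha c) (wwt V j)) *
       (\sum_z (-1) ^+ ((pp y (+) pp z) && pp j) * V X y z * v j z) +
     qp (- wform (2^-1 *: alpha c) (wwt V y)) * (\sum_z V X j z * v z y) = 0.
    move=> hX j y; rewrite !wwtV -[RHS](coef_ef hX j y); congr (_ * _ + _ * _).
      rewrite (bigD1 (ib j)) //= big1 ?addr0 => [|z hz]; first by rewrite /v eqxx.
      by rewrite /v (negPf hz) mulr0.
    rewrite (bigD1 (ib y)) //= big1 ?addr0 => [|z hz]; first by rewrite vE' eqxx mul1r.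
    by rewrite vE' (negPf hz) mul0r mulr0.
  have := invariant_R hq0 hqp1 hqpD hDelta hR p0 e0 f0 h0 t0 hW v_par v_wt v_ef i (ib i).
  rewrite (bigD1 i) //= [X in _ + X]big1 ?addr0 => [|j hj]; last first.
    rewrite big1 // => y _; rewrite /v; case: eqP => [->|_]; last by rewrite scale0r.
    rewrite (legs_entry hR hW).
    have [->|n1] := eqVneq (L i j) 0; first by rewrite mul0r !scaler0.
    have [->|n2] := eqVneq (L (ib i) (ib j)) 0; first by rewrite mulr0 !scaler0.
    by rewrite (L_both n1 n2) eqxx in hj.
  rewrite (bigD1 (ib i)) //= [X in _ + X]big1 ?addr0 => [|y hy]; last first.
    by rewrite /v (negPf hy) scale0r.
  rewrite (legs_entry hR hW) addbb scale1r !L_diag_xx -UtD /v eqxx.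
  have c0 : coef (ib i) != 0.
    rewrite /coef !mulf_neq0 ?signr_eq0 ?(qp_neq0 hq0 hqp1 hqpD) //.
    by apply: contra_eq_neq (xi_sq R (lab (ib i))) => ->; rewrite mul0r eq_sym oner_neq0.
  by move=> h; apply/esym; apply: (scalerI c0); exact: h.
(* The value of R on the trivial module is thus both idempotent and of the form q^y, which gives y +
   y = y. *)
have := R_trivial p0 e0 f0 h0 t0; rewrite e -UtD.
move/(Ut_injective) => /esym; rewrite -[RHS]addr0.
by move/addrI.
Qed.

(** The difference x_i - eps_i is the same along every edge, hence for all i; since x and eps both
    change sign under duality, twice this constant is 0. *)
Lemma xxE i : xx i = ee i.
Proof.
pose Y (a : idx) := xx (ix a) - eps a.
have YE (a : idx) : a \in indices -> Y a = xx (ix a) - ee (ix a).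
  by move=> ha; rewrite /Y /lab_weight ixK.
have edgeY (c : sroot m k) b a : edge c b a -> Y b = Y a.
  move=> hc; have [hb ha] := edge_in hm hk hc; rewrite !YE //.
  have hc' : edge c (lab (ix b)) (lab (ix a)) by rewrite !ixK.
  have v0 := Vf_edge_neq0 hc'.
  have [-> _] := xx_edge v0.
  rewrite {1}/lab_weight ixK // (edge_alpha R hm hk hc) /lab_weight ixK //.
  by rewrite opprD addrACA subrr addr0.
have conn := @connected m k hm hk _ Y (fun c => edgeY c _ _ (or_introl (conj erefl erefl)))
  (fun c => esym (edgeY c _ _ (or_intror (conj erefl erefl)))).
have e1 : xx i - ee i = Y (ev 1) by rewrite -(conn _ (lab_in i)) YE ?lab_in // labK.
have e2 : xx (ib i) - ee (ib i) = Y (ev 1).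
  by rewrite -(conn _ (lab_in (ib i))) YE ?lab_in // labK.
have : Y (ev 1) + Y (ev 1) = 0.
  by rewrite -{1}e1 -e2 ee_ib addrACA xx_bar opprK addNr addr0.
rewrite -mulr2n -[_ *+ 2]scaler_nat => /eqP; rewrite scaler_eq0 pnatr_eq0 /= -e1.
by rewrite subr_eq0 => /eqP.
Qed.

Lemma L_diag i : L i i = Ut (ee i).
Proof. by rewrite -xxE -L_diag_xx. Qed.

Lemma L_edge c i j : edge c (lab j) (lab i) -> L i j =
  ((q - q^-1) * V (Uf c) i j * qp (- wform (2^-1 *: alpha c) (ee j))) *:
     (Ut (ee i + 2^-1 *: alpha c) * Ue c).
Proof.
move=> hc; rewrite -(xxE i).
by have [_] := xx_edge (Vf_edge_neq0 hc).
Qed.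

(* (id (x) V) M, acting on V (x) V *)
Definition second_leg (M : 'M[U]_N) : 'M[C]_#|{: 'I_N * 'I_N}| :=
  \matrix_(z, z') ((-1) ^+ ((pp (enum_val z).2 (+) pp (enum_val z').2) && pp (enum_val z').1) *
    V (M (enum_val z).1 (enum_val z').1) (enum_val z).2 (enum_val z').2).

(** * The RLL relation and its consequences *)

Lemma second_legE M i x j y : second_leg M (pk i x) (pk j y) =
  (-1) ^+ ((pp x (+) pp y) && pp j) * V (M i j) x y.
Proof. by rewrite mxE !pkE. Qed.

Lemma second_leg_gmul M M' : second_leg (gmul pp M M') = second_leg M *m second_leg M'.
Proof.
apply: pk_ext => i x j y; rewrite second_legE [RHS]mxE sum_pk mxE wact_sum summxE mulr_sumr.
apply: eq_bigr => u _; rewrite wactM mxE mulr_sumr; apply: eq_bigr => z _.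
rewrite !second_legE.
have -> : V (if pp u (+) pp j then grad (M i u) else M i u) x z =
    (-1) ^+ ((pp u (+) pp j) && (pp x (+) pp z)) * V (M i u) x z.
  by case: ifP => _; rewrite ?mul1r // wact_grad.
rewrite !mulrA; congr (_ * _); rewrite -!mulrA [V _ _ _ * _]mulrC !mulrA; congr (_ * _).
rewrite -!signr_addb; congr (_ ^+ nat_of_bool _).
by case: (pp x); case: (pp y); case: (pp z); case: (pp u); case: (pp j).
Qed.

Lemma second_leg_etens A u : second_leg (etens A u) = skron V V A (V u).
Proof. by apply: pk_ext => i x j y; rewrite second_legE skronE mxE wactZ mxE. Qed.

Lemma second_leg0 : second_leg 0 = 0.
Proof. by apply: pk_ext => i x j y; rewrite second_legE !mxE wact0 mxE mulr0. Qed.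

Lemma second_legD M M' : second_leg (M + M') = second_leg M + second_leg M'.
Proof.
apply: pk_ext => i x j y; rewrite second_legE mxE wactD [in LHS]mxE mulrDr.
by rewrite [RHS]mxE !second_legE.
Qed.

Lemma second_leg_sum (I : Type) (s : seq I) (F : I -> 'M[U]_N) :
  second_leg (\sum_(w <- s) F w) = \sum_(w <- s) second_leg (F w).
Proof. exact: (big_morph second_leg second_legD second_leg0). Qed.

(* the matrix of P R_VV, for the graded flip P *)
Definition braid : 'M[C]_#|{: 'I_N * 'I_N}| :=
  \matrix_(z, z') ((-1) ^+ (pp (enum_val z).1 && pp (enum_val z).2) *
    second_leg L (pk (enum_val z).2 (enum_val z).1) z').

Lemma braidE i x j y : braid (pk i x) (pk j y) =
  (-1) ^+ ((pp i && pp x) (+) ((pp i (+) pp y) && pp j)) * V (L x j) i y.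
Proof. by rewrite mxE pkE /= second_legE mulrA -signr_addb. Qed.

Let braid_mulE (M : 'M[C]_#|{: 'I_N * 'I_N}|) i x z :
  (braid *m M) (pk i x) z = (-1) ^+ (pp i && pp x) * (second_leg L *m M) (pk x i) z.
Proof.
rewrite !mxE mulr_sumr; apply: eq_bigr => z' _.
by rewrite mxE pkE /= mulrA.
Qed.

Lemma skron_flip (r s : bool) u u' i x j y : homog r u -> homog s u' ->
  (-1) ^+ (pp i && pp x) * ((-1) ^+ (r && s) * skron V V (V u') (V u) (pk x i) (pk j y)) =
  skron V V (V u) (V u') (pk i x) (pk y j) * (-1) ^+ (pp j && pp y).
Proof.
move=> hu hu'; rewrite !skronE.
have [->|n1] := eqVneq (V u i y) 0; first by rewrite !(mulr0, mul0r).
have [->|n2] := eqVneq (V u' x j) 0; first by rewrite !(mulr0, mul0r).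
rewrite -(wact_par hu n1) -(wact_par hu' n2).
by case: (pp i); case: (pp x); case: (pp j); case: (pp y); rewrite /= ?(expr0, expr1); ring.
Qed.

(** R exchanges Delta and its twist, and the graded flip exchanges them back. *)
Lemma braid_sweedler (W'' : wmodule #|{: 'I_N * 'I_N}|) a s :
  is_tensor_module V V Delta W'' -> sweedler (Delta a) s ->
  braid *m W'' a = W'' a *m braid.
Proof.
move=> hW hs; have [hhom _] := hs.
have tw := congr1 second_leg (univR_twist hR V hs).
rewrite !second_leg_gmul /act_id /act_id_twist !second_leg_sum in tw.
rewrite !(hW.2 _ _ hs).
have e1 : \sum_(w <- s) second_leg (etens (V w.1.2) w.2.2) =
    \sum_(w <- s) skron V V (V w.1.2) (V w.2.2).
  by apply: eq_bigr => w _; rewrite second_leg_etens.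
rewrite e1 in tw; apply: pk_ext => i x j y; rewrite braid_mulE tw.
rewrite mulmx_suml summxE mulr_sumr mulmx_suml summxE; apply: eq_big_seq => w hw.
have /andP [h1 h2] := hhom _ hw.
rewrite second_leg_etens [(_ *m second_leg L) _ _]mxE [RHS]mxE mulr_sumr.
rewrite !sum_pk exchange_big /=; apply: eq_bigr => u _; apply: eq_bigr => v _.
rewrite braidE second_legE.
have -> : skron V V ((-1) ^+ (w.1.1 && w.2.1) *: V w.2.2) (V w.1.2) (pk x i) (pk v u) =
    (-1) ^+ (w.1.1 && w.2.1) * skron V V (V w.2.2) (V w.1.2) (pk x i) (pk v u).
  by rewrite !skronE mxE -mulrA mulrCA.
rewrite mulrA (@skron_flip w.1.1 w.2.1 w.1.2 w.2.2 i x v u h1 h2) -[LHS]mulrA.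
congr (_ * _); rewrite [LHS]mulrA -signr_addb; congr (_ ^+ nat_of_bool _ * _).
by case: (pp u); case: (pp v); case: (pp _); case: (pp _).
Qed.

Lemma RLL i x j y :
  \sum_u \sum_v braid (pk i x) (pk u v) *:
     ((-1) ^+ ((pp v (+) pp y) && pp u) *: (L u j * L v y)) =
  \sum_u \sum_v braid (pk u v) (pk j y) *:
     ((-1) ^+ ((pp x (+) pp v) && pp i) *: (L i u * L x v)).
Proof.
have [W'' hW] := tensor_module hqpD hDelta V V.
have hg : forall u, braid *m W'' u = W'' u *m braid.
  apply: intertwine => u [] [c ->].
  - exact: (braid_sweedler hW (sweedler_ef (homog_e _ _ c) (coprod_e hDelta c))).
  - exact: (braid_sweedler hW (sweedler_ef (homog_f _ _ c) (coprod_f hDelta c))).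
  - exact: (braid_sweedler hW (sweedler_h hDelta c)).
  - exact: (braid_sweedler hW (sweedler_t hDelta c)).
have gp z z' : braid z z' != 0 -> wpar W'' z = wpar W'' z'.
  rewrite (pk_surj z) (pk_surj z'); move: (_.1) (_.2) (_.1) (_.2) => a b c d.
  rewrite braidE !(hW.1) !pkE /= mulf_eq0 signr_eq0 /= => h.
  have := wact_par (homog_L d a) h.
  by case: (pp a); case: (pp b); case: (pp c); case: (pp d).
have := univR_natural hR gp hg.
move/(congr1 (fun M : 'M_#|{: 'I_N * 'I_N}| => M (pk i x) (pk j y))).
rewrite /= [LHS]mxE [RHS]mxE !sum_pk => e.
transitivity (\sum_u \sum_v map_mx (in_alg U) braid (pk i x) (pk u v) * cR W'' (pk u v) (pk j y)).
  apply: eq_bigr => u _; apply: eq_bigr => v _.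
  by rewrite (legs_entry hR hW) [map_mx _ _ _ _]mxE /= mulr_algl.
rewrite e; apply: eq_bigr => u _; apply: eq_bigr => v _.
by rewrite (legs_entry hR hW) [map_mx _ _ _ _]mxE /= mulr_algr.
Qed.

Lemma ee_pair a c u v : c != a -> c != ib a -> ee a + ee c = ee u + ee v ->
  (u = a /\ v = c) \/ (u = c /\ v = a).
Proof.
move=> h1 h2 e; have n1 : lab c != lab a by rewrite (inj_eq (@lab_inj m k)).
have n2 : lab c != ibar (lab a) by rewrite -lab_ib (inj_eq (@lab_inj m k)).
by case: (eps_pair hm hk (lab_in a) (lab_in c) (lab_in u) (lab_in v) n1 n2 e)
  => -[/lab_inj -> /lab_inj ->]; [left|right].
Qed.

Lemma ee_orth a c : c != a -> c != ib a -> wform (ee a) (ee c) = 0.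
Proof.
move=> h1 h2; apply: wform_eps0; rewrite ?lab_in ?(inj_eq (@lab_inj m k)) //.
by rewrite -lab_ib (inj_eq (@lab_inj m k)).
Qed.

Lemma V_L_weight x u i v : V (L x u) i v != 0 -> ee x + ee i = ee u + ee v.
Proof.
move/(V_weight (fun y => L_weight y x u)) => ->.
by rewrite addrC -addrA subrK addrC.
Qed.

Lemma V_L_diag a c : c != a -> c != ib a -> V (L a a) c c = 1.
Proof.
move=> h1 h2; rewrite L_diag V_t eqxx mulr1n.
by rewrite ee_orth // (qp0 hq0 hqp1 hqpD).
Qed.

Lemma signed_solve (e1 e2 e3 : bool) (r : C) (X Y Z : U) :
  (-1) ^+ e1 *: Y + ((-1) ^+ e2 * r) *: X = (-1) ^+ e3 *: Z ->
  r *: X = (-1) ^+ (e2 (+) e3) *: Z - (-1) ^+ (e1 (+) e2) *: Y.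
Proof.
move/(congr1 (fun z => (-1) ^+ e2 *: z)); rewrite scalerDr !scalerA mulrA -!signr_addb addbb mul1r.
by move <-; rewrite [X in _ = X - _]addrC [e1 (+) e2]addbC addrK.
Qed.

(* In the entry ((c, a), (c, b)) of RLL, weights leave two terms on each side, one of
   which vanishes because L is triangular. *)
Lemma L_exchange a c b : wlt m k (lab a) (lab c) -> wlt m k (lab c) (lab b) ->
  c != ib a -> c != ib b ->
  V (L a c) c a *: (L c c * L a b) = L c b * L a c -
    (-1) ^+ ((pp b (+) pp c) && (pp a (+) pp c)) *: (L a c * L c b).
Proof.
move=> ac cb na nb.
have nca : c != a by apply: contraTneq ac => ->; rewrite /wlt ltnn.
have ncb : c != b by apply: contraTneq cb => ->; rewrite /wlt ltnn.
have L0 : L b c = 0.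
  apply/eqP/negP => /negP /(L_triang).
  by case=> [e|]; [rewrite e eqxx in ncb | move: cb; rewrite /wlt; lia].
have := RLL c a c b.
rewrite (bigD1 a) //= (bigD1 c) //= [X in _ + X + _]big1 ?addr0; last first.
  move=> v hv; rewrite braidE; case: (eqVneq (V (L a a) c v) 0) => [->|].
    by rewrite mulr0 scale0r.
  by move/V_L_weight/(ee_pair nca na) => [[_ e]|[e _]]; rewrite e eqxx in hv nca.
rewrite (bigD1 c) //= (bigD1 a) //= [X in _ + (_ + X + _)]big1 ?addr0; last first.
  move=> v hv; rewrite braidE; case: (eqVneq (V (L a c) c v) 0) => [->|].
    by rewrite mulr0 scale0r.
  by move/V_L_weight/(ee_pair nca na) => [[e _]|[_ e]]; rewrite ?e eqxx in hv nca.
rewrite [X in _ + (_ + X)]big1 ?addr0; last first.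
  move=> u /andP [h1 h2]; apply: big1 => v _; rewrite braidE.
  case: (eqVneq (V (L a u) c v) 0) => [->|]; first by rewrite mulr0 scale0r.
  by move/V_L_weight/(ee_pair nca na) => [[e _]|[e _]]; rewrite e eqxx in h1 h2.
rewrite [X in _ = X](bigD1 b) //= [X in _ = X + _](bigD1 c) //=.
rewrite [X in _ = _ + X + _]big1 ?addr0; last first.
  move=> v hv; rewrite braidE; case: (eqVneq (V (L v c) b b) 0) => [->|].
    by rewrite mulr0 scale0r.
  move/V_L_weight; rewrite [_ + ee b]addrC [ee c + _]addrC => /addrI /ee_inj e.
  by rewrite e eqxx in hv.
rewrite [X in _ = _ + X]big1 ?addr0; last first.
  move=> u hu; apply: big1 => v _; rewrite braidE.
  case: (eqVneq (V (L v c) u b) 0) => [->|]; first by rewrite mulr0 scale0r.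
  move=> h; have := h; move/V_L_weight; rewrite [_ + ee b]addrC [ee v + _]addrC => /esym.
  move/(ee_pair ncb nb) => [[e1 _]|[e1 e2]]; first by rewrite e1 eqxx in hu.
  by rewrite e1 e2 L0 wact0 mxE eqxx in h.
rewrite !braidE (V_L_diag nca na) V_L_diag // 1?eq_sym //; last first.
  by rewrite -(inj_eq (can_inj ibK)) ibK.
move: (V _ c a) (L c c * _) (L a c * _) (L c b * _) => r X Y Z.
rewrite !scalerA => e; move: e.
have -> : (-1) ^+ ((pp c && pp a) (+) ((pp c (+) pp c) && pp a)) * 1 * (-1) ^+ ((pp c (+) pp b) && pp a) =
    (-1) ^+ (pp a && pp b) :> C.
  by rewrite mulr1 -signr_addb; case: (pp a); case: (pp b); case: (pp c).
have -> : (-1) ^+ ((pp c && pp a) (+) ((pp c (+) pp a) && pp c)) * r * (-1) ^+ ((pp a (+) pp b) && pp c) =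
    (-1) ^+ (pp c (+) ((pp a (+) pp b) && pp c)) * r :> C.
  rewrite mulrAC -signr_addb; congr (_ ^+ nat_of_bool _ * _).
  by case: (pp a); case: (pp b); case: (pp c).
have -> : (-1) ^+ ((pp b && pp c) (+) ((pp b (+) pp b) && pp c)) * 1 * (-1) ^+ ((pp a (+) pp c) && pp c) =
    (-1) ^+ (pp c (+) ((pp a (+) pp b) && pp c)) :> C.
  by rewrite mulr1 -signr_addb; congr (_ ^+ nat_of_bool _); case: (pp a); case: (pp b); case: (pp c).
move/signed_solve => ->; rewrite addbb scale1r.
by congr (_ - _ ^+ nat_of_bool _ *: _); case: (pp a); case: (pp b); case: (pp c).
Qed.

Lemma V_Ut_mul x u i j : V (Ut x * u) i j = qp (wform x (ee i)) * V u i j.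
Proof.
rewrite wactM mxE (bigD1 i) //= V_t eqxx mulr1n big1 ?addr0 // => z hz.
by rewrite V_t eq_sym (negPf hz) mul0r.
Qed.

Lemma V_L_edge (c : sroot m k) i j : edge c (lab j) (lab i) -> j != i -> j != ib i ->
  V (L i j) j i = (-1) ^+ pp j * (q - q^-1).
Proof.
move=> hc n1 n2; rewrite (L_edge hc) wactZ mxE V_Ut_mul.
have [_ e] := edge_entries hc.
rewrite wformDl ee_orth // add0r pp_lab -e.
rewrite [qp (wform _ _) * _]mulrC mulrA -!mulrA [qp (- _) * _]mulrCA [qp (- _) * _](qpNM hq0 hqp1 hqpD).
by rewrite mulr1 mulrC -mulrA.
Qed.

(* Taking the entry (b, a) of [L_exchange] in V shows that this constant is the same
   for (a, b) and (c, b), which reduces it to the simple roots. *)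
Lemma V_L_antidiag a b : wlt m k (lab a) (lab b) -> b != ib a ->
  V (L a b) b a = (-1) ^+ pp b * (q - q^-1).
Proof.
have [d] := ubnP (position (lab a) - position (lab b)).
elim: d a b => [//|d IH] a b hd ab nab.
have nba : b != a by apply: contraTneq ab => ->; rewrite /wlt ltnn.
have nab' : lab b != ibar (lab a) by rewrite -lab_ib (inj_eq (@lab_inj m k)).
have [[c hc]|[c' hc' [ac cb na nb]]] := edge_or_between hm hk (lab_in a) (lab_in b) ab nab'.
  exact: V_L_edge hc _ _.
have [c ec] : exists c, c' = lab c by exists (ix c'); rewrite ixK.
move: ac cb na nb; rewrite {c' hc'}ec.
rewrite -!lab_ib !(inj_eq (@lab_inj m k)) => ac cb na nb.
have nca : c != a by apply: contraTneq ac => ->; rewrite /wlt ltnn.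
have ncb : c != b by apply: contraTneq cb => ->; rewrite /wlt ltnn.
have rac : V (L a c) c a = (-1) ^+ pp c * (q - q^-1).
  by apply: IH => //; move: ac cb hd; rewrite /wlt; lia.
have rcb : V (L c b) b c = (-1) ^+ pp b * (q - q^-1).
  apply: IH; [by move: ac cb hd; rewrite /wlt; lia|by []|].
  by rewrite -(inj_eq (can_inj ibK)) ibK eq_sym.
have := congr1 (fun u => V u b a)
  (L_exchange ac cb na nb).
rewrite /= wactZ mxE L_diag V_Ut_mul ee_orth //; last 2 first.
- by rewrite eq_sym.
- by rewrite -(inj_eq (can_inj ibK)) ibK eq_sym.
rewrite (qp0 hq0 hqp1 hqpD) mul1r wactB mxE wactM mxE (bigD1 c) //= big1 ?addr0; last first.
  move=> z hz; have [->|] := eqVneq (V (L a c) z a) 0; first by rewrite mulr0.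
  by move/V_L_weight; rewrite addrC => /addIr /ee_inj e; rewrite e eqxx in hz.
rewrite mxE wactZ mxE wactM mxE big1 ?mulr0 ?subr0; last first.
  move=> z _; have [->|] := eqVneq (V (L a c) b z) 0; first by rewrite mul0r.
  move/V_L_weight/(ee_pair nba nab) => [[e _]|[e _]]; first by rewrite e eqxx in nca.
  by rewrite e eqxx in ncb.
(* What is left is r_ac r_ab = r_cb r_ac, and r_ac is nonzero because q^2 is not 1. *)
rewrite rcb mulrC; apply: mulIf.
by rewrite rac mulf_neq0 ?signr_eq0 // (q_sub_neq0 hq0 hq).
Qed.

(** * The operators sigma *)

Let kap := q - q^-1.
Let kap0 : kap != 0. Proof. exact: q_sub_neq0 hq0 hq. Qed.

(** Solved from the second expression for R: the index a is the row and b the column of the entry of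
    L. *)
Definition lax_sigma (b a : idx) : U :=
  (kap * (-1) ^+ b.1)^-1 *: (Ut (- eps a) * L (ix a) (ix b)).
Local Notation sg := lax_sigma.

Let kap_sign0 (b : bool) : kap * (-1) ^+ b != 0.
Proof. by rewrite mulf_neq0 // signr_eq0. Qed.

Lemma L_sigma a b : L (ix a) (ix b) = (kap * (-1) ^+ b.1) *: (Ut (eps a) * sg b a).
Proof.
by rewrite /lax_sigma -scalerAr scalerA mulfV ?kap_sign0 // scale1r mulrA UtMN mul1r.
Qed.

Lemma cartan_partE i j : cartan_part V i j = Ut (ee i) *+ (i == j).
Proof.
rewrite /cartan_part !mxE -[in RHS](cartan_expansion (ee i)).
congr (Ut _ *+ _); apply: eq_bigr => a _.
by rewrite V_h eqxx mulr1n.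
Qed.

Lemma sum_indices (P : pred idx) (F : idx -> U) (z : idx) : z \in indices ->
  \sum_(a <- indices | P a) (z == a)%:R *: F a = if P z then F z else 0.
Proof.
move=> hz; rewrite big_mkcond (bigD1_seq z) ?uniq_indices //= big1 ?addr0 => [|a na].
  by rewrite eqxx scale1r.
by rewrite eq_sym (negPf na) scale0r; case: ifP.
Qed.

Lemma sum_EopE (c : idx -> C) (G : idx -> idx -> U) i j :
  (\sum_(b <- indices) \sum_(a <- indices | wlt m k a b)
     etens (c b *: Eop R m k a b) (G b a)) i j =
  if wlt m k (lab i) (lab j) then c (lab j) *: G (lab j) (lab i) else 0.
Proof.
rewrite summxE.
transitivity (\sum_(b <- indices) (lab j == b)%:R *:
    (if wlt m k (lab i) b then c b *: G b (lab i) else 0)).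
  apply: eq_bigr => b _; rewrite summxE.
  rewrite -(sum_indices (fun a => wlt m k a b) (fun a => c b *: G b a) (lab_in i)) scaler_sumr.
  apply: eq_bigr => a _; rewrite !mxE !scalerA; congr (_ *: _).
  by case: (_ == a); case: (_ == b); rewrite /= ?(mulr0, mulr1, mul0r, mul1r).
by rewrite (sum_indices xpredT _ (lab_in j)).
Qed.

Lemma sum_diagE i j :
  (\sum_(a <- indices) etens (Eop R m k a a) (Ut (eps a))) i j = Ut (ee i) *+ (i == j).
Proof.
rewrite summxE (eq_bigr (fun a => (lab i == a)%:R *: (Ut (eps a) *+ (i == j)))).
  by rewrite (sum_indices xpredT _ (lab_in i)).
move=> a _; rewrite !mxE; case: (eqVneq i j) => [->|nij].
  by rewrite andbb mulr1n.
case: (eqVneq (lab i) a) => [<-|_]; last by rewrite !scale0r.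
by rewrite eq_sym (inj_eq (@lab_inj m k)) (negPf nij) scale0r scale1r.
Qed.

Lemma lax_formula : L =
  \sum_(a <- indices) etens (Eop R m k a a) (Ut (eps a)) +
  \sum_(b <- indices) \sum_(a <- indices | wlt m k a b)
     etens ((kap * (-1) ^+ b.1) *: Eop R m k a b) (Ut (eps a) * sg b a).
Proof.
apply/matrixP => i j; rewrite mxE sum_EopE.
rewrite sum_diagE.
case: (eqVneq i j) => [->|nij]; first by rewrite /wlt ltnn addr0 L_diag.
rewrite add0r; case: ifP => h; first by rewrite -L_sigma !labK.
apply/eqP/negP => /negP /(L_triang).
by rewrite h; case => // e; rewrite e eqxx in nij.
Qed.

Lemma lax_factored : L = gmul pp (cartan_part V)
  (1%:M + \sum_(b <- indices) \sum_(a <- indices | wlt m k a b)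
     etens ((kap * (-1) ^+ b.1) *: Eop R m k a b) (sg b a)).
Proof.
rewrite {1}lax_formula; apply/matrixP => i j; rewrite !mxE sum_EopE.
rewrite (bigD1 i) //= [X in _ = _ + X]big1 ?addr0 => [|x hx]; last first.
  rewrite cartan_partE eq_sym (negPf hx) mulr0n.
  by case: ifP => _; rewrite ?rmorph0 mul0r.
have -> : (if pp i (+) pp j then grad (cartan_part V i i) else cartan_part V i i) = Ut (ee i).
  by rewrite cartan_partE eqxx mulr1n; case: ifP => _; rewrite ?grad_t.
rewrite sum_diagE [X in _ = _ * X]mxE [X in _ * (X + _)]mxE sum_EopE mulrDr mulrnAr mulr1.
congr (_ + _); case: ifP => _; last by rewrite mulr0.
by rewrite scalerAr.
Qed.

(** The sums in [twist_e] run over basis vectors of weight eps_b + alpha_c and eps_a - alpha_c, so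
    the hypothesis empties both. The powers of q collect what arises when q^(-eps_a) and
    q^(alpha_c/2) are moved past e_c and L_ab. *)
Lemma sigma_commute a b c : a \in indices -> b \in indices ->
  (forall x, x \in indices -> eps a - alpha c <> eps x /\ eps b + alpha c <> eps x) ->
  qp (wform (alpha c) (eps b)) *: (sg b a * UE c)
  - ((-1) ^+ ((a.1 (+) b.1) && spar c) * qp (- wform (alpha c) (eps a))) *: (UE c * sg b a) = 0.
Proof.
move=> ha hb hx; have ea : ee (ix a) = eps a by rewrite /lab_weight ixK.
have eb : ee (ix b) = eps b by rewrite /lab_weight ixK.
pose w := 2^-1 *: alpha c; pose X := L (ix a) (ix b).
pose s : C := (-1) ^+ ((a.1 (+) b.1) && spar c).
have ww : w + w = alpha c by rewrite -scalerDl -div1r -splitr scale1r.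
have e1 : qp (wform w (eps b)) *: (X * Ue c) =
    (s * qp (- wform w (eps a))) *: (Ue c * X).
  have := twist_e c (ix a) (ix b).
  rewrite big1 ?addr0 => [|x _]; last first.
    have [->|n0] := eqVneq (V (Ue c) x (ix b)) 0; first by rewrite mulr0 scale0r.
    have [_ []] := hx _ (lab_in x).
    by rewrite -[RHS]/(ee x) (Ve_weight n0) eb.
  rewrite big1 ?add0r => [|x _]; last first.
    have [->|n0] := eqVneq (V (Ue c) (ix a) x) 0; first by rewrite scale0r.
    have [[]] := hx _ (lab_in x).
    by rewrite -ea (Ve_weight n0) addrK.
  by rewrite ea eb !pp_lab !ixK // /s andbC.
have sE : s * s = 1 by rewrite -signr_addb addbb.
have e2 : Ue c * X = (s * qp (wform w (eps a)) * qp (wform w (eps b))) *: (X * Ue c).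
  rewrite -scalerA e1 scalerA -[LHS]scale1r; congr (_ *: _).
  by rewrite mulrACA sE mul1r -hqpD subrr (qp0 hq0 hqp1 hqpD).
have e3 : Ut w * X = qp (wform w (eps b) - wform w (eps a)) *: (X * Ut w).
  by rewrite /X L_Ut ea eb wformBr.
rewrite /lax_sigma -/X -/s /Defs.UE -/w -![(_ *: _) * _]scalerAl -[_ * (_ *: _)]scalerAr.
have -> : Ue c * Ut w * (Ut (- eps a) * X) =
  (s * qp (wform (eps a) (alpha c)) * qp (wform (alpha c) (eps b))) *: (Ut (- eps a) * X * (Ue c * Ut w)).
  rewrite [LHS]mulrA -[Ue c * Ut w * _]mulrA -UtD [w + _]addrC e_Ut // UtD -[(_ *: _) * X]scalerAl.
  rewrite -[_ * Ue c * X]mulrA e2 -[_ * (_ *: _)]scalerAr -!mulrA [Ut w * (X * _)]mulrA e3.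
  rewrite -[(_ *: _) * Ue c]scalerAl -[Ut (- eps a) * (_ *: _)]scalerAr -[X * Ut w * _]mulrA.
  rewrite Ut_e -[X * (_ *: _)]scalerAr -[Ut (- eps a) * (_ *: _)]scalerAr !scalerA.
  congr (_ *: _); have reorder (x1 x2 x3 x4 x5 : C) :
      x1 * (s * (x2 * x3) * x4 * x5) = s * (x1 * x2 * x3 * x4 * x5) by ring.
  rewrite reorder -!hqpD; congr (s * qp _).
  rewrite (wformDl (- eps a) w (alpha c)) wformNl -[X in _ = _ + wform X _]ww (wformDl w w (eps b)).
  move: (wform _ _) (wform _ _) (wform _ _) (wform _ _) => x1 x2 x3 x4; ring.
rewrite !scalerA -scalerBl; apply/eqP; rewrite scaler_eq0 subr_eq0; apply/orP; left; apply/eqP.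
have qN : qp (- wform (alpha c) (eps a)) * qp (wform (eps a) (alpha c)) = 1.
  by rewrite [wform (eps a) _]wformC (qpNM hq0 hqp1 hqpD).
clear e1 e2 e3 hx; move: qN sE; clearbody s; move: (qp _) (qp _) (qp _) (_^-1) => x1 x2 x3 x4 h1 h2.
ring: h1 h2.
Qed.

Lemma sigma_Ut y a b : a \in indices -> b \in indices ->
  sg b a * Ut y = qp (- wform y (eps b - eps a)) *: (Ut y * sg b a).
Proof.
move=> ha hb.
have e : Ut y * sg b a = qp (wform y (eps b - eps a)) *: (sg b a * Ut y).
  rewrite /lax_sigma -[Ut y * (_ *: _)]scalerAr -[(_ *: _) * Ut y]scalerAl mulrA -UtD addrC UtD -mulrA.
  rewrite (L_Ut y) /lab_weight !ixK // -[Ut _ * (_ *: _)]scalerAr !scalerA mulrA.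
  by congr (_ *: _); rewrite mulrC.
by rewrite e scalerA (qpNM hq0 hqp1 hqpD) scale1r.
Qed.

(** In [L_exchange] the scalar r_ac supplies the factor q - q^(-1) and the sign of c, so both sides
    carry the same normalisation. The powers of q come from moving the Cartan factor of one sigma
    past the other. *)
Lemma sigma_recursion a b c : a \in indices -> b \in indices -> c \in indices ->
  wlt m k c b -> wlt m k a c -> c <> ibar b -> c <> ibar a ->
  sg b a = qp (- wform (eps b) (eps a)) *: (sg b c * sg c a)
    - (qp (- wform (eps c) (eps c)) * (-1) ^+ ((b.1 (+) c.1) && (a.1 (+) c.1))) *:
      (sg c a * sg b c).
Proof.
move=> ha hb hc cb ac nb na.
have nib x : x \in indices -> c <> ibar x -> ix c != ib (ix x).
  move=> hx; apply: contra_notN => /eqP e.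
  by rewrite -(ixK hm0 hc) e lab_ib ixK.
have nca : c != a by apply: contraTneq ac => ->; rewrite /wlt ltnn.
have := @L_exchange (ix a) (ix c) (ix b).
rewrite !ixK // => /(_ ac cb (nib a ha na) (nib b hb nb)).
rewrite V_L_antidiag ?ixK ?nib // L_diag /lab_weight ixK // !pp_lab !ixK //.
rewrite !L_sigma -/kap.
set s := (-1) ^+ (_ && _).
have ac0 : wform (eps a) (eps c) = 0.
  by apply: wform_eps0 => //; apply/eqP.
have f1 : Ut (eps c) * sg b c * (Ut (eps a) * sg c a) =
    qp (- wform (eps b) (eps a)) *: (Ut (eps c) * Ut (eps a) * (sg b c * sg c a)).
  rewrite -mulrA [sg b c * (_ * _)]mulrA sigma_Ut // wformBr ac0 subr0 [wform (eps a) _]wformC.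
  by rewrite -scalerAl -scalerAr !mulrA.
have f2 : Ut (eps a) * sg c a * (Ut (eps c) * sg b c) =
    qp (- wform (eps c) (eps c)) *: (Ut (eps c) * Ut (eps a) * (sg c a * sg b c)).
  rewrite -mulrA [sg c a * (_ * _)]mulrA sigma_Ut // wformBr [wform (eps c) (eps a)]wformC ac0 subr0.
  by rewrite -scalerAl -scalerAr !mulrA -!UtD [eps a + _]addrC.
move: f1 f2; move: (sg b c) (sg c a) (sg b a) => x y t f1 f2.
rewrite -[Ut (eps c) * (_ *: _)]scalerAr -!scalerAl -!scalerAr f1 f2 !scalerA [Ut (eps c) * (Ut _ * t)]mulrA.
set z := kap * (-1) ^+ b.1 * (kap * (-1) ^+ c.1).
have -> : (-1) ^+ c.1 * kap * (kap * (-1) ^+ b.1) = z by rewrite /z; ring.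
have -> : s * (kap * (-1) ^+ c.1) * (kap * (-1) ^+ b.1) * qp (- wform (eps c) (eps c)) =
    z * (qp (- wform (eps c) (eps c)) * s).
  by rewrite /z; move: (qp _) => u; ring.
rewrite -[(z * (_ * s)) *: _]scalerA -[(z * _) *: _]scalerA -scalerBr.
have z0 : z != 0 by rewrite mulf_neq0 ?kap_sign0.
move/(scalerI z0); rewrite !scalerAr -mulrBr -UtD.
exact: Ut_inj.
Qed.

(** * Initial values *)

Lemma sigma_edge (c : sroot m k) b a : edge c b a -> sg b a =
  ((-1) ^+ b.1 * V (Uf c) (ix a) (ix b) * qp (- wform (2^-1 *: alpha c) (eps a))) *: UE c.
Proof.
move=> hc; have [hb ha] := edge_in hm hk hc.
have hc' : edge c (lab (ix b)) (lab (ix a)) by rewrite !ixK.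
rewrite /lax_sigma (L_edge hc') /lab_weight !ixK // -/kap.
rewrite (edge_alpha R hm hk hc); set w := 2^-1 *: alpha c.
rewrite -[Ut _ * (_ *: _)]scalerAr scalerA [Ut (- eps a) * _]mulrA -UtD addKr Ut_e scalerA.
congr (_ *: _).
rewrite (wformDr (eps a) (alpha c) w) opprD (hqpD _ (- wform w (alpha c))).
have := qpNM hq0 hqp1 hqpD (wform w (alpha c)).
move: (qp (- wform w (eps a))) (qp (- wform w (alpha c))) (qp (wform w (alpha c))) (V _ _ _) => x3 x1 x2 x4 h.
have s2 : ((-1) ^+ b.1)^-1 = (-1) ^+ b.1 :> C by rewrite invr_sign.
rewrite invfM s2; transitivity (kap^-1 * kap * ((-1) ^+ b.1 * x4 * x3) * (x1 * x2)); first by ring.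
by rewrite mulVf // h mulr1 mul1r.
Qed.

Lemma V_edge_top (c : sroot m k) :
  V (Uf c) (ix (root_bot c)) (ix (root_top c)) = (-1) ^+ (root_top c).1.
Proof.
have hb := bot_in hm hk c; have ht := top_in hm hk c.
rewrite Vf_entry !ixK // !eqxx.
have -> : (root_bot c == ibar (root_top c)) = false.
  by rewrite eq_sym ibar_eq //; apply/negbTE/(top_neq_ibar_bot hm hk).
by rewrite mulr0 subr0 mulr1.
Qed.

Lemma V_edge_bar (c : sroot m k) : V (Uf c) (ix (ibar (root_top c))) (ix (ibar (root_bot c))) =
  - ((-1) ^+ (root_top c).1 * Sig_sign R (root_bot c) (root_top c)).
Proof.
have hb := bot_in hm hk c; have ht := top_in hm hk c.
rewrite Vf_entry !ixK ?ibar_in // !eqxx [ibar (root_top c) == _]ibar_eq //.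
by rewrite (negPf (top_neq_ibar_bot hm hk c)) mulr1 sub0r mulrN.
Qed.

Let half_sq x y : wform (eps x) (eps y) = 0 ->
  wform (2^-1 *: (eps x - eps y)) (eps x) = 2^-1 * wform (eps x) (eps x) /\
  wform (2^-1 *: (eps x - eps y)) (eps y) = - (2^-1 * wform (eps y) (eps y)).
Proof.
by move=> e; rewrite !wformZl !wformBl [wform (eps y) (eps x)]wformC e subr0 sub0r mulrN.
Qed.

(** The exponent (eps_bot, eps_bot)/2 is 1/2, 0 or -1/2 according as the lower index is even,
    self-dual or odd; this is the origin of the half powers of q in the initial values. On dual
    edges the upper index takes its place. *)
Lemma sigma_edge_top (c : sroot m k) : sg (root_top c) (root_bot c) =
  qp (2^-1 * wform (eps (root_bot c)) (eps (root_bot c))) *: UE c.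
Proof.
have hb := bot_in hm hk c; have ht := top_in hm hk c.
rewrite (@sigma_edge c); last by left.
rewrite V_edge_top -signr_addb addbb mul1r {1}(alphaE R hm hk c).
by have [_ ->] := half_sq (wform_topbot R hm hk c); rewrite opprK.
Qed.

Lemma sigma_edge_bar (c : sroot m k) : sg (ibar (root_bot c)) (ibar (root_top c)) =
  - (((-1) ^+ ((root_bot c).1 (+) (root_top c).1) * Sig_sign R (root_bot c) (root_top c) *
      qp (2^-1 * wform (eps (root_top c)) (eps (root_top c)))) *: UE c).
Proof.
have hb := bot_in hm hk c; have ht := top_in hm hk c.
rewrite (@sigma_edge c); last by right.
rewrite V_edge_bar eps_bar // wformNr opprK {1}(alphaE R hm hk c).
have [-> _] := half_sq (wform_topbot R hm hk c).
rewrite -[RHS]scaleNr; congr (_ *: _); rewrite signr_addb /=.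
by move: (qp _) (Sig_sign _ _ _) => x y; ring.
Qed.

(** The weight 2 eps_l has height 0, as [ht_fun] vanishes at l, so it is not a nonempty sum of
    simple roots and the corresponding entry of L is 0. *)
Lemma sigma_mid0 (i : 'I_(m./2)) : i.+1 = m./2 -> ~~ odd m ->
  sg (ev i.+1) (ibar (ev i.+1)) = 0.
Proof.
move=> hi ho.
have hl : ev i.+1 \in indices by rewrite mem_indices /=; lia.
rewrite /lax_sigma; suff -> : L (ix (ibar (ev i.+1))) (ix (ev i.+1)) = 0 by rewrite mulr0 scaler0.
apply/eqP/negP => /negP /(L_neq0) [w].
rewrite /lab_weight !ixK ?ibar_in // => e.
have h0 : wform (cw m k (ht_fun R m k)) (eps (ev i.+1)) = 0.
  rewrite wform_cw //; last exact: ht_antisym.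
  rewrite /ht_fun (negPf ho) /Defs.position /= ifT; last by rewrite hi.
  by rewrite hi subrr.
have := congr1 (wform (cw m k (ht_fun R m k))) e.
rewrite wformDr eps_bar // wformNr h0 oppr0 add0r (ht_wt R hm hk) => /esym/eqP.
rewrite pnatr_eq0 => /eqP /size0nil w0; move: e; rewrite w0 /root_sum big_nil addr0.
move/(eps_inj hm hk hl (ibar_in hl)) => /(congr1 snd); rewrite /Defs.ibar /=; lia.
Qed.

Let eps_sq x : x \in indices -> x != ibar x -> wform (eps x) (eps x) = (-1) ^+ x.1.
Proof. by move=> hx /negPf nx; rewrite wform_eps // eqxx nx subr0 mulr1. Qed.

Let ev_sq i : (0 < i <= m)%N -> (2 * i != m + 1)%N -> wform (eps (ev i)) (eps (ev i)) = 1.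
Proof.
move=> hi h2; rewrite eps_sq ?mem_indices //.
by apply: contra_neq h2 => /(congr1 snd); rewrite /Defs.ibar /=; lia.
Qed.

Let od_sq i : (0 < i <= 2 * k)%N -> wform (eps (od i)) (eps (od i)) = -1.
Proof.
move=> hi; rewrite eps_sq ?mem_indices //.
by apply/eqP => /(congr1 snd); rewrite /Defs.ibar /=; lia.
Qed.

Lemma sigma_even (i : 'I_(m./2)) : (i.+1 < m./2)%N ->
  sg (ev i.+1) (ev i.+2) = qp 2^-1 *: UE (sE k i) /\
  - sg (ibar (ev i.+2)) (ibar (ev i.+1)) = qp 2^-1 *: UE (sE k i).
Proof.
move=> hi; have := sigma_edge_top (sE k i); have := sigma_edge_bar (sE k i).
rewrite /root_top /root_bot hi orTb (ev_sq (i := i.+1)) 1?(ev_sq (i := i.+2)); [|lia..].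
by rewrite /Sig_sign /= !expr0 !mul1r mulr1 => -> ->; rewrite opprK.
Qed.

Lemma sigma_even_last (i : 'I_(m./2)) : i.+1 = m./2 -> ~~ odd m ->
  sg (ev i) (ibar (ev i.+1)) = qp 2^-1 *: UE (sE k i) /\
  - sg (ev i.+1) (ibar (ev i)) = qp 2^-1 *: UE (sE k i).
Proof.
move=> hi ho; have := sigma_edge_top (sE k i); have := sigma_edge_bar (sE k i).
have e : (i.+1 < m./2)%N = false by rewrite hi ltnn.
rewrite /root_top /root_bot e (negPf ho) orbF.
have -> : ev i.+2 = ibar (ev i.+1) by rewrite /Defs.ibar /ev /=; congr (_, _); lia.
rewrite ibarK; last by rewrite mem_indices /=; lia.
rewrite (ev_sq (i := i)); [|lia..].
rewrite eps_bar ?wformNl ?wformNr ?opprK ?(ev_sq (i := i.+1)) ?mem_indices /=; [|lia..].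
by rewrite /Sig_sign /= !expr0 !mul1r mulr1 => -> ->; rewrite opprK.
Qed.

Lemma sigma_odd_last (i : 'I_(m./2)) : i.+1 = m./2 -> odd m ->
  sg (ev i.+1) (ev i.+2) = UE (sE k i) /\
  - (qp (- 2^-1) *: sg (ev i.+2) (ibar (ev i.+1))) = UE (sE k i).
Proof.
move=> hi ho; have := sigma_edge_top (sE k i); have := sigma_edge_bar (sE k i).
have e0 : (i.+1 < m./2)%N = false by rewrite hi ltnn.
rewrite /root_top /root_bot e0 ho orbT.
have e : ibar (ev i.+2) = ev i.+2 by rewrite /Defs.ibar /ev /=; congr (_, _); lia.
have h2 : ev i.+2 \in indices by rewrite mem_indices /=; lia.
rewrite e (ev_sq (i := i.+1)); [|lia..].
rewrite wform_eps // e subrr mulr0 mulr0 (qp0 hq0 hqp1 hqpD) scale1r.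
rewrite /Sig_sign /= !expr0 !mul1r mulr1 => -> ->; split=> //.
by rewrite scalerN opprK scalerA (qpNM hq0 hqp1 hqpD) scale1r.
Qed.

Lemma sigma_odd (mu : 'I_k.-1) :
  sg (od mu.+1) (od mu.+2) = qp (- 2^-1) *: UE (sO m mu) /\
  sg (ibar (od mu.+2)) (ibar (od mu.+1)) = qp (- 2^-1) *: UE (sO m mu).
Proof.
have hmu := ltn_ord mu.
have := sigma_edge_top (sO m mu); have := sigma_edge_bar (sO m mu).
rewrite /root_top /root_bot !od_sq; [|lia..].
rewrite /Sig_sign /xi /= !expr0 !mul1r mulrN1 => -> ->; split=> //.
rewrite -scaleNr; congr (_ *: _).
rewrite -exprD; have -> : (mu.+2 + mu.+1 = 2 * mu.+1 + 1)%N by lia.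
by rewrite exprD exprM sqrrN !expr1n expr1 mul1r mulN1r opprK.
Qed.

Lemma sigma_super :
  sg (od k) (ev 1) = qp 2^-1 *: UE (sS m k) /\
  ((-1) ^+ k * q) *: sg (ibar (ev 1)) (ibar (od k)) = qp 2^-1 *: UE (sS m k).
Proof.
have := sigma_edge_top (sS m k); have := sigma_edge_bar (sS m k).
rewrite /root_top /root_bot od_sq ?ev_sq; [|lia..].
rewrite /Sig_sign /xi /= !expr0 expr1 !mul1r mulr1 mulrN1 => -> ->; split=> //.
rewrite -scaleNr scalerA; congr (_ *: _).
have s2 : (-1) ^+ k * (-1) ^+ k = 1 :> C by rewrite -exprD addnn -muln2 mulnC exprM sqrrN !expr1n.
(* The dual edge carries q^(-1/2), from (delta_k, delta_k) = -1, and the sign of xi at the odd index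
   k; the factor (-1)^k q corrects both. *)
have -> : qp 2^-1 = q * qp (- 2^-1).
  by rewrite -hqp1 -hqpD; congr qp; rewrite {2}(splitr 1) div1r addrK.
by move: (qp _) s2; move: ((-1) ^+ k) => s x s2; ring: s2.
Qed.

End LaxOperator.

Theorem theorem4p3p1 (R : realType) (m k : nat) (q : R[i]) (qp : R[i] -> R[i])
  (hm : (2 < m)%N) (hk : (0 < k)%N)
  (hq0 : q != 0) (hq : forall j : nat, (0 < j)%N -> q ^+ j != 1)
  (hqp1 : qp 1 = q) (hqpD : forall x y : R[i], qp (x + y) = qp x * qp y)
  (Delta : {lrmorphism Uq m k q qp -> UU m k q qp}) (hDelta : is_coproduct Delta)
  (V : wmodule m k q qp (m + 2 * k)) (hV : is_vector_rep V)
  (cR : forall d : nat, wmodule m k q qp d -> 'M[Uq m k q qp]_d)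
  (hR : is_universal_R Delta cR) :
  exists sigma : idx -> idx -> Uq m k q qp,
    (cR _ V =
       gmul (wpar V) (cartan_part V)
         (1%:M + \sum_(b <- indices m k) \sum_(a <- indices m k | wlt m k a b)
            etens (((q - q^-1) * (-1) ^+ b.1) *: Eop R m k a b) (sigma b a))) /\
    (cR _ V =
       \sum_(a <- indices m k) etens (Eop R m k a a) (Ut q qp (eps R m k a)) +
       \sum_(b <- indices m k) \sum_(a <- indices m k | wlt m k a b)
          etens (((q - q^-1) * (-1) ^+ b.1) *: Eop R m k a b)
                (Ut q qp (eps R m k a) * sigma b a)) /\
    (forall a b : idx, a \in indices m k -> b \in indices m k -> wlt m k a b ->
       forall c : sroot m k,
       (forall x : idx, x \in indices m k ->
          eps R m k a - alpha R c <> eps R m k x /\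
          eps R m k b + alpha R c <> eps R m k x) ->
       qp (wform (alpha R c) (eps R m k b)) *: (sigma b a * UE q qp c)
       - ((-1) ^+ ((a.1 (+) b.1) && spar c)
          * qp (- wform (alpha R c) (eps R m k a))) *: (UE q qp c * sigma b a) = 0) /\
    (forall a b c : idx,
       a \in indices m k -> b \in indices m k -> c \in indices m k ->
       wlt m k c b -> wlt m k a c -> c <> ibar m k b -> c <> ibar m k a ->
       sigma b a =
         qp (- wform (eps R m k b) (eps R m k a)) *: (sigma b c * sigma c a)
         - (qp (- wform (eps R m k c) (eps R m k c))
            * (-1) ^+ ((b.1 (+) c.1) && (a.1 (+) c.1))) *: (sigma c a * sigma b c)) /\
    (forall i : 'I_(m./2), (i.+1 < m./2)%N ->
       sigma (ev i.+1) (ev i.+2) = qp 2^-1 *: UE q qp (sE k i) /\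
       - sigma (ibar m k (ev i.+2)) (ibar m k (ev i.+1)) =
         qp 2^-1 *: UE q qp (sE k i)) /\
    (forall i : 'I_(m./2), i.+1 = m./2 -> ~~ odd m ->
       sigma (ev i) (ibar m k (ev i.+1)) = qp 2^-1 *: UE q qp (sE k i) /\
       - sigma (ev i.+1) (ibar m k (ev i)) = qp 2^-1 *: UE q qp (sE k i) /\
       sigma (ev i.+1) (ibar m k (ev i.+1)) = 0) /\
    (forall i : 'I_(m./2), i.+1 = m./2 -> odd m ->
       sigma (ev i.+1) (ev i.+2) = UE q qp (sE k i) /\
       - (qp (- 2^-1) *: sigma (ev i.+2) (ibar m k (ev i.+1))) = UE q qp (sE k i)) /\
    (forall mu : 'I_k.-1,
       sigma (od mu.+1) (od mu.+2) = qp (- 2^-1) *: UE q qp (sO m mu) /\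
       sigma (ibar m k (od mu.+2)) (ibar m k (od mu.+1)) =
         qp (- 2^-1) *: UE q qp (sO m mu)) /\
    sigma (od k) (ev 1) = qp 2^-1 *: UE q qp (sS m k) /\
    ((-1) ^+ k * q) *: sigma (ibar m k (ev 1)) (ibar m k (od k)) =
      qp 2^-1 *: UE q qp (sS m k).
Proof.
exists (lax_sigma hm V cR).
split; first exact: (lax_factored hm hk hq0 hq hqp1 hqpD hDelta hV hR).
split; first exact: (lax_formula hm hk hq0 hq hqp1 hqpD hDelta hV hR).
split; first by move=> a b ha hb _ c; apply: (sigma_commute hm hq0 hqp1 hqpD hDelta hV hR).
split; first by move=> a b c; apply: (sigma_recursion hm hk hq0 hq hqp1 hqpD hDelta hV hR).
split; first by move=> i; apply: (sigma_even hm hk hq0 hq hqp1 hqpD hDelta hV hR).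
split.
  move=> i hi ho.
  have [e1 e2] := sigma_even_last hm hk hq0 hq hqp1 hqpD hDelta hV hR hi ho.
  by do !split=> //; apply: (sigma_mid0 hm hk hq0 hq hqp1 hqpD hDelta hV hR hi ho).
split; first by move=> i; apply: (sigma_odd_last hm hk hq0 hq hqp1 hqpD hDelta hV hR).
split; first exact: (sigma_odd hm hk hq0 hq hqp1 hqpD hDelta hV hR).
exact: (sigma_super hm hk hq0 hq hqp1 hqpD hDelta hV hR).
Qed.
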